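(* Let $M$ be a simple minimally $3$-degenerate matroid. Then $|E(M)|\leq 2r(M)$. Moreover, equality is attained if and only if at least one of the following holds: (i) $M$ is (isomorphic to) the cycle matroid $M(\mathcal{W}_k)$ of a wheel $\mathcal{W}_k$ for some $k\geq 3$; (ii) $M$ is (isomorphic to) a whirl $\mathcal{W}^k$ for some $k\geq 2$; (iii) $M=M_1\oplus_2 M_2$ is a $2$-sum at a basepoint $p$ where, for each $i\in\{1,2\}$, the matroid $M_i$ is one of the matroids described in (i) or (ii) and $p$ is a spoke of $M_i$.
   Context: All matroids are finite, loopless, with non-empty ground set; all restrictions considered are non-empty. The cogirth $g^*(M)$ is the size of a smallest cocircuit of $M$. For an integer $k\geq 2$, a loopless matroid $M$ is minimally $k$-degenerate if $g^*(M)=k$ and every proper (non-empty) restriction of $M$ has cogirth at most $k-1$. For $k\ge 2$, the wheel graph $\mathcal{W}_k$ consists of a $k$-cycle (the rim; for $k=2$ this is two parallel edges) together with an additional vertex (the hub) adjacent to all vertices of the cycle via edges called spokes. By convention every edge of $\mathcal{W}_3\cong K_4$ is a spoke (any vertex of $K_4$ can serve as the hub). The spokes of the cycle matroid $M(\mathcal{W}_k)$ are the spokes of $\mathcal{W}_k$. The whirl $\mathcal{W}^k$ is obtained from $M(\mathcal{W}_k)$ by relaxing the circuit-hyperplane consisting of the rim (so $\mathcal{W}^2\cong U_{2,4}$); its spokes are the elements that lie in more than one triangle ($3$-element circuit); in particular every element of $\mathcal{W}^2$ is a spoke. If $E(M_1)\cap E(M_2)=\{p\}$, $|E(M_1)|,|E(M_2)|\ge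 3$, and $p$ is neither a loop nor a coloop of $M_1$ or $M_2$, the $2$-sum $M_1\oplus_2 M_2$ at basepoint $p$ is the matroid on $(E(M_1)\cup E(M_2))-\{p\}$ whose circuits are the circuits of $M_1$ avoiding $p$, the circuits of $M_2$ avoiding $p$, and the sets $(C_1\cup C_2)-\{p\}$ where $C_i$ is a circuit of $M_i$ containing $p$ for $i=1,2$. *)

(* Defs.v *)
From mathcomp Require Import all_boot.
Set Implicit Arguments.
Unset Strict Implicit.
Unset Printing Implicit Defensive.

(* The ground set is a subset of an ambient finite type, so that restrictions
   and 2-sums need no change of type. *)
Record matroid (T : finType) := Matroid {
  ground : {set T};
  indep : {set {set T}};
  indep_ground : forall I : {set T}, I \in indep -> I \subset ground;
  indep_set0 : set0 \in indep;
  indep_subset : forall I J : {set T},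
    J \in indep -> I \subset J -> I \in indep;
  indep_augment : forall I J : {set T},
    I \in indep -> J \in indep -> #|I| < #|J| ->
    exists2 x, x \in J :\: I & x |: I \in indep }.

Section MatroidNotions.
Variables (T : finType) (M : matroid T).

Definition bases : {set {set T}} :=
  [set B | maxset [pred I | I \in indep M] B].

Definition circuits : {set {set T}} :=
  [set C | minset [pred X : {set T} | (X \subset ground M)
                                      && (X \notin indep M)] C].

(* Independence in the dual matroid: X lies in the complement of a basis. *)
Definition coindep : {set {set T}} :=
  [set X : {set T} | [exists B in bases, X \subset ground M :\: B]].

Definition cocircuits : {set {set T}} :=
  [set C | minset [pred X : {set T} | (X \subset ground M)
                                      && (X \notin coindep)] C].

Definition rank (X : {set T}) : nat :=
  \max_(I in indep M | I \subset X) #|I|.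

Definition mrank : nat := rank (ground M).

(* A loopless matroid on a non-empty ground set has positive rank, hence a
   cocircuit; the value #|ground M| of the empty minimum is then not used. *)
Definition cogirth : nat := \big[minn/#|ground M|]_(C in cocircuits) #|C|.

Definition loop (x : T) : Prop := [set x] \in circuits.

Definition coloop (x : T) : Prop :=
  x \in ground M /\ forall B, B \in bases -> x \in B.

Definition loopless : Prop := forall x, ~ loop x.

Definition simple : Prop := forall C, C \in circuits -> 3 <= #|C|.

Definition flat (F : {set T}) : Prop :=
  F \subset ground M /\
  forall x, x \in ground M :\: F -> rank F < rank (x |: F).

Definition hyperplane (H : {set T}) : Prop :=
  flat H /\ (rank H).+1 = mrank.

Definition triangles : {set {set T}} := [set C in circuits | #|C| == 3].

Variable A : {set T}.

Let restr_indep : {set {set T}} := [set I in indep M | I \subset A].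

Let restr_ground (I : {set T}) :
  I \in restr_indep -> I \subset ground M :&: A.
Proof.
by rewrite inE subsetI => /andP[/indep_ground -> ->].
Qed.

Let restr_set0 : set0 \in restr_indep.
Proof. by rewrite inE indep_set0 sub0set. Qed.

Let restr_subset (I J : {set T}) :
  J \in restr_indep -> I \subset J -> I \in restr_indep.
Proof.
rewrite !inE => /andP[indJ sJA] sIJ.
by rewrite (indep_subset indJ sIJ) (subset_trans sIJ sJA).
Qed.

Let restr_augment (I J : {set T}) :
  I \in restr_indep -> J \in restr_indep -> #|I| < #|J| ->
  exists2 x, x \in J :\: I & x |: I \in restr_indep.
Proof.
rewrite !inE => /andP[indI sIA] /andP[indJ sJA] ltIJ.
have [x xJI indxI] := indep_augment indI indJ ltIJ.
exists x => //; rewrite inE indxI subUset sub1set sIA andbT.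
by move: xJI; rewrite inE => /andP[_ /(subsetP sJA)].
Qed.

Definition restrict : matroid T :=
  Matroid restr_ground restr_set0 restr_subset restr_augment.

End MatroidNotions.

Definition minimally_degenerate (k : nat) (T : finType) (M : matroid T) : Prop :=
  [/\ 2 <= k, ground M != set0, loopless M, cogirth M = k &
      forall A : {set T}, A \proper ground M -> A != set0 ->
        cogirth (restrict M A) <= k.-1].

Definition isomorphism (T U : finType) (M : matroid T) (N : matroid U)
    (f : T -> U) : Prop :=
  [/\ {in ground M &, injective f}, f @: ground M = ground N &
      forall I : {set T}, I \subset ground M ->
        (I \in indep M) = (f @: I \in indep N)].

Definition isomorphic (T U : finType) (M : matroid T) (N : matroid U) : Prop :=
  exists f : T -> U, isomorphism M N f.

(* A multigraph is given by the map [ends] from edges to sets of one (for a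
   loop) or two end vertices. *)
Definition edge_set_of_cycle (V E : finType) (ends : E -> {set V})
    (C : {set E}) : Prop :=
  exists (n : nat) (v : 'I_n -> V) (e : 'I_n -> E),
    [/\ 0 < n, injective v, injective e,
        forall i, ends (e i) = [set v i; v (ordS i)] &
        C = [set e i | i : 'I_n]].

Definition is_cycle_matroid (V E : finType) (ends : E -> {set V})
    (N : matroid E) : Prop :=
  ground N = [set: E] /\
  forall C : {set E}, C \in circuits N <-> edge_set_of_cycle ends C.

(* The hub is [None]; [inl i] is the rim edge from [Some i] to its cyclic
   successor and [inr i] is the spoke at [Some i]. *)
Definition wheel_vertex (k : nat) : finType := option 'I_k.
Definition wheel_edge (k : nat) : finType := ('I_k + 'I_k)%type.

Definition wheel_ends (k : nat) (e : wheel_edge k) : {set wheel_vertex k} :=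
  match e with
  | inl i => [set Some i; Some (ordS i)]
  | inr i => [set None; Some i]
  end.

Definition wheel_rim (k : nat) : {set wheel_edge k} :=
  [set (inl i : wheel_edge k) | i : 'I_k].

(* Every edge of the wheel with three spokes counts as a spoke. *)
Definition wheel_spoke (k : nat) (e : wheel_edge k) : Prop :=
  k = 3 \/ exists i : 'I_k, e = inr i.

Definition is_wheel_matroid (k : nat) (N : matroid (wheel_edge k)) : Prop :=
  is_cycle_matroid (@wheel_ends k) N.

Definition is_relaxation (T : finType) (M : matroid T) (H : {set T})
    (N : matroid T) : Prop :=
  [/\ H \in circuits M, hyperplane M H, ground N = ground M &
      bases N = H |: bases M].

Definition is_whirl (k : nat) (N : matroid (wheel_edge k)) : Prop :=
  exists2 W : matroid (wheel_edge k),
    is_wheel_matroid W & is_relaxation W (wheel_rim k) N.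

Definition wheel_type (T : finType) (M : matroid T) : Prop :=
  exists (k : nat) (N : matroid (wheel_edge k)),
    [/\ 3 <= k, is_wheel_matroid N & isomorphic M N].

Definition whirl_type (T : finType) (M : matroid T) : Prop :=
  exists (k : nat) (N : matroid (wheel_edge k)),
    [/\ 2 <= k, is_whirl N & isomorphic M N].

Definition wheel_type_with_spoke (T : finType) (M : matroid T) (p : T) : Prop :=
  exists (k : nat) (N : matroid (wheel_edge k)) (f : T -> wheel_edge k),
    [/\ 3 <= k, is_wheel_matroid N, isomorphism M N f,
        p \in ground M & wheel_spoke (f p)].

Definition whirl_type_with_spoke (T : finType) (M : matroid T) (p : T) : Prop :=
  [/\ whirl_type M, p \in ground M & 1 < #|[set C in triangles M | p \in C]|].

Definition is_two_sum (T : finType) (M1 M2 : matroid T) (p : T)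
    (N : matroid T) : Prop :=
  [/\ ground M1 :&: ground M2 = [set p],
      3 <= #|ground M1| /\ 3 <= #|ground M2|,
      [/\ ~ loop M1 p, ~ coloop M1 p, ~ loop M2 p & ~ coloop M2 p],
      ground N = (ground M1 :|: ground M2) :\ p &
      circuits N =
        [set C in circuits M1 | p \notin C]
        :|: [set C in circuits M2 | p \notin C]
        :|: [set (C1 :|: C2) :\ p | C1 in [set C in circuits M1 | p \in C],
                                    C2 in [set C in circuits M2 | p \in C]]].

Definition two_sum_type (T : finType) (M : matroid T) : Prop :=
  exists (U : finType) (M1 M2 N : matroid U) (p : U),
    [/\ is_two_sum M1 M2 p N, isomorphic M N,
        wheel_type_with_spoke M1 p \/ whirl_type_with_spoke M1 p &
        wheel_type_with_spoke M2 p \/ whirl_type_with_spoke M2 p].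

(* Main.v *)
(* Put f(X) = 2 r(X) - |X|. Removing a cocircuit of size at most 2 lowers the
   rank by 1, so peeling off such cocircuits until one element is left gives
   f(X) >= 1 for every proper non-empty X, hence f(E) >= 0. Suppose f(E) = 0 and
   call X tight if f(X) = 1. Tight sets have odd size, |E| is even, and by
   submodularity two tight sets that meet and do not cover E have tight meet and
   join; complementation (matroid duality) preserves all this. Minimal
   degeneracy adds that every tight set with more than one element stays tight
   after the removal of a suitable pair.

   If A and E - A are never both tight except when one is a singleton (no
   2-separation), every element x lies in a tight triple: otherwise the
   complements of the minimal tight sets W containing x, W <> {x}, would be odd
   blocks that partition the odd set E - x and that the peeling pairs of the
   sets W match two by two. Dually x lies in a triad. Triangles and triads then
   chain up cyclically, and every circuit contains a cycle of the corresponding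
   wheel graph since it never meets a triad in one element; so M is a wheel or,
   if the rim is independent, a whirl.

   For a 2-separation (A, B) the two parts of the 2-sum are extremal again. Two
   disjoint sides of 2-separations that miss an element x cannot exist, as
   E - x could not be peeled; hence both parts have no 2-separation. The same
   argument yields, for each x in A, a triangle through the basepoint avoiding
   x, so the basepoint lies in two triangles and is a spoke. *)

Require Import Defs.
From mathcomp Require Import all_boot.
From mathcomp Require Import zify.

Set Implicit Arguments.
Unset Strict Implicit.
Unset Printing Implicit Defensive.

(** * Tight families *)

(** The combinatorics is carried out for an abstract family of tight sets that is closed under
    complementation, so the dual matroid is never constructed. Peelability is kept apart, as it is
    not obviously inherited by the complements. It yields the triads at once: [E :\ x] is tight, and
    a peeling pair of it forms a triad together with [x]. The triangles are the hard half. Once both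
    kinds of triple are available, the chaining argument is symmetric and uses no further peeling.

    Chaining joins two or more triples and needs the union, or its complement, to be neither the
    ground set nor too small. This is why it starts at eight elements; ground sets with four and six
    elements are labelled directly.

    For the reverse direction of the equivalence it suffices to compute sizes and ranks, since
    minimal degeneracy of [M] is assumed throughout. *)

Section TightFamilies.
Variable T : finType.
Implicit Types (x y : T) (D E F R V W X Y : {set T}).

(** Oddness is the parity of [f X = 1]; many later contradictions just exhibit a tight set of even
    size. The condition [X :|: Y != E] is there because [f] vanishes on the ground set, where
    submodularity no longer forces the meet to be tight. *)
Record tight_family E (tau : pred {set T}) : Prop := TightFamily {
  tight_sub X : tau X -> X \subset E;
  tight_odd X : tau X -> odd #|X|;
  ground_even : ~~ odd #|E|;
  tight_meet_join X Y : tau X -> tau Y -> X :&: Y != set0 -> X :|: Y != E ->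
    tau (X :&: Y) /\ tau (X :|: Y);
  tight_set1 x : x \in E -> tau [set x];
  tight_setD1 x : x \in E -> tau (E :\ x) }.

Definition peelable (tau : pred {set T}) : Prop :=
  forall X, tau X -> 1 < #|X| ->
    exists D, [/\ D \subset X, #|D| = 2 & tau (X :\: D)].

(** A tight set with tight complement is a side of a 2-separation: since [f E = 0], the two ranks
    add up to the full rank plus one. Singletons are exempt, as they and their complements are
    always tight. *)
Definition unsplittable E (tau : pred {set T}) : Prop :=
  forall X, tau X -> tau (E :\: X) -> #|X| = 1 \/ #|E :\: X| = 1.

Section Basics.
Variables (E : {set T}) (tau : pred {set T}).
Hypothesis tauE : tight_family E tau.

Lemma tight_neq0 X : tau X -> X != set0.
Proof. by move/(tight_odd tauE); apply: contraTneq => ->; rewrite cards0. Qed.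

Lemma tight_neq_ground X : tau X -> X != E.
Proof.
by move/(tight_odd tauE); apply: contraTneq => ->; exact: ground_even tauE.
Qed.

Lemma tight_proper X : tau X -> X \proper E.
Proof.
by move=> tX; rewrite properEneq (tight_neq_ground tX) (tight_sub tauE tX).
Qed.

Lemma subset_tight_neq X Y : tau Y -> X \subset Y -> X != E.
Proof.
move=> tY sXY; apply: contraNneq (tight_neq_ground tY) => eX.
by rewrite eqEsubset (tight_sub tauE tY) -eX sXY.
Qed.

Lemma tight_meet X Y :
  tau X -> tau Y -> X :&: Y != set0 -> X :|: Y != E -> tau (X :&: Y).
Proof. by move=> tX tY n0 nE; case: (tight_meet_join tauE tX tY n0 nE). Qed.

Lemma tight_join X Y :
  tau X -> tau Y -> X :&: Y != set0 -> X :|: Y != E -> tau (X :|: Y).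
Proof. by move=> tX tY n0 nE; case: (tight_meet_join tauE tX tY n0 nE). Qed.

(** The set [V :\: D] is the meet of [W :\: D] and [V], hence tight and odd; since [V] is odd too,
    [D] meets [V] in zero or two elements. *)
Lemma tight_peel_sub W V D :
    tau W -> tau V -> V \subset W -> D \subset W -> #|D| = 2 ->
    tau (W :\: D) -> 2 < #|V| ->
  (D \subset V /\ tau (V :\: D)) \/ [disjoint D & V].
Proof.
move=> tW tV sVW sDW D2 tWD V3.
have eVD : (W :\: D) :&: V = V :\: D.
  apply/setP=> z; rewrite !inE; case zV: (z \in V); last by rewrite !andbF.
  by rewrite (subsetP sVW) ?andbT.
have cVD : #|V :\: D| = #|V| - #|V :&: D| by rewrite cardsD.
have leD : #|V :&: D| <= 2 by rewrite -D2 subset_leq_card ?subsetIr.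
have nVD : V :\: D != set0 by rewrite -card_gt0; lia.
have tVD : tau (V :\: D).
  rewrite -eVD; apply: tight_meet; rewrite ?eVD //.
  apply: (subset_tight_neq tW).
  by rewrite subUset sVW andbT subsetDl.
have := tight_odd tauE tV; have := tight_odd tauE tVD.
rewrite cVD => o1 o2.
have [D0|D0] := posnP #|V :&: D|.
  by right; rewrite disjoint_sym -setI_eq0 -cards_eq0 D0.
left; split=> //; suff: #|V :&: D| = 2.
  move=> e2; apply/setIidPr/eqP; rewrite eqEcard subsetIr /=; lia.
by lia.
Qed.

End Basics.

(* The complements of the sets of a tight family form a tight family; this is
   the effect of matroid duality. *)
Definition cotight E (tau : pred {set T}) : pred {set T} :=
  [pred X : {set T} | (X \subset E) && tau (E :\: X)].

Lemma cotight_family E tau : tight_family E tau -> tight_family E (cotight E tau).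
Proof.
move=> tE; split=> [X|X||X Y|x xE|x xE] /=.
- by case/andP.
- case/andP=> sX /(tight_odd tE); have := ground_even tE.
  rewrite cardsD (setIidPr sX); have := subset_leq_card sX; lia.
- exact: ground_even tE.
- case/andP=> sX tX /andP[sY tY] n0 nE.
  have e1 : E :\: (X :&: Y) = (E :\: X) :|: (E :\: Y) by rewrite setDIr.
  have e2 : E :\: (X :|: Y) = (E :\: X) :&: (E :\: Y) by rewrite setDUr.
  rewrite /cotight /= (subset_trans (subsetIl _ _) sX) subUset sX sY e1 e2 /=.
  have [||-> ->//] := tight_meet_join tE tX tY.
    rewrite -e2; apply: contraNneq nE => e; rewrite eqEsubset subUset sX sY /=.
    by rewrite -setD_eq0 e.
  rewrite -e1; apply: contraNneq n0 => e; rewrite -subset0.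
  apply/subsetP=> z zXY; have: z \in E :\: (X :&: Y).
    by rewrite e; move: zXY; rewrite inE => /andP[/(subsetP sX)].
  by rewrite in_setD zXY.
- by rewrite /cotight /= sub1set xE; exact: (tight_setD1 tE xE).
- rewrite /cotight /= subD1set setDDr setDv set0U; rewrite (setIidPr _) ?sub1set //.
  exact: (tight_set1 tE xE).
Qed.

(** * Triangles and triads through every element *)

Section SmallTightSets.
Variables (E : {set T}) (tau : pred {set T}).
Hypotheses (tauE : tight_family E tau) (peel : peelable tau).
Hypotheses (conn : unsplittable E tau) (E4 : 3 < #|E|).

Lemma cotight3_exists x :
  x \in E -> exists t, [/\ cotight E tau t, #|t| = 3 & x \in t].
Proof.
move=> xE; have tEx := tight_setD1 tauE xE.
have cEx : #|E :\ x|.+1 = #|E| by rewrite [in RHS](cardsD1 x) xE.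
have [|D [sD D2 tD]] := peel tEx; first by lia.
exists (x |: D); rewrite !inE eqxx /=; split=> //; last first.
  by rewrite cardsU1 D2; case: (boolP (x \in D)) => // /(subsetP sD); rewrite !inE eqxx.
rewrite /cotight /= subUset sub1set xE (subset_trans sD (subsetDl _ _)) /=.
by rewrite setDDl in tD.
Qed.

Section NoTriangle.
Variable x : T.
Hypothesis xE : x \in E.
Hypothesis no3 : forall t, tau t -> x \in t -> #|t| != 3.

Let cand := [pred W : {set T} | [&& tau W, x \in W & 1 < #|W|]].
Let WW := [set W | minset cand W].

Let WWP W : W \in WW -> [/\ tau W, x \in W & 4 < #|W|].
Proof.
rewrite inE => /minsetp /and3P[tW xW W1]; split=> //.
by have := no3 tW xW; have := tight_odd tauE tW; lia.
Qed.

Let WWmin W V : W \in WW -> tau V -> x \in V -> 1 < #|V| -> V \subset W -> V = W.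
Proof. by rewrite inE => /minsetP[_ m] tV xV V1 sVW; apply: m => //=; apply/and3P. Qed.

(** The tight set [E :\ c] contains a minimal candidate. Hence the complements of the members of
    [WW], the blocks, cover [E :\ x]; [cover] makes them pairwise disjoint. *)
Let avoid c : c \in E -> c != x -> exists2 W, W \in WW & c \notin W.
Proof.
move=> cE cx; have tEc := tight_setD1 tauE cE.
have: cand (E :\ c).
  rewrite /= tEc !inE eq_sym cx xE /=.
  have := cardsD1 c E; rewrite cE; lia.
case/minset_exists=> W mW sW; exists W; first by rewrite inE.
by apply/negP=> /(subsetP sW); rewrite !inE eqxx.
Qed.

(** If [x] survived the peeling, [W :\: D] would be a smaller candidate. *)
Let pairP W D : W \in WW -> D \subset W -> #|D| = 2 -> tau (W :\: D) -> x \in D.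
Proof.
move=> WW_W sD D2 tD; have [tW xW W5] := WWP WW_W.
apply/negPn/negP=> xD; have := WWmin WW_W tD.
have c : #|W :\: D| = #|W| - 2 by rewrite cardsD (setIidPr sD) D2.
rewrite inE xD xW subsetDl => /(_ isT) H.
have /setP/(_ _) e : W :\: D = W by apply: H => //; rewrite c; lia.
have /card_gt0P[d dD] : 0 < #|D| by rewrite D2.
by have := e d; rewrite inE dD /= (subsetP sD _ dD).
Qed.

(** Otherwise the meet is tight, so it is [[set x]] by minimality, and the join is tight and can be
    peeled. The pair lies inside or outside each of [W] and [V]. Both inside is too much for a
    one-element meet, both outside is impossible, and exactly one inside contradicts [pairP],
    because the other set contains [x]. *)
Let cover W V : W \in WW -> V \in WW -> W != V -> W :|: V = E.
Proof.
move=> hW hV WV; apply/eqP/negPn/negP=> nE.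
have [tW xW W5] := WWP hW; have [tV xV V5] := WWP hV.
have n0 : W :&: V != set0 by apply/set0Pn; exists x; rewrite inE xW.
have [tI tU] := tight_meet_join tauE tW tV n0 nE.
have eI : W :&: V = [set x].
  apply/eqP; rewrite eqEsubset sub1set inE xW xV !andbT.
  apply/negPn/negP=> nI.
  have I1 : 1 < #|W :&: V|.
    rewrite ltnNge; apply: contra nI => /card_le1_eqP le1.
    by apply/subsetP=> z zI; rewrite in_set1 (le1 z x) // !inE xW.
  have xI : x \in W :&: V by rewrite inE xW.
  have e1 := WWmin hW tI xI I1 (subsetIl _ _).
  have e2 := WWmin hV tI xI I1 (subsetIr _ _).
  by rewrite -e1 e2 eqxx in WV.
have [|D [sD D2 tD]] := peel tU.
  by apply: leq_trans (subset_leq_card (subsetUl W V)); apply: leq_trans W5.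
have hWD := tight_peel_sub tauE tU tW (subsetUl _ _) sD D2 tD (ltnW (ltnW W5)).
have hVD := tight_peel_sub tauE tU tV (subsetUr _ _) sD D2 tD (ltnW (ltnW V5)).
have [D_W|D_W] := hWD; have [D_V|D_V] := hVD.
- have: D \subset W :&: V by rewrite subsetI D_W.1 D_V.1.
  by rewrite eI => /subset_leq_card; rewrite D2 cards1.
- have := pairP hW D_W.1 D2 D_W.2 => xD.
  by rewrite (disjointFr D_V xD) in xV.
- have := pairP hV D_V.1 D2 D_V.2 => xD.
  by rewrite (disjointFr D_W xD) in xW.
have /card_gt0P[d dD] : 0 < #|D| by rewrite D2.
have := subsetP sD _ dD; rewrite inE.
by rewrite (disjointFr D_W dD) (disjointFr D_V dD).
Qed.

(** The matching of blocks: if [W] is peeled by the pair [[set x; y]], its partner is the [V] whose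
    block contains [y]. Expressing this by tightness makes the relation symmetric. *)
Let adj W V := [&& W \in WW, V \in WW, W != V & tau ((W :&: V) :\ x)].

Let adjC W V : adj W V = adj V W.
Proof. by rewrite /adj setIC eq_sym; do 2 case: (_ \in WW). Qed.

Let adj_exists W : W \in WW -> exists V, adj W V.
Proof.
move=> hW; have [tW xW W5] := WWP hW.
have [|D [sD D2 tD]] := peel tW; first by lia.
have xD := pairP hW sD D2 tD.
have /card_gt0P[y] : 0 < #|D :\ x| by have := cardsD1 x D; rewrite xD D2; lia.
rewrite !inE => /andP[yx yD].
have eD : D = [set x; y].
  apply/esym/eqP; rewrite eqEcard subUset !sub1set xD yD D2 cards2 eq_sym yx.
  by [].
have yE : y \in E by rewrite (subsetP (tight_sub tauE tW)) // (subsetP sD).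
have [V hV yV] := avoid yE yx; have [tV xV V5] := WWP hV.
have WV : W != V.
  by apply: contraNneq yV => <-; rewrite (subsetP sD).
exists V; rewrite /adj hW hV WV /=.
have eI : (W :&: V) :\ x = (W :\: D) :&: V.
  apply/setP=> z; rewrite eD !inE; case zV: (z \in V); rewrite ?andbT ?andbF //.
  by case: (eqVneq z y) => [zy|]; [rewrite zy (negPf yV) in zV | rewrite orbF].
rewrite eI; apply: (tight_meet tauE tD tV).
  (* The sizes of [W] and [V] are odd and that of their union [E] is even, so the meet has even size
     and contains an element besides [x]. *)
  have WuV := cover hW hV WV.
  have cU : #|W| + #|V| = #|E| + #|W :&: V| by rewrite -WuV cardsUI.
  have /(congr1 odd) := cU.
  rewrite !oddD (tight_odd tauE tW) (tight_odd tauE tV) (negPf (ground_even tauE)).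
  rewrite -eI -card_gt0 (cardsD1 x (W :&: V)) inE xW xV.
  by case: #|_|.
apply: contraNneq yV => e.
by move: yE; rewrite -e !inE yD.
Qed.

(** With two partners, the two tight sets have union [W :\ x], which is even; so they cannot meet,
    as their join would be tight. Being disjoint, they are the complements of [V'] and [V], hence
    singletons by [conn], and [W] would have only three elements. *)
Let adj_uniq W V V' : adj W V -> adj W V' -> V = V'.
Proof.
move=> /and4P[hW hV WV tF] /and4P[_ hV' WV' tF']; apply/eqP/negPn/negP=> VV'.
have [tW xW W5] := WWP hW; have [tV xV V5] := WWP hV.
have [tV' xV' V'5] := WWP hV'.
have EV := cover hW hV WV; have EV' := cover hW hV' WV'; have EVV := cover hV hV' VV'.
have eU : ((W :&: V) :\ x) :|: ((W :&: V') :\ x) = W :\ x.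
  apply/setP=> z; rewrite !inE; case: eqP => //= _.
  case zW: (z \in W) => //=; have := tight_sub tauE tW.
  by move/subsetP/(_ z zW); rewrite -EVV inE.
have nE : ((W :&: V) :\ x) :|: ((W :&: V') :\ x) != E.
  by rewrite eU; apply: (subset_tight_neq tauE tW (subsetDl _ _)).
have cWx : #|W :\ x|.+1 = #|W| by rewrite [in RHS](cardsD1 x) xW.
have I0 : ((W :&: V) :\ x) :&: ((W :&: V') :\ x) = set0.
  apply/eqP/negPn/negP=> n0.
  have := tight_join tauE tF tF' n0 nE; rewrite eU => /(tight_odd tauE).
  by have := tight_odd tauE tW; rewrite -cWx /= => /negPf->.
have compl_eq A B : A \in WW -> B \in WW -> W :|: B = E -> A :|: B = E ->
   ((W :&: A) :\ x) :&: ((W :&: B) :\ x) = set0 ->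
   (W :&: A) :\ x = E :\: B.
  move=> hA hB eWB eAB /setP i0; apply/setP=> z; have [tB xB _] := WWP hB.
  have [tA _ _] := WWP hA.
  have := i0 z; rewrite !inE; case: eqP => [->|_] /=; first by rewrite xB.
  case zE: (z \in E); last first.
    rewrite andbF => _; apply/negP=> /andP[zW _].
    by rewrite (subsetP (tight_sub tauE tW)) in zE.
  by move: (zE) (zE); rewrite -{1}eWB -eAB !inE; do 3 case: (z \in _).
have e1 : (W :&: V) :\ x = E :\: V' by apply: compl_eq.
have e2 : (W :&: V') :\ x = E :\: V.
  by apply: compl_eq; rewrite // 1?setUC // setIC.
have c1 : #|(W :&: V) :\ x| = 1.
  by rewrite e1; have [|V'1|//] := conn tV'; [rewrite -e1 | rewrite V'1 in V'5].
have c2 : #|(W :&: V') :\ x| = 1.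
  by rewrite e2; have [|V1|//] := conn tV; [rewrite -e2 | rewrite V1 in V5].
have := cardsUI ((W :&: V) :\ x) ((W :&: V') :\ x).
by rewrite eU I0 cards0 c1 c2 addn0 => cW; move: W5; rewrite -cWx cW.
Qed.

(** Tight unions of blocks that are closed under the matching. Descent to a minimal one replaces
    counting the matched odd blocks. *)
Let blocky := [pred R : {set T} | [&& tau R, x \notin R,
  [forall W in WW, (E :\: W \subset R) || [disjoint E :\: W & R]] &
  [forall W, forall V, adj W V ==> (E :\: W \subset R) ==> (E :\: V \subset R)]]].

Lemma no_triangle_absurd : False.
Proof.
have tEx := tight_setD1 tauE xE.
have: blocky (E :\ x).
  have sWE W : W \in WW -> E :\: W \subset E :\ x.
    move=> /WWP[_ xW _]; apply/subsetP=> z; rewrite !inE => /andP[zW ->].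
    by rewrite andbT; apply: contraNneq zW => ->.
  rewrite /= tEx !inE eqxx /=; apply/andP; split.
    by apply/forall_inP=> W hW; rewrite sWE.
  apply/forallP=> W; apply/forallP=> V; apply/implyP=> /and4P[_ hV _ _].
  by apply/implyP=> _; apply: sWE.
case/minset_exists=> R /minsetP[/and4P[tR xR /forall_inP blk /forallP clo] minR] _.
have /set0Pn[c cR] := tight_neq0 tauE tR.
have cE := subsetP (tight_sub tauE tR) _ cR.
have cx : c != x by apply: contraNneq xR => <-.
have [W hW cW] := avoid cE cx.
have sWR : E :\: W \subset R.
  have /orP[//|d] := blk _ hW.
  by move: (disjointFl d cR); rewrite !inE cW cE.
have [V aWV] := adj_exists hW.
have /and4P[_ hV WV tF] := aWV.
have sVR : E :\: V \subset R.
  by have := clo W => /forallP/(_ V); rewrite aWV sWR.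
have [tW xW W5] := WWP hW; have [tV xV V5] := WWP hV.
have eF : R :&: ((W :&: V) :\ x) = R :&: (W :&: V).
  apply/setP=> z; rewrite !inE; case: eqP => [->|//].
  by rewrite (negPf xR).
have sRE := tight_sub tauE tR.
have tR' : tau (R :&: (W :&: V)).
  rewrite -eF; apply: (tight_meet tauE tR tF).
    rewrite eF.
    have eR : R = (R :&: (W :&: V)) :|: ((E :\: W) :|: (E :\: V)).
      apply/eqP; rewrite eqEsubset !subUset subsetIl sWR sVR !andbT.
      apply/subsetP=> z zR; rewrite !inE zR (subsetP sRE _ zR) !andbT.
      by case: (z \in W); case: (z \in V).
    (* Two disjoint odd blocks have even total size, so they do not exhaust the odd set [R]. *)
    apply: contraTneq (tight_odd tauE tR) => e; rewrite eR e set0U.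
    have := cardsUI (E :\: W) (E :\: V).
    rewrite -setDUr (cover hW hV WV) setDv cards0 addn0 => ->.
    rewrite oddD !cardsD !(setIidPr (tight_sub tauE _)) //.
    rewrite !oddB ?subset_leq_card ?(tight_sub tauE) //.
    by rewrite (tight_odd tauE tW) (tight_odd tauE tV); case: odd.
  apply: (subset_tight_neq tauE tEx); apply/subsetP=> z; rewrite !inE.
  case/orP=> [zR|/and3P[-> zW _]]; last by rewrite (subsetP (tight_sub tauE tW)).
  by rewrite (subsetP sRE) // andbT; apply: contraNneq xR => <-.
(* Removing the matched blocks of [W] and [V] leaves a blocky set, so minimality says that nothing
   was removed; but [c] lies in the block of [W]. *)
have: R :&: (W :&: V) = R.
  apply: minR (subsetIl _ _); rewrite /= tR' !inE (negPf xR) /=.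
  have covered U : U \in WW -> U != W -> U != V -> E :\: U \subset W :&: V.
    move=> hU UW UV; apply/subsetP=> z; rewrite !inE => /andP[zU zE].
    move: (zE) (zE); rewrite -{1}(cover hU hW UW) -(cover hU hV UV) !inE.
    by rewrite (negPf zU) /= => -> ->.
  have dis U : U \in WW -> (U == W) || (U == V) ->
      [disjoint E :\: U & R :&: (W :&: V)].
    move=> hU UWV; rewrite -setI_eq0; apply/eqP/setP=> z; rewrite !inE.
    by case/orP: UWV => /eqP->; case: (z \in W); case: (z \in V);
       rewrite /= ?andbF //.
  apply/andP; split.
    apply/forall_inP=> U hU; case: (boolP ((U == W) || (U == V))) => [h|].
      by rewrite dis // orbT.
    rewrite negb_or => /andP[UW UV].
    have sU := covered U hU UW UV.
    have /orP[s|d] := blk _ hU; first by rewrite subsetI s sU.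
    by rewrite (disjointWr _ d) ?orbT ?subsetIl.
  apply/forallP=> U; apply/forallP=> U'; apply/implyP=> aU; apply/implyP=> sU.
  have /and4P[hU hU' UU' _] := aU.
  have nU : (U != W) && (U != V).
    rewrite -negb_or; apply/negP=> h.
    have := dis U hU h; rewrite -setI_eq0 (setIidPl sU) => e0.
    have [tU _ _] := WWP hU.
    move: (tight_neq_ground tauE tU); rewrite eqEsubset (tight_sub tauE tU).
    by rewrite -setD_eq0 (eqP e0) eqxx.
  case/andP: nU => UW UV.
  have U'W : U' != W.
    apply: contraNneq UV => e; rewrite e adjC in aU.
    by rewrite (adj_uniq aU aWV).
  have U'V : U' != V.
    apply: contraNneq UW => e; rewrite e adjC in aU.
    by rewrite adjC in aWV; rewrite (adj_uniq aU aWV).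
  rewrite subsetI covered // andbT.
  have := clo U => /forallP/(_ U'); rewrite aU /= => /implyP; apply.
  exact: subset_trans sU (subsetIl _ _).
by move/setP/(_ c); rewrite !inE cR (negPf cW).
Qed.

End NoTriangle.

Lemma tight3_exists x :
  x \in E -> exists t, [/\ tau t, #|t| = 3 & x \in t].
Proof.
move=> xE; case: (boolP [exists t, [&& tau t, #|t| == 3 & x \in t]]).
  by case/existsP=> t /and3P[tt /eqP t3 xt]; exists t.
move/existsPn=> no; case: (@no_triangle_absurd x xE) => t tt xt.
by have := no t; rewrite tt xt andbT.
Qed.

End SmallTightSets.

End TightFamilies.

(** * Triangles and triads *)

Section Fans.
Variable T : finType.
Implicit Types (E X Y : {set T}) (tau : pred {set T}).

(* Self-dual in [tau] and [tau'], which stand for the tight sets of a matroid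
   and of its dual. *)
Record fan_family E tau tau' : Prop := FanFamily {
  fan_tight : tight_family E tau;
  fan_cotight : tight_family E tau';
  fan_dual X : X \subset E -> tau' X = tau (E :\: X);
  fan_unsplittable : unsplittable E tau;
  fan_triangle x : x \in E -> exists t, [/\ tau t, #|t| = 3 & x \in t];
  fan_triad x : x \in E -> exists t, [/\ tau' t, #|t| = 3 & x \in t];
  fan_card : 7 < #|E| }.

Lemma fan_family_sym E tau tau' : fan_family E tau tau' -> fan_family E tau' tau.
Proof.
case=> t1 t2 d u f1 f2 c; split=> // [X sX|X tX].
  by rewrite d ?subsetDl // setDDr setDv set0U (setIidPr sX).
have sX := tight_sub t2 tX; rewrite d ?subsetDl // setDDr setDv set0U.
by rewrite (setIidPr sX) => tX'; apply: u; rewrite -?d.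
Qed.

Definition triple tau (a b c : T) := uniq [:: a; b; c] && tau [set a; b; c].

Lemma triple_rot tau a b c : triple tau a b c -> triple tau b c a.
Proof.
rewrite /triple -[[:: b; c; a]]/(rot 1 [:: a; b; c]) rot_uniq.
by rewrite [[set b; c; a]]setUC setUA.
Qed.

Lemma triple_swap tau a b c : triple tau a b c -> triple tau b a c.
Proof.
rewrite /triple [[set a; b]]setUC => /andP[u ->]; rewrite andbT.
by rewrite -(@perm_uniq _ [:: a; b; c]) //; apply/permP=> p /=; lia.
Qed.

Lemma tripleP tau t x : tau t -> #|t| = 3 -> x \in t ->
  exists a b, triple tau x a b /\ t = [set x; a; b].
Proof.
move=> tt t3 xt; have: #|t :\ x| == 2 by have := cardsD1 x t; rewrite xt t3; lia.
case/cards2P=> a [b [ab e]]; exists a, b.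
have et : t = [set x; a; b].
  by rewrite -(setD1K xt) e setUA.
split=> //; rewrite /triple -et tt andbT /= !inE ab !andbT.
have : x \notin t :\ x by rewrite !inE eqxx.
by rewrite e !inE => ->.
Qed.

Lemma triple_uniq tau a b c : triple tau a b c -> [/\ a != b, a != c & b != c].
Proof. by case/andP=> /=; rewrite !inE negb_or => /and3P[/andP[-> ->] ->]. Qed.

Lemma card_triple tau a b c : triple tau a b c -> #|[set a; b; c]| = 3.
Proof.
move/triple_uniq=> [ab ac bc].
rewrite setUC cardsU1 cards2 ab !inE negb_or ![c == _]eq_sym ac bc //.
Qed.

Section Triples.
Variables (E : {set T}) (tau tau' : pred {set T}).
Hypothesis F : fan_family E tau tau'.

Let tauE := fan_tight F.

Lemma triple_sub a b c : triple tau a b c -> [set a; b; c] \subset E.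
Proof. by case/andP=> _ /(tight_sub tauE). Qed.

Lemma triple_in a b c : triple tau a b c -> [/\ a \in E, b \in E & c \in E].
Proof. by move/triple_sub; rewrite !subUset !sub1set => /andP[/andP[-> ->] ->]. Qed.

(** Otherwise the meet of the two triples would be a tight set with two elements. *)
Lemma triple_unique3 a b c d : triple tau a b c -> triple tau a b d -> c = d.
Proof.
move=> tc td; apply/eqP/negPn/negP=> cd.
have [ab ac bc] := triple_uniq tc; have [_ ad bd] := triple_uniq td.
have /andP[_ tX] := tc; have /andP[_ tY] := td.
have eI : [set a; b; c] :&: [set a; b; d] = [set a; b].
  apply/setP=> z; rewrite !inE; case: (z == a) => //=; case: (z == b) => //=.
  by case: eqP => //= ->; rewrite (negPf cd).
have : tau [set a; b].
  rewrite -eI; apply: (tight_meet tauE) => //.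
    by apply/set0Pn; exists a; rewrite !inE eqxx.
  apply: contraTneq (fan_card F) => <-; rewrite -leqNgt.
  have := cardsUI [set a; b; c] [set a; b; d].
  rewrite (card_triple tc) (card_triple td) eI cards2 ab.
  by move/(congr1 (subn^~ 2)); rewrite addnK => ->.
by move/(tight_odd tauE); rewrite cards2 ab.
Qed.

(** A triangle and a triad never meet in exactly one element: if they met in [a] only, the triangle
    would meet the tight complement of the triad in the even set [[set b; c]]. *)
Lemma triple_orthogonal a b c d e :
  triple tau a b c -> triple tau' a d e -> (b \in [:: d; e]) || (c \in [:: d; e]).
Proof.
move=> t t'; rewrite -[_ || _]negbK negb_or; apply/negP=> /andP[].
rewrite !inE !negb_or => /andP[bd be] /andP[cd ce].
have [ab ac bc] := triple_uniq t; have [ad ae de] := triple_uniq t'.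
have /andP[_ tX] := t; have /andP[_ tY] := t'.
have sY := tight_sub (fan_cotight F) tY.
rewrite (fan_dual F) // in tY.
have [aE bE cE] := triple_in t.
have eI : [set a; b; c] :&: (E :\: [set a; d; e]) = [set b; c].
  apply/setP=> z; rewrite !inE.
  have [->|za] := eqVneq z a; first by rewrite (negPf ab) (negPf ac).
  have [->|zb] := eqVneq z b; first by rewrite (negPf bd) (negPf be) bE.
  have [->|zc] := eqVneq z c; first by rewrite (negPf cd) (negPf ce) cE.
  by [].
have dE : d \in E by apply: (subsetP sY); rewrite !inE eqxx orbT.
have : tau [set b; c].
  rewrite -eI; apply: (tight_meet tauE) => //.
    by rewrite eI; apply/set0Pn; exists b; rewrite !inE eqxx.
  apply: contraTneq dE => <-; rewrite !inE eqxx orbT /= orbF !negb_or.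
  by rewrite eq_sym ad eq_sym bd eq_sym cd.
by move/(tight_odd tauE); rewrite cards2 bc.
Qed.

(** A triple that is both triangle and triad is a side of a split whose other side has at least five
    elements. *)
Lemma triple_dual_neq a b c : triple tau a b c -> ~ tau' [set a; b; c].
Proof.
move=> t t'; have /andP[_ tX] := t.
rewrite (fan_dual F) in t'; last exact: triple_sub t.
have := fan_unsplittable F tX t'.
rewrite cardsD (setIidPr (triple_sub t)) (card_triple t).
by case=> // e; have := leq_sub2r 3 (fan_card F); rewrite e.
Qed.

(** The at most five elements form a union of two triangles and also a union of two triads. Their
    set is therefore tight with tight complement, and at least three elements remain outside. *)
Lemma bad_fan a b c e h :
  triple tau a b c -> triple tau e b h ->
  triple tau' h a b -> triple tau' b c e -> False.
Proof.
move=> t1 t2 t3 t4.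
have [ab ac bc] := triple_uniq t1; have [eb eh bh] := triple_uniq t2.
have [ha _ _] := triple_uniq t3; have [_ be ce] := triple_uniq t4.
have [aE bE cE] := triple_in t1; have [eE _ hE] := triple_in t2.
pose X := [set a; b; c] :|: [set e; b; h].
pose X' := [set h; a; b] :|: [set b; c; e].
have eX : X = X'.
  by apply/setP=> z; rewrite !inE; case: (z == a); case: (z == b); case: (z == c);
     case: (z == e); case: (z == h).
have cX : #|X| <= 5.
  have := cardsUI [set a; b; c] [set e; b; h]; rewrite -/X.
  rewrite (card_triple t1) (card_triple t2) => e6.
  have : 0 < #|[set a; b; c] :&: [set e; b; h]|.
    by apply/card_gt0P; exists b; rewrite !inE eqxx !orbT.
  move: e6; case: #|_ :&: _| => // n; rewrite addnS => -[e6] _.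
  by rewrite -[5]/(2 + 3) -e6 leq_addr.
have nE : X != E.
  by apply: contraTneq cX => ->; rewrite -ltnNge; apply: leq_trans (fan_card F).
have sXE : X \subset E by rewrite subUset (triple_sub t1) (triple_sub t2).
have tX : tau X.
  case/andP: t1 => _ t1; case/andP: t2 => _ t2; apply: (tight_join tauE) => //.
  by apply/set0Pn; exists b; rewrite !inE eqxx !orbT.
have tX' : tau' X.
  rewrite eX; case/andP: t3 => _ t3; case/andP: t4 => _ t4.
  apply: (tight_join (fan_cotight F)); rewrite // -?/X' -?eX //.
  by apply/set0Pn; exists b; rewrite !inE eqxx !orbT.
rewrite (fan_dual F) // in tX'.
have := fan_unsplittable F tX tX'; rewrite cardsD (setIidPr sXE).
have X3 : 3 <= #|X| by rewrite -(card_triple t1) subset_leq_card ?subsetUl.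
have := fan_card F => E8 [X1|X1]; first by rewrite X1 in X3.
have : #|E| <= 6 by rewrite -(subnK (subset_leq_card sXE)) X1; apply: (leq_add (leqnn 1)).
by rewrite leqNgt (leq_trans _ E8).
Qed.

End Triples.

(* Position of b in a fan: the consecutive pairs ab and bc of the triangle abc
   both lie in triads. *)
Definition midtri tau tau' a b c :=
  [&& triple tau a b c, [exists h, triple tau' h a b] & [exists e, triple tau' b c e]].

Ltac triple_perm :=
  match goal with H : is_true (triple _ _ _ _) |- _ => first
    [ exact: H | exact: (triple_rot H) | exact: (triple_rot (triple_rot H))
    | exact: (triple_swap H) | exact: (triple_rot (triple_swap H))
    | exact: (triple_rot (triple_rot (triple_swap H))) ] end.

Section MidTriples.
Variables (E : {set T}) (tau tau' : pred {set T}).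
Hypothesis F : fan_family E tau tau'.
Let F' := fan_family_sym F.

(** This is how a fan is prolonged. A triangle through [e] meets the triad [b], [c], [e] in a second
    element. If that element were [b], orthogonality with the triad [h], [a], [b] would lead to
    repeated triples, a triple that is its own dual, or a bad fan; so it is [c]. *)
Lemma midtri_next a b c e :
  midtri tau tau' a b c -> triple tau' b c e -> midtri tau' tau b c e.
Proof.
case/and3P=> t /existsP[h th] _ te; rewrite /midtri te /=.
apply/andP; split; first by apply/existsP; exists a.
have [bE cE eE] := triple_in F' te.
have [s [ts s3 es]] := fan_triangle F eE.
have [u [v [tuv es']]] := tripleP ts s3 es.
have [be ce] : b != e /\ c != e by have [_ -> ->] := triple_uniq te.
have tri_b g : triple tau e b g -> False.
  move=> tg.
  have := triple_orthogonal F (triple_swap tg) (triple_rot (triple_rot th)).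
  rewrite !inE -orbA => /or4P[] /eqP e1.
  - rewrite e1 in te; have :=
      triple_unique3 F' (triple_rot (triple_swap te)) (triple_rot (triple_rot th)).
    by move=> ca; have [_] := triple_uniq t; rewrite ca eqxx.
  - have := triple_rot te; rewrite e1 => tcab.
    by apply: (triple_dual_neq F t); have /andP[_] := triple_rot tcab.
  - by rewrite e1 in tg; apply: (bad_fan F t tg th te).
  - rewrite e1 in tg; have := triple_unique3 F (triple_rot tg) (triple_swap t).
    by move=> ec; rewrite ec eqxx in ce.
have := triple_orthogonal F tuv (triple_rot (triple_rot te)).
rewrite !inE -orbA => /or4P[] /eqP e1; rewrite e1 in tuv.
- by case: (tri_b v).
- by apply/existsP; exists v; apply: triple_swap.
- by case: (tri_b u); triple_perm.
- by apply/existsP; exists u; do 2 apply: triple_rot.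
Qed.

(** A triangle through [b] is orthogonal to both triads at [b]. If it avoided [a] and [c] it would
    consist of [b], [h] and [e], which is a bad fan. *)
Lemma midtri_unique a b c u v :
  midtri tau tau' a b c -> triple tau b u v -> u = a /\ v = c \/ u = c /\ v = a.
Proof.
case/and3P=> t /existsP[h th] /existsP[e te] tuv.
have [uv nba nbc] : [/\ u != v, b != a & b != c].
  have [ab _ bc] := triple_uniq t; have [_ _ ->] := triple_uniq tuv.
  by rewrite eq_sym ab.
have Ha w w' : triple tau b w w' -> w = a -> w' = c.
  by move=> tw ew; rewrite ew in tw; apply: (triple_unique3 F tw); triple_perm.
have Hc w w' : triple tau b w w' -> w = c -> w' = a.
  by move=> tw ew; rewrite ew in tw; apply: (triple_unique3 F tw); triple_perm.
have tvu : triple tau b v u by triple_perm.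
have tbah : triple tau' b a h by triple_perm.
have := triple_orthogonal F tuv tbah; have := triple_orthogonal F tuv te.
have [ua _|ua] := eqVneq u a; first by left; rewrite (Ha u v).
have [va _|va] := eqVneq v a; first by right; rewrite (Ha v u).
have [uc _|uc] := eqVneq u c; first by right; rewrite (Hc u v).
have [vc _|vc] := eqVneq v c; first by left; rewrite (Hc v u).
rewrite !inE (negPf ua) (negPf va) (negPf uc) (negPf vc) /=.
have he : h != e.
  apply: contraTneq (te) => eh; apply/negP=> te'; rewrite -eh in te'.
  have [_] := triple_uniq t; rewrite (_ : a = c) ?eqxx //.
  by apply: (triple_unique3 F' (a := b) (b := h)); triple_perm.
case/orP=> /eqP e1 /orP[] /eqP e2.
- by rewrite -e1 -e2 eqxx in he.
- by case: (bad_fan F t (h := h) (e := e)) => //; rewrite -e1 -e2; triple_perm.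
- by case: (bad_fan F t (h := h) (e := e)) => //; rewrite -e1 -e2; triple_perm.
- by rewrite -e1 -e2 eqxx in he.
Qed.

End MidTriples.

Section MiddleElements.
Variables (E : {set T}) (tau tau' : pred {set T}).
Hypothesis F : fan_family E tau tau'.
Let F' := fan_family_sym F.

(** By the dual of [midtri_unique] only one triad contains [b], so the triads [h], [a], [b] and [b],
    [c], [e] coincide and are equal to the triangle [a], [b], [c]. *)
Lemma midtri_midtriad_absurd a b c x y :
  midtri tau tau' a b c -> midtri tau' tau x b y -> False.
Proof.
case/and3P=> t /existsP[h th] /existsP[e te] m.
have [ab ac bc] := triple_uniq t.
have tbha : triple tau' b h a by triple_perm.
have eh : h = c -> False.
  move=> hc; rewrite hc in th; apply: (triple_dual_neq F t).
  by have /andP[_] := triple_rot th.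
by have [[e1 e2]|[e1 e2]] := midtri_unique F' m te;
   have [[e3 e4]|[e3 e4]] := midtri_unique F' m tbha;
  [apply: eh; rewrite e1 | rewrite e4 e1 eqxx in ac
  | rewrite e4 e1 eqxx in ac | apply: eh; rewrite e1].
Qed.

(** Join two elements of a triangle if some triad contains both. By orthogonality no vertex of this
    graph on three vertices is isolated, so some vertex has both neighbours. *)
Lemma midtri_exists : exists a b c, midtri tau tau' a b c.
Proof.
have /card_gt0P[a aE] : 0 < #|E| by apply: leq_trans (fan_card F).
have [s [ts s3 es]] := fan_triangle F aE.
have [b [c [t _]]] := tripleP ts s3 es.
pose P x y := exists h, triple tau' h x y.
have PC x y : P x y -> P y x by case=> h th; exists h; triple_perm.
have tria x y z : triple tau x y z -> P x y \/ P x z.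
  move=> txyz; have [xE _ _] := triple_in F txyz.
  have [s' [ts' s3' es']] := fan_triad F xE.
  have [u [v [tuv _]]] := tripleP ts' s3' es'.
  have := triple_orthogonal F txyz tuv.
  rewrite !inE -orbA => /or4P[] /eqP e; rewrite e.
  - by left; exists v; triple_perm.
  - by left; exists u; triple_perm.
  - by right; exists v; triple_perm.
  - by right; exists u; triple_perm.
have mk x y z : triple tau x y z -> P x y -> P y z -> midtri tau tau' x y z.
  move=> txyz [h th] [e te]; apply/and3P; split=> //; first by apply/existsP; exists h.
  by apply/existsP; exists e; triple_perm.
have tb : triple tau b a c by triple_perm.
have tc : triple tau c a b by triple_perm.
have [ab|ac] := tria _ _ _ t.
  have [ca|cb] := tria _ _ _ tc.
    by exists c, a, b; apply: mk.
  by exists a, b, c; apply: mk => //; apply: PC.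
have [ba|bc] := tria _ _ _ tb.
  by exists b, a, c; apply: mk.
by exists a, c, b; apply: mk => //; [triple_perm | apply: PC].
Qed.
End MiddleElements.
End Fans.

(** * The cyclic order of a fan *)

(** The tight triple at [i] is a rim edge with the spokes at its ends; the cotight triple is the set
    of edges at the rim vertex [ordS i]. *)
Definition wheel_config (T : finType) (E : {set T}) (tau tau' : pred {set T}) :=
  exists k (g : wheel_edge k -> T),
    [/\ 1 < k, injective g, g @: setT = E,
      forall i, tau [set g (inr i); g (inl i); g (inr (ordS i))] &
      forall i, tau' [set g (inl i); g (inr (ordS i)); g (inl (ordS i))]].

Section CyclicSequence.
Variables (T : finType) (E : {set T}) (tau tau' : pred {set T}).
Hypothesis F : fan_family E tau tau'.
Let F' := fan_family_sym F.
Variables s r : nat -> T.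
Hypothesis mt : forall i, midtri tau tau' (s i) (r i) (s i.+1).
Hypothesis md : forall i, midtri tau' tau (r i) (s i.+1) (r i.+1).

Let mt3 i : triple tau (s i) (r i) (s i.+1).
Proof. by have /and3P[] := mt i. Qed.
Let md3 i : triple tau' (r i) (s i.+1) (r i.+1).
Proof. by have /and3P[] := md i. Qed.
Let s_step i : s i != s i.+1.
Proof. by have [] := triple_uniq (mt3 i). Qed.
Let r_step i : r i != r i.+1.
Proof. by have [] := triple_uniq (md3 i). Qed.

(** Such a coincidence would make the sequence retrace itself backwards. Uniqueness of the middle
    triples moves both ends one step inwards, so [n] drops by two, until two consecutive spokes or
    rim elements are equal. *)
Lemma no_reflection n i : s i = s (i + n.+1) -> r i = r (i + n) -> False.
Proof.
elim/ltn_ind: n i => -[|[|n]] IH i es er.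
- by have := s_step i; rewrite es addn1 eqxx.
- by have := r_step i; rewrite er addn1 eqxx.
have := mt3 (i + n.+2); rewrite -er => tr.
have [[e1 e2]|[e1 e2]] := midtri_unique F (mt i) (triple_swap tr).
  by have := s_step (i + n.+2); rewrite e1 es addnS eqxx.
have ed : s (i + n.+2) = s i.+1 by [].
have := md3 (i + n.+1); rewrite -!addnS ed => td.
have [[e3 e4]|[e3 e4]] := midtri_unique F' (md i) (triple_swap td).
  by have := r_step (i + n.+1); rewrite -addnS e3 er eqxx.
apply: (IH n _ i.+1) => //; first by rewrite addSnnS ed.
by rewrite -e3 addSnnS.
Qed.

(** The two triads with this common middle agree as sets; if their ends were swapped, the sequence
    would be reflected. *)
Lemma spoke_determines_rim i j : s i.+1 = s j.+1 -> r i.+1 = r j.+1.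
Proof.
wlog ij : i j / i <= j => [hw e|e].
  by have [/hw->//|/ltnW/hw->//] := leqP i j.
have := md3 j; rewrite -e => td.
have [[e1 e2]|[e1 e2]] := midtri_unique F' (md i) (triple_swap td); first by [].
have [eij|] := eqVneq i j; first by rewrite eij.
move=> nij; have {nij} lij : i < j by rewrite ltn_neqAle nij.
case: (@no_reflection (j - i.+1) i.+1); last by rewrite -e1 subnKC.
by rewrite e addnS subnKC.
Qed.

Variable k : nat.
Hypothesis k_gt0 : 0 < k.
Hypothesis s_per : forall i, s (i + k) = s i.
Hypothesis r_per : forall i, r (i + k) = r i.
Hypothesis state_inj : forall i j, i < k -> j < k -> s i = s j -> r i = r j -> i = j.

Lemma spoke_rim i j : s i = s j -> r i = r j.
Proof.
rewrite -[s i]s_per -[s j]s_per -[r i]r_per -[r j]r_per -(prednK k_gt0) !addnS.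
exact: spoke_determines_rim.
Qed.

Lemma rim_spoke i j : r i = r j -> s i = s j.
Proof.
move=> e; have := mt3 j; rewrite -e => tr.
have [[//]|[e1 e2]] := midtri_unique F (mt i) (triple_swap tr).
by have := r_step j; rewrite -e (spoke_rim (esym e2)) eqxx.
Qed.

Lemma spoke_neq_rim i j : s i != r j.
Proof.
apply/eqP=> e; have := md (i + k.-1); rewrite -addnS (prednK k_gt0) s_per e.
by move=> m; have := midtri_midtriad_absurd F (mt j) m.
Qed.

Let spoke_inj i j : i < k -> j < k -> s i = s j -> i = j.
Proof. by move=> ik jk e; apply: state_inj => //; apply: spoke_rim. Qed.

Let rim_inj i j : i < k -> j < k -> r i = r j -> i = j.
Proof. by move=> ik jk e; apply: state_inj => //; apply: rim_spoke. Qed.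

Let g (e : wheel_edge k) := match e with inl i => r i | inr i => s i end.

Let g_inj : injective g.
Proof.
case=> i [] j /= e.
- by congr inl; apply/val_inj/rim_inj; rewrite ?ltn_ord.
- by have := spoke_neq_rim j i; rewrite e eqxx.
- by have := spoke_neq_rim i j; rewrite e eqxx.
- by congr inr; apply/val_inj/spoke_inj; rewrite ?ltn_ord.
Qed.

Let mod_per i : (s (i %% k) = s i) * (r (i %% k) = r i).
Proof.
rewrite {2 4}(divn_eq i k); elim: (i %/ k) => [|n [IHs IHr]]; first by rewrite mul0n.
by rewrite mulSn -addnA addnC s_per r_per.
Qed.

(** Consecutive triangles share a spoke, so if the labels missed an element of [E], all partial
    unions would be tight. The full union would then be odd, but it has [k + k] elements. *)
Let g_onto : g @: setT = E.
Proof.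
have memS i : s i \in g @: setT.
  rewrite -(mod_per i); apply/imsetP.
  by exists (inr (Ordinal (ltn_pmod i k_gt0))).
have memR i : r i \in g @: setT.
  rewrite -(mod_per i); apply/imsetP.
  by exists (inl (Ordinal (ltn_pmod i k_gt0))).
have card_g : #|g @: setT| = k + k.
  by rewrite card_imset // cardsT card_sum card_ord.
apply/eqP/negPn/negP=> nE.
have sg : g @: setT \subset E.
  apply/subsetP=> _ /imsetP[[] i _ ->] /=.
    by have [_] := triple_in F (mt3 i).
  by have [] := triple_in F (mt3 i).
pose U n := \bigcup_(i < n) [set s i; r i; s i.+1].
have Usub n : U n \subset g @: setT.
  by apply/bigcupsP=> i _; rewrite !subUset !sub1set !memS memR.
have tU n : tau (U n.+1).
  elim: n => [|n IH]; first by rewrite /U big_ord1; have /andP[] := mt3 0.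
  rewrite /U big_ord_recr /= -/(U n.+1).
  apply: (tight_join (fan_tight F)) => //; first by have /andP[] := mt3 n.+1.
    apply/set0Pn; exists (s n.+1); rewrite !inE eqxx !andbT.
    by apply/bigcupP; exists ord_max => //=; rewrite !inE eqxx orbT.
  apply: contraNneq nE => e; rewrite eqEsubset sg -e subUset Usub.
  by rewrite !subUset !sub1set !memS memR.
have eU : U k = g @: setT.
  apply/eqP; rewrite eqEsubset Usub; apply/subsetP=> _ /imsetP[[] i _ ->] /=;
    by apply/bigcupP; exists i; rewrite // !inE eqxx ?orbT.
have := tU k.-1; rewrite (prednK k_gt0) eU => /(tight_odd (fan_tight F)).
by rewrite card_g oddD addbb.
Qed.

Let k_gt1 : 1 < k.
Proof.
have := fan_card F; rewrite -g_onto card_imset // cardsT card_sum card_ord.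
by case: k => [|[]].
Qed.

Lemma cyclic_sequence_wheel : wheel_config E tau tau'.
Proof.
exists k, g; split=> // i /=; rewrite !mod_per.
  by have /andP[] := mt3 i.
by have /andP[] := md3 i.
Qed.

End CyclicSequence.

Lemma fan_wheel (T : finType) (E : {set T}) (tau tau' : pred {set T}) :
  fan_family E tau tau' -> wheel_config E tau tau'.
Proof.
move=> F; have F' := fan_family_sym F.
(* A state records a spoke and the rim element after it, and is valid when they close a middle
   triad; this is what allows the next step. *)
pose valid := [pred p : T * T | [exists q, midtri tau' tau q p.1 p.2]].
pose step (p q : T * T) := midtri tau tau' p.1 p.2 q.1 && midtri tau' tau p.2 q.1 q.2.
pose nxt p := odflt p [pick q | step p q].
have stepP p : p \in valid -> step p (nxt p).
  case/existsP=> q m; rewrite /nxt; case: pickP => // no.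
  have /and3P[_ _ /existsP[s' t']] := m.
  have m' := midtri_next F' m t'.
  have /and3P[_ _ /existsP[r' t'']] := m'.
  by have := no (s', r'); rewrite /step /= m' (midtri_next F m' t'').
have nxt_valid p : p \in valid -> nxt p \in valid.
  by move/stepP=> /andP[_ m]; apply/existsP; exists p.2.
(* Injectivity makes the orbit of [p0] a pure cycle, without a preperiod; the predecessor is
   recovered because two elements of a triple determine the third. *)
have nxt_inj : {in valid &, injective nxt}.
  move=> p q /stepP/andP[m1 m2] /stepP/andP[m3 m4] e; rewrite -e in m3 m4.
  have /and3P[t1 _ _] := m1; have /and3P[t2 _ _] := m2.
  have /and3P[t3 _ _] := m3; have /and3P[t4 _ _] := m4.
  have e2 : p.2 = q.2.
    by apply: (triple_unique3 F' (triple_rot t2)); apply: triple_rot.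
  rewrite -e2 in t3.
  have e1 : p.1 = q.1.
    by apply: (triple_unique3 F (triple_rot t1)); apply: triple_rot.
  by case: p q e1 e2 {e m1 m2 m3 m4 t1 t2 t3 t4} => ? ? [? ?] /= -> ->.
have [a [b [c m]]] := midtri_exists F.
have /and3P[_ _ /existsP[e te]] := m.
pose p0 := (c, e).
have p0v : p0 \in valid by apply/existsP; exists b; apply: (midtri_next F m te).
have itv i : iter i nxt p0 \in valid by elim: i => //= i; apply: nxt_valid.
pose k := order nxt p0.
have per i : iter (i + k) nxt p0 = iter i nxt p0.
  by rewrite iterD (iter_order_in nxt_valid nxt_inj).
apply: (@cyclic_sequence_wheel T E tau tau' F
  (fun i => (iter i nxt p0).1) (fun i => (iter i nxt p0).2) _ _ k).
- by move=> i /=; have /andP[] := stepP _ (itv i).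
- by move=> i /=; have /andP[] := stepP _ (itv i).
- exact: order_gt0.
- by move=> i; rewrite per.
- by move=> i; rewrite per.
move=> i j ik jk e1 e2; rewrite -(findex_iter ik) -(findex_iter jk); congr findex.
by case: (iter i nxt p0) (iter j nxt p0) e1 e2 => ? ? [? ?] /= -> ->.
Qed.

(** * Wheel configurations *)

Lemma ordS_neq k (i : 'I_k) : 1 < k -> ordS i != i.
Proof.
move=> k1; apply/eqP=> /(congr1 val) /=.
have [ik|] := ltnP i.+1 k; first by rewrite modn_small // => /eqP; rewrite eqn_leq ltnn.
move=> ik; have -> : i.+1 = k by apply/eqP; rewrite eqn_leq ltn_ord.
by rewrite modnn => i0; rewrite -i0 leqNgt k1 in ik.
Qed.

Lemma card_set3 (T : finType) (x y z : T) :
  uniq [:: x; y; z] -> #|[set x; y; z]| = 3.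
Proof.
rewrite /= !inE negb_or => /and3P[/andP[xy xz] yz _].
by rewrite setUC cardsU1 cards2 xy !inE negb_or ![z == _]eq_sym xz yz.
Qed.

Lemma inl_inj {A B : Type} : injective (@inl A B). Proof. by move=> x y []. Qed.
Lemma inr_inj {A B : Type} : injective (@inr A B). Proof. by move=> x y []. Qed.

Definition wheel_index k (e : wheel_edge k) : nat :=
  match e with inl i => i | inr i => k + i end.

Lemma wheel_labelling (T : finType) (E : {set T}) k x0 (L : seq T) :
    uniq L -> size L = k + k -> #|E| = k + k -> {subset L <= E} ->
  let g (e : wheel_edge k) := nth x0 L (wheel_index e) in
  injective g /\ g @: setT = E.
Proof.
move=> uL sL cE sLE g.
have idx_lt e : @wheel_index k e < size L.
  by rewrite sL; case: e => i /=; have := ltn_ord i; lia.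
have g_inj : injective g.
  move=> e e' /eqP; rewrite nth_uniq // => /eqP; clear.
  by case: e e' => [] i [] j /= h; first [congr inl | congr inr | exfalso];
     first [apply: val_inj => /=| have := ltn_ord i; have := ltn_ord j]; lia.
split=> //; apply/eqP; rewrite eqEcard card_imset // cardsT card_sum card_ord cE.
by rewrite leqnn andbT; apply/subsetP=> _ /imsetP[e _ ->]; apply: sLE; apply: mem_nth.
Qed.

(** * Ground sets with four and six elements *)

Section SmallWheels.
Variables (T : finType) (E : {set T}) (tau : pred {set T}).
Hypothesis tauE : tight_family E tau.
Hypothesis conn : unsplittable E tau.

Lemma imset3 (aT rT : finType) (g : aT -> rT) x y z :
  g @: [set x; y; z] = [set g x; g y; g z].
Proof. by rewrite !imsetU !imset_set1. Qed.

(** Every three-element subset is the complement of a point, hence both tight and cotight, so any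
    labelling will do. *)
Lemma wheel_config4 : #|E| = 4 -> wheel_config E tau (cotight E tau).
Proof.
move=> E4; have /card_gt0P[x0 _] : 0 < #|E| by rewrite E4.
pose L := enum E; have uL : uniq L := enum_uniq E.
have sL : size L = 4 by rewrite -cardE.
have sLE : {subset L <= E} by move=> z; rewrite mem_enum.
have [] := wheel_labelling x0 uL (k := 2) sL E4 sLE.
set g := fun e : wheel_edge 2 => _ => g_inj g_onto.
have three (A : {set wheel_edge 2}) : #|A| = 3 ->
    tau (g @: A) /\ cotight E tau (g @: A).
  move=> A3; have sA : g @: A \subset E by rewrite -g_onto imsetS ?subsetT.
  have : #|E :\: g @: A| == 1 by rewrite cardsD (setIidPr sA) card_imset // A3 E4.
  case/cards1P=> x ex; have xE : x \in E by have := subsetDl E (g @: A); rewrite ex sub1set.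
  split; last by rewrite /cotight /= sA ex; exact: (tight_set1 tauE xE).
  suff -> : g @: A = E :\ x by exact: (tight_setD1 tauE xE).
  by rewrite -ex setDDr setDv set0U (setIidPr sA).
exists 2, g; split=> // i; rewrite -imset3; [apply: (three _ _).1 | apply: (three _ _).2].
  by rewrite card_set3 //= !inE /= andbT (inj_eq inr_inj) eq_sym ordS_neq.
by rewrite card_set3 //= !inE /= !andbT (inj_eq inl_inj) eq_sym ordS_neq.
Qed.

Section Six.
Hypothesis peel : peelable tau.
Hypothesis E6 : #|E| = 6.

Let triE (t : {set T}) := tau t /\ #|t| = 3.

(** Disjoint triangles would be complementary and form a split; a common pair would be a tight set
    of even size. *)
Let tri_meet t u : triE t -> triE u -> t != u -> exists x, t :&: u = [set x].
Proof.
move=> [tt t3] [tu u3] ne; apply/cards1P.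
have st := tight_sub tauE tt; have su := tight_sub tauE tu.
have cU := cardsUI t u; rewrite t3 u3 in cU.
have I3 : #|t :&: u| < 3.
  rewrite ltnNge; apply: contra ne => I3.
  have e1 : t :&: u = t by apply/eqP; rewrite eqEcard subsetIl t3.
  have e2 : t :&: u = u by apply/eqP; rewrite eqEcard subsetIr u3.
  by rewrite -e1 e2.
have I0 : #|t :&: u| != 0.
  rewrite cards_eq0 setI_eq0; apply/negP=> d.
  have eu : E :\: t = u.
    apply/esym/eqP; rewrite eqEcard cardsD (setIidPr st) E6 t3 u3 andbT.
    by rewrite subsetD su disjoint_sym.
  by have := conn tt; rewrite eu t3 u3 => /(_ tu)[].
have I2 : #|t :&: u| != 2.
  apply/negP=> /eqP I2; have : tau (t :&: u).
    apply: (tight_meet tauE) => //; first by rewrite -cards_eq0 I2.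
    by apply/eqP=> eU; rewrite I2 eU E6 in cU.
  by move/(tight_odd tauE); rewrite I2.
by move: I0 I2 I3; case: #|_| => [|[|[]]].
Qed.

(** With six elements the complement of a triad through [x] is a triangle. *)
Let tri_avoid x : x \in E -> exists2 t, triE t & x \notin t.
Proof.
move=> xE; have [|t [tt t3 xt]] := cotight3_exists tauE peel _ xE; first by rewrite E6.
case/andP: tt => sE tt; exists (E :\: t); last by rewrite !inE xt.
by split=> //; rewrite cardsD (setIidPr sE) E6 t3.
Qed.

Let tri_third t a b : triE t -> a \in t -> b \in t -> a != b ->
  exists c, [/\ t = [set a; c; b], c != a & c != b].
Proof.
move=> [tt t3] at_ bt ab; have : #|t :\: [set a; b]| == 1.
  by rewrite cardsD (setIidPr _) ?subUset ?sub1set ?at_ // t3 cards2 ab.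
case/cards1P=> c ec; have : c \in t :\: [set a; b] by rewrite ec inE.
rewrite !inE negb_or => /andP[/andP[ca cb] ct]; exists c; split=> //.
apply/esym/eqP; rewrite eqEcard !subUset !sub1set at_ bt ct t3 card_set3 //=.
by rewrite !inE negb_or ab eq_sym ca cb.
Qed.

Lemma wheel_config6 : wheel_config E tau (cotight E tau).
Proof.
have /card_gt0P[x xE] : 0 < #|E| by rewrite E6.
have [t1 T1 _] := tri_avoid xE.
have /card_gt0P[a at1] : 0 < #|t1| by rewrite T1.2.
have [t2 T2 at2] := tri_avoid (subsetP (tight_sub tauE T1.1) _ at1).
have n12 : t1 != t2 by apply: contraNneq at2 => <-.
have [b eb] := tri_meet T1 T2 n12.
have /setIP[bt1 bt2] : b \in t1 :&: t2 by rewrite eb inE.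
have [t3 T3 bt3] := tri_avoid (subsetP (tight_sub tauE T1.1) _ bt1).
have n13 : t1 != t3 by apply: contraNneq bt3 => <-.
have n23 : t2 != t3 by apply: contraNneq bt3 => <-.
have [p ep] := tri_meet T1 T3 n13; have [q eq] := tri_meet T2 T3 n23.
have /setIP[pt1 pt3] : p \in t1 :&: t3 by rewrite ep inE.
have /setIP[qt2 qt3] : q \in t2 :&: t3 by rewrite eq inE.
have bp : b != p by apply: contraNneq bt3 => ->.
have bq : b != q by apply: contraNneq bt3 => ->.
have I12 z : z \in t1 -> z \in t2 -> z = b.
  by move=> z1 z2; apply/set1P; rewrite -eb inE z1.
have I13 z : z \in t1 -> z \in t3 -> z = p.
  by move=> z1 z2; apply/set1P; rewrite -ep inE z1.
have I23 z : z \in t2 -> z \in t3 -> z = q.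
  by move=> z1 z2; apply/set1P; rewrite -eq inE z1.
have pq : p != q.
  by apply: contraNneq bp => e; rewrite (I12 p) // e.
have [r0 [e1 r0b r0p]] := tri_third T1 bt1 pt1 bp.
have [r1 [e3 r1p r1q]] := tri_third T3 pt3 qt3 pq.
have [r2 [e2 r2q r2b]] := tri_third T2 qt2 bt2 (negbT (etrans (eq_sym _ _) (negPf bq))).
have r0t : (r0 \notin t2) * (r0 \notin t3).
  have r0t1 : r0 \in t1 by rewrite e1 !inE eqxx orbT.
  split; first by apply: contra r0b => r02; apply/eqP/I12.
  by apply: contra r0p => r02; apply/eqP/I13.
have r1t : (r1 \notin t1) * (r1 \notin t2).
  have r1t3 : r1 \in t3 by rewrite e3 !inE eqxx orbT.
  split; first by apply: contra r1p => r02; apply/eqP/I13.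
  by apply: contra r1q => r02; apply/eqP/I23.
have r2t : (r2 \notin t1) * (r2 \notin t3).
  have r2t2 : r2 \in t2 by rewrite e2 !inE eqxx orbT.
  split; first by apply: contra r2b => r02; apply/eqP/I12.
  by apply: contra r2q => r02; apply/eqP/I23.
(* The three triangles meet pairwise in [b], [p] and [q], which become the spokes; their remaining
   points become the rim. Rim labels come first, as in [wheel_index]. *)
pose L := [:: r0; r1; r2; b; p; q].
have uL : uniq L.
  move: r0t.1 r0t.2 r1t.1 r1t.2 r2t.1 r2t.2; rewrite e1 e2 e3 /= !inE !negb_or.
  move=> /andP[/andP[-> ->] ->] /andP[/andP[-> ->] _].
  move=> /andP[/andP[-> _] ->] /andP[/andP[-> ->] _].
  by move=> /andP[/andP[-> _] ->] /andP[/andP[_ _] ->]; rewrite bp bq pq.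
have sLE : {subset L <= E}.
  have s1 := tight_sub tauE T1.1; have s2 := tight_sub tauE T2.1.
  have s3 := tight_sub tauE T3.1; rewrite e1 e2 e3 !subUset !sub1set in s1 s2 s3.
  case/andP: s1 => [/andP[bE r0E] pE]; case/andP: s2 => [/andP[qE r2E] _].
  case/andP: s3 => [/andP[_ r1E] _].
  by apply/allP; rewrite /= bE r0E pE qE r2E r1E.
have [] := wheel_labelling b uL (k := 3) erefl E6 sLE.
set g := fun e : wheel_edge 3 => _ => g_inj g_onto.
have compl A u v w : ~: A = [set u; v; w] -> tau [set g u; g v; g w] ->
    cotight E tau (g @: A).
  move=> cA; rewrite -imset3 -cA => tB; rewrite /cotight /= -g_onto imsetS ?subsetT //= g_onto.
  suff -> : E :\: g @: A = g @: (~: A) by [].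
  rewrite -g_onto; apply/setP=> z; rewrite !inE; apply/andP/imsetP.
    case=> zA /imsetP[e _ ez]; exists e => //; rewrite inE.
    by apply: contra zA => eA; rewrite ez imset_f.
  case=> e; rewrite inE => eA ->; rewrite mem_imset //; split=> //.
  exact: imset_f.
have tri i : tau [set g (inr i); g (inl i); g (inr (ordS i))].
  case: i => [[|[|[|//]]] hi].
  - by have := T1.1; rewrite e1.
  - by have := T3.1; rewrite e3.
  - by have := T2.1; rewrite e2.
(* The star between the rim edges [i] and [ordS i] is the complement of the triangle two steps
   further on. *)
exists 3, g; split=> // i; rewrite -imset3; apply: compl (tri (ordS (ordS i))).
apply/setP=> z; rewrite !inE.
by case: i => [[|[|[|//]]] hi]; case: z => -[[|[|[|//]]] hz].
Qed.

End Six.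

Lemma tight_wheel : peelable tau -> 3 < #|E| -> wheel_config E tau (cotight E tau).
Proof.
move=> peel E4; have [E8|E8] := ltnP 7 #|E|.
  apply: fan_wheel; split=> //.
  - exact: cotight_family.
  - by move=> X sX; rewrite /cotight /= sX.
  - exact: tight3_exists.
  - exact: cotight3_exists.
have := ground_even tauE.
move: E4 E8; case e: #|E| => [|[|[|[|[|[|[|[|]]]]]]]] //.
  by move=> _ _ _; apply: wheel_config4.
by move=> _ _ _; apply: wheel_config6.
Qed.
End SmallWheels.

(** * Rank functions *)

Section MatroidBasics.
Variable T : finType.
Implicit Types (M : matroid T) (x y : T) (A B C I J X Y : {set T}).

Lemma leq_rank M I X : I \in indep M -> I \subset X -> #|I| <= rank M X.
Proof. by move=> iI sIX; apply: (leq_bigmax_cond (F := fun I => #|I|)); rewrite iI. Qed.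

Lemma rank_witness M X : exists I, [/\ I \in indep M, I \subset X & #|I| = rank M X].
Proof.
have h0 : (set0 \in indep M) && (set0 \subset X) by rewrite indep_set0 sub0set.
rewrite /rank (bigmax_eq_arg set0) //.
by case: arg_maxnP => // I /andP[iI sI] _; exists I.
Qed.

Lemma rank_leq_card M X : rank M X <= #|X|.
Proof. by apply/bigmax_leqP=> I /andP[_ /subset_leq_card]. Qed.

Lemma rank_mono M X Y : X \subset Y -> rank M X <= rank M Y.
Proof.
move=> sXY; apply/bigmax_leqP=> I /andP[iI sI].
exact: leq_rank iI (subset_trans sI sXY).
Qed.

Lemma indepE M I : (I \in indep M) = (rank M I == #|I|).
Proof.
apply/idP/eqP=> [iI|].
  by apply/eqP; rewrite eqn_leq rank_leq_card leq_rank.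
have [J [iJ sJ <-]] := rank_witness M I => e.
by have <- : J = I by apply/eqP; rewrite eqEcard sJ e /=.
Qed.

Lemma indep_extend M I X : I \in indep M -> I \subset X ->
  exists J, [/\ J \in indep M, I \subset J, J \subset X & #|J| = rank M X].
Proof.
move=> iI sIX; have h : (I \in indep M) && (I \subset X) by rewrite iI.
have : [pred J | [&& J \in indep M, I \subset J & J \subset X]] I.
  by rewrite /= iI subxx.
case/maxset_exists=> J /maxsetP[/and3P[iJ sIJ sJX] maxJ] _.
exists J; split=> //; apply/eqP; rewrite eqn_leq leq_rank //= leqNgt.
have [K [iK sKX <-]] := rank_witness M X; apply/negP=> ltJK.
have [x xKJ ixJ] := indep_augment iJ iK ltJK.
move: xKJ; rewrite inE => /andP[xJ xK].
have := maxJ (x |: J); rewrite /= ixJ subsetU ?sIJ ?orbT // subUset sJX sub1set.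
rewrite (subsetP sKX) // subsetUr => /(_ isT isT) e.
by rewrite -e !inE eqxx in xJ.
Qed.

Lemma rank_submod M X Y :
  rank M (X :|: Y) + rank M (X :&: Y) <= rank M X + rank M Y.
Proof.
have [I [iI sI <-]] := rank_witness M (X :&: Y).
have sIU : I \subset X :|: Y.
  exact: subset_trans sI (subset_trans (subsetIl _ _) (subsetUl _ _)).
have [J [iJ sIJ sJ <-]] := indep_extend iI sIU.
have leI Z : #|J :&: Z| <= rank M Z.
  by apply: leq_rank (subsetIr _ _); apply: indep_subset iJ (subsetIl _ _).
apply: leq_trans (leq_add (leI X) (leI Y)).
rewrite -[leqRHS]cardsUI -setIUr (setIidPl sJ) leq_add2l -setIIr.
by apply: subset_leq_card; rewrite subsetI sIJ.
Qed.

Lemma rank_dep M x X : x \notin X -> rank M (x |: X) = rank M X ->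
  x |: X \notin indep M.
Proof.
move=> xX e; rewrite indepE e cardsU1 xX add1n neq_ltn ltnS.
by rewrite rank_leq_card.
Qed.

Lemma circuitP M C : reflect
  [/\ C \subset ground M, C \notin indep M & forall x, x \in C -> C :\ x \in indep M]
  (C \in circuits M).
Proof.
rewrite inE; apply: (iffP minsetP) => [[/= /andP[sC dC] minC]|[sC dC iC]].
  split=> // x xC; apply/negPn/negP=> dCx.
  have := minC (C :\ x); rewrite dCx subD1set (subset_trans (subD1set _ _) sC).
  by move=> /(_ isT isT)/setP/(_ x); rewrite !inE eqxx xC.
split; first by rewrite /= sC.
move=> /= X /andP[sX dX] sXC; apply/eqP; rewrite eqEsubset sXC.
apply/subsetP=> x xC; apply/negPn/negP=> xX; case/negP: dX.
apply: indep_subset (iC x xC) _; apply/subsetP=> z zX.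
by rewrite !inE (subsetP sXC) // andbT; apply: contraNneq xX => <-.
Qed.

Lemma dep_circuit M X : X \subset ground M -> X \notin indep M ->
  exists2 C, C \in circuits M & C \subset X.
Proof.
move=> sX dX.
have : [pred X : {set T} | (X \subset ground M) && (X \notin indep M)] X.
  by rewrite /= sX.
by case/minset_exists=> C mC sC; exists C; rewrite ?inE.
Qed.

Lemma circuit_rank M C x : C \in circuits M -> x \in C ->
  rank M C = rank M (C :\ x).
Proof.
case/circuitP=> sC dC iC xC; apply/eqP; rewrite eqn_leq andbC rank_mono ?subD1set //=.
have := iC x xC; rewrite indepE => /eqP ->.
have := cardsD1 x C; rewrite xC => e.
by move: dC; rewrite indepE neq_ltn [#|C| < _]ltnNge rank_leq_card orbF e.
Qed.

(* [rank M (x |: Y) = rank M Y] expresses that x lies in the closure of Y. *)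
Lemma rank_closure_mono M x X Y : X \subset Y ->
  rank M (x |: X) = rank M X -> rank M (x |: Y) = rank M Y.
Proof.
move=> sXY e; apply/eqP; rewrite eqn_leq andbC rank_mono ?subsetUr //=.
have := rank_submod M (x |: X) Y; rewrite e.
have -> : x |: X :|: Y = x |: Y by rewrite -setUA (setUidPr sXY).
have : rank M X <= rank M ((x |: X) :&: Y).
  by apply: rank_mono; rewrite subsetI subsetUr sXY.
lia.
Qed.

Lemma max_indep_card M B : B \in indep M ->
  (forall x, x \in ground M -> x \notin B -> x |: B \notin indep M) ->
  #|B| = mrank M.
Proof.
move=> iB maxB; rewrite /mrank; have [J [iJ sBJ sJ <-]] := indep_extend iB (indep_ground iB).
suff -> : B = J by [].
apply/eqP; rewrite eqEsubset sBJ.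
apply/subsetP=> x xJ; apply/negPn/negP=> xB; have := maxB x (subsetP sJ _ xJ) xB.
by rewrite (indep_subset iJ) // subUset sub1set xJ.
Qed.

Lemma basesP M B : reflect (B \in indep M /\ #|B| = mrank M) (B \in bases M).
Proof.
rewrite inE; apply: (iffP maxsetP) => /= [[iB maxB]|[iB cB]].
  split=> //; apply: max_indep_card => // x xG xB; apply/negP=> i.
  by have := maxB _ i (subsetUr _ _) => /setP/(_ x); rewrite !inE eqxx (negPf xB).
split=> // J iJ sBJ; apply/esym/eqP; rewrite eqEcard sBJ cB.
exact: leq_rank iJ (indep_ground iJ).
Qed.

Lemma indep_basis M I : I \in indep M -> exists2 B, B \in bases M & I \subset B.
Proof.
move=> iI; have [J [iJ sIJ _ cJ]] := indep_extend iI (indep_ground iI).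
by exists J => //; apply/basesP.
Qed.

End MatroidBasics.

(** * Matroids defined by a rank function *)

Section MatroidOfRank.
Variables (T : finType) (G : {set T}) (r : {set T} -> nat).
Implicit Types (I J X Y : {set T}).

(** The axioms are asked for subsets of [G] alone, the range in which they are derived for
    [side_rank]. *)
Record rank_function : Prop := RankFunction {
  rf_card X : X \subset G -> r X <= #|X|;
  rf_mono X Y : Y \subset G -> X \subset Y -> r X <= r Y;
  rf_submod X Y : X \subset G -> Y \subset G ->
    r (X :|: Y) + r (X :&: Y) <= r X + r Y }.

Hypothesis rf : rank_function.

Lemma rf_closure X Y : X \subset G -> Y \subset G ->
  (forall y, y \in Y -> r (y |: X) = r X) -> r (X :|: Y) = r X.
Proof.
move=> sX; have [n] := ubnP #|Y|; elim: n Y => // n IH Y.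
have [->|/set0Pn[y yY]] := eqVneq Y set0; first by rewrite setU0.
rewrite -(setD1K yY); set Z := Y :\ y.
rewrite cardsU1 !inE eqxx add1n ltnS subUset sub1set => cZ /andP[yG sZ] cl.
have {IH} IHY : r (X :|: Z) = r X.
  by apply: IH => // z zZ; apply: cl; rewrite inE zZ orbT.
move: (Z) IHY sZ cl => Y' IHY sY cl.
apply/eqP; rewrite eqn_leq andbC rf_mono ?subsetUl //; last first.
  by rewrite !subUset sX sub1set yG.
have sXY : X :|: Y' \subset G by rewrite subUset sX.
have syX : y |: X \subset G by rewrite subUset sub1set yG.
have := rf_submod rf sXY syX.
have -> : X :|: Y' :|: (y |: X) = X :|: (y |: Y').
  by apply/setP=> z; rewrite !inE; case: (z \in X); case: (z \in Y'); case: (z == y).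
have : r X <= r ((X :|: Y') :&: (y |: X)).
  apply: (rf_mono rf); first exact: subset_trans (subsetIl _ _) sXY.
  by rewrite subsetI subsetUl subsetUr.
by rewrite IHY (cl y) ?setU11 //; lia.
Qed.

Definition rank_indep : {set {set T}} := [set I : {set T} | (I \subset G) && (r I == #|I|)].

Let indep_sub I : I \in rank_indep -> I \subset G.
Proof. by rewrite inE => /andP[]. Qed.

Let rf0 : r set0 = 0.
Proof. by apply/eqP; rewrite -leqn0 -(cards0 T) rf_card ?sub0set. Qed.

Let indep0 : set0 \in rank_indep.
Proof. by rewrite inE sub0set rf0 cards0. Qed.

Let indepS I J : J \in rank_indep -> I \subset J -> I \in rank_indep.
Proof.
rewrite !inE => /andP[sJ /eqP eJ] sIJ; have sI := subset_trans sIJ sJ.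
have sD := subset_trans (subsetDl J I) sJ.
rewrite sI eqn_leq rf_card //=; have := rf_submod rf sI sD.
have -> : I :|: J :\: I = J.
  by apply/setP=> z; rewrite !inE; case: (boolP (z \in I)) => //= /(subsetP sIJ).
have := rf_card rf sD; rewrite cardsD (setIidPr sIJ) eJ.
have := subset_leq_card sIJ; lia.
Qed.

Let indep_aug I J : I \in rank_indep -> J \in rank_indep -> #|I| < #|J| ->
  exists2 x, x \in J :\: I & x |: I \in rank_indep.
Proof.
rewrite !inE => /andP[sI /eqP eI] /andP[sJ /eqP eJ] ltIJ.
have [/existsP[x /andP[xJI ix]]|no] :=
  boolP [exists x, (x \in J :\: I) && (x |: I \in rank_indep)]; first by exists x.
suff : r (I :|: J) = r I.
  have : r J <= r (I :|: J) by apply: (rf_mono rf); rewrite ?subsetUr // subUset sI.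
  by rewrite eI eJ => le e; rewrite e leqNgt ltIJ in le.
apply: rf_closure => // y yJ; have yG := subsetP sJ _ yJ.
have [yI|yI] := boolP (y \in I).
  by congr r; apply/setUidPr; rewrite sub1set.
have syI : y |: I \subset G by rewrite subUset sub1set yG.
have le1 : r I <= r (y |: I) by apply: (rf_mono rf) => //; apply: subsetUr.
have := rf_card rf syI; rewrite leq_eqVlt cardsU1 yI add1n ltnS -eI.
case/orP=> [/eqP e|le2]; last by apply/eqP; rewrite eqn_leq le1 le2.
case/existsP: no; exists y; rewrite !inE yI yJ syI e /=.
by rewrite cardsU1 yI eI.
Qed.

Definition matroid_of_rank : matroid T :=
  Matroid indep_sub indep0 indepS indep_aug.

Lemma rank_matroid_of_rank X : X \subset G -> rank matroid_of_rank X = r X.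
Proof.
move=> sX; apply/eqP; rewrite eqn_leq; apply/andP; split.
  have [I [iI sI <-]] := rank_witness matroid_of_rank X.
  by move: iI; rewrite inE => /andP[_ /eqP <-]; apply: (rf_mono rf).
have [I [iI sI cI]] := rank_witness matroid_of_rank X.
rewrite -cI; move: (iI); rewrite inE => /andP[sIG /eqP <-].
suff <- : r (I :|: X) = r I by rewrite (setUidPr sI).
apply: rf_closure => // y yX; have yG := subsetP sX _ yX.
have [yI|yI] := boolP (y \in I).
  by congr r; apply/setUidPr; rewrite sub1set.
have syI : y |: I \subset G by rewrite subUset sub1set yG.
have le1 : r I <= r (y |: I) by apply: (rf_mono rf) => //; apply: subsetUr.
have eI : r I = #|I| by move: iI; rewrite inE => /andP[_ /eqP].
have := rf_card rf syI; rewrite leq_eqVlt cardsU1 yI add1n ltnS -eI.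
case/orP=> [/eqP e|le2]; last by apply/eqP; rewrite eqn_leq le1 le2.
have iyI : y |: I \in indep matroid_of_rank.
  by rewrite inE syI e cardsU1 yI eI add1n eqxx.
have : #|y |: I| <= rank matroid_of_rank X.
  by apply: leq_rank; rewrite // subUset sub1set yX.
by rewrite -cI cardsU1 yI add1n ltnn.
Qed.

End MatroidOfRank.

(** * Cycles of the wheel *)

Section LeaflessSubgraphs.
Variables (V E : finType) (ends : E -> {set V}).
Hypothesis no_loop : forall e, #|ends e| = 2.
Implicit Types (C Z : {set E}).

(** Absence of vertices of degree one. Cycles are minimal among the non-empty leafless edge sets,
    which identifies them without following vertex sequences. *)
Definition leafless Z : Prop := forall v, #|[set e in Z | v \in ends e]| != 1.

Lemma val_iter_ordS n (i : 'I_n) m : iter m (@ordS n) i = (i + m) %% n :> nat.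
Proof.
elim: m => [|m IH] /=; first by rewrite addn0 modn_small.
by rewrite IH -addn1 modnDml addn1 addnS.
Qed.

Lemma ordS_iter n (i j : 'I_n) : exists m, j = iter m (@ordS n) i.
Proof.
exists (j + (n - i)); apply: val_inj; rewrite /= val_iter_ordS addnCA.
by rewrite (subnKC (ltnW (ltn_ord i))) modnDr modn_small.
Qed.

Lemma cycle_neq0 C : edge_set_of_cycle ends C -> C != set0.
Proof.
by case=> n [v [e [n0 _ _ _ ->]]]; apply/set0Pn; exists (e (Ordinal n0)); apply: imset_f.
Qed.

(** An edge of [Z] forces the next edge of the cycle into [Z] at their common vertex, and so on all
    the way round. *)
Lemma cycle_minimal C Z : edge_set_of_cycle ends C ->
  Z \subset C -> Z != set0 -> leafless Z -> Z = C.
Proof.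
case=> n [v [e [n0 inj_v inj_e He ->]]] sZC /set0Pn[f fZ] leafZ.
have step i : e i \in Z -> e (ordS i) \in Z.
  move=> eiZ; have := leafZ (v (ordS i)).
  set S := [set _ in Z | _]; have eiS : e i \in S by rewrite inE eiZ He !inE eqxx orbT.
  rewrite (cardsD1 (e i)) eiS add1n eqSS cards_eq0 => /set0Pn[g].
  rewrite !inE => /andP[gi /andP[gZ]].
  have /imsetP[j _ eg] := subsetP sZC _ gZ.
  rewrite eg in gi gZ *; rewrite He !inE => /orP[] /eqP/inj_v => [->//|].
  by move/(can_inj (@ordSK n)) => ij; rewrite ij eqxx in gi.
apply/eqP; rewrite eqEsubset sZC; apply/subsetP=> _ /imsetP[j _ ->].
have /imsetP[i _ ef] := subsetP sZC _ fZ; rewrite ef in fZ.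
have [m ->] := ordS_iter i j; elim: m => //= m; exact: step.
Qed.

Lemma cycle_leafless C : edge_set_of_cycle ends C -> leafless C.
Proof.
case=> n [v [e [n0 inj_v inj_e He ->]]] w.
have [|/set0Pn[f]] := eqVneq [set x in [set e i | i : 'I_n] | w \in ends x] set0.
  by move=> ->; rewrite cards0.
rewrite !inE => /andP[/imsetP[i _ ->]]; rewrite He => wi.
have neq (j : 'I_n) : ordS j != j.
  apply/eqP=> ej; have := no_loop (e j); rewrite He ej.
  by rewrite setUid cards1.
have [j wj] : exists j, w = v (ordS j).
  move: wi; rewrite !inE => /orP[] /eqP ->; last by exists i.
  by exists (ord_pred i); rewrite ord_predK.
set S := [set _ in _ | _].
have m1 : e j \in S by rewrite !inE He wj !inE eqxx orbT imset_f.
have m2 : e (ordS j) \in S by rewrite !inE He wj !inE eqxx imset_f.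
have : [set e j; e (ordS j)] \subset S by rewrite subUset !sub1set m1 m2.
by move/subset_leq_card; rewrite cards2 (inj_eq inj_e) eq_sym neq; case: #|S| => [|[]].
Qed.

End LeaflessSubgraphs.

Section WheelCycles.
Variable k : nat.
Hypothesis k_gt1 : 1 < k.
Let k_gt0 : 0 < k := ltnW k_gt1.
Implicit Types (X C Z : {set wheel_edge k}).

(* Positions on the rim are natural numbers read modulo k. *)
Definition pos n : 'I_k := Ordinal (ltn_pmod n k_gt0).
Definition rim n : wheel_edge k := inl (pos n).
Definition spoke n : wheel_edge k := inr (pos n).

Lemma pos_ord (i : 'I_k) : pos i = i.
Proof. by apply: val_inj; rewrite /= modn_small. Qed.

Lemma ordS_pos n : ordS (pos n) = pos n.+1.
Proof. by apply: val_inj; rewrite /= -addn1 modnDml addn1. Qed.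

Lemma pos_period n : pos (n + k) = pos n.
Proof. by apply: val_inj; rewrite /= modnDr. Qed.

Lemma pos_inj i a b : a < k -> b < k -> pos (i + a) = pos (i + b) -> a = b.
Proof.
move=> ak bk /(congr1 val) /= /eqP; rewrite eqn_modDl => /eqP.
by rewrite !modn_small.
Qed.

Lemma pos_neq n : pos n.+1 != pos n.
Proof. by rewrite -ordS_pos ordS_neq. Qed.

Definition wheel_path i l : {set wheel_edge k} :=
  spoke i |: [set rim (i + j) | j : 'I_l].

Definition hub_cycle i l : {set wheel_edge k} := spoke (i + l) |: wheel_path i l.

Definition star n : {set wheel_edge k} := [set rim n; spoke n.+1; rim n.+1].

Lemma wheel_no_loop (e : wheel_edge k) : #|wheel_ends e| = 2.
Proof.
case: e => i /=; rewrite cards2 //; case: eqP => // -[] e.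
by have := ordS_neq i k_gt1; rewrite -e eqxx.
Qed.

Lemma leafless_star Z n : leafless (@wheel_ends k) Z -> #|Z :&: star n| != 1.
Proof.
move/(_ (Some (pos n.+1))); congr (#|pred_of_set _| != 1).
apply/setP=> -[i|i]; rewrite !inE; congr andb; rewrite /rim /spoke.
  rewrite (inj_eq (@inl_inj _ _)) (inj_eq (@inl_inj _ _)) orbF.
  rewrite !(inj_eq Some_inj) -ordS_pos (inj_eq (can_inj (@ordSK k))) orbC.
  by rewrite ![_ == i]eq_sym.
by rewrite /= (inj_eq (@inr_inj _ _)) (inj_eq Some_inj) orbF eq_sym.
Qed.

(** The property shared by cycles of the wheel graph and by matroid circuits orthogonal to the
    triads. It says nothing about the hub, where no cocircuit is available. *)
Definition starry X : Prop := forall n, #|X :&: star n| != 1.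

Lemma starry_cases X : starry X -> forall n,
  [/\ rim n \in X -> rim n.+1 \notin X -> spoke n.+1 \in X,
      rim n.+1 \in X -> rim n \notin X -> spoke n.+1 \in X &
      spoke n.+1 \in X -> (rim n \in X) || (rim n.+1 \in X)].
Proof.
move=> sX n; have lone x y z : star n = [set x; y; z] ->
    x \in X -> y \notin X -> z \notin X -> False.
  move=> e xX yX zX; have := sX n; rewrite e.
  suff -> : X :&: [set x; y; z] = [set x] by rewrite cards1.
  apply/setP=> w; rewrite !inE; case: (eqVneq w x) => [->|_]; first by rewrite xX.
  case: (eqVneq w y) => [->|_]; first by rewrite (negPf yX).
  by case: (eqVneq w z) => [->|_]; rewrite ?(negPf zX) // andbF.
have e1 : star n = [set rim n.+1; rim n; spoke n.+1].
  by apply/setP=> z; rewrite !inE orbC -!orbA.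
have e2 : star n = [set spoke n.+1; rim n; rim n.+1].
  by apply/setP=> z; rewrite !inE; congr orb; rewrite orbC.
split=> h.
- by move=> h'; apply/negPn/negP=> h''; apply: (lone _ _ _ erefl).
- by move=> h'; apply/negPn/negP=> h''; apply: (lone _ _ _ e1).
- by apply/negPn; rewrite negb_or; apply/negP=> /andP[h' h'']; apply: (lone _ _ _ e2).
Qed.

(** A maximal run of consecutive rim edges in [X] that is not the whole rim forces a spoke of [X] at
    each of its two ends. *)
Lemma starry_contains_cycle X : X != set0 -> starry X ->
  wheel_rim k \subset X \/
  exists i l, [/\ 0 < l, l < k & hub_cycle i l \subset X].
Proof.
move=> X0 sX; have cs := starry_cases sX.
have [m mX] : exists m, rim m \in X.
  case/set0Pn: X0 => -[i|i] iX; first by exists i; rewrite /rim pos_ord.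
  have [_ _ c] := cs (i + k).-1.
  move: c; rewrite prednK ?addn_gt0 ?k_gt0 ?orbT // /spoke pos_period pos_ord iX.
  by case/(_ isT)/orP => h; eexists; exact: h.
have [|/subsetPn[_ /imsetP[j _ ->] jX]] := boolP (wheel_rim k \subset X); first by left.
right.
have jX' : rim j \notin X by rewrite /rim pos_ord.
have ext : exists t, rim (j + t) \in X.
  by exists (m + (k - j)); rewrite addnCA (subnKC (ltnW (ltn_ord j))) /rim pos_period.
case: (ex_minnP ext) => -[|t] tX tmin; first by rewrite addn0 (negPf jX') in tX.
have ntX : rim (j + t) \notin X.
  by apply/negP=> /tmin; rewrite ltnn.
(* One turn of the rim leads back to the missing edge [rim (j + t)]; hence the run has fewer than
   [k] edges. *)
have exl : exists l, rim (j + t.+1 + l) \notin X.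
  by exists k.-1; rewrite addnS addSn -addnS prednK // /rim pos_period.
case: (ex_minnP exl) => l lX lmin.
have lk : l < k.
  by rewrite -(prednK k_gt0) ltnS lmin // addnS addSn -addnS prednK // /rim pos_period.
have rimX a : a < l -> rim (j + t.+1 + a) \in X.
  by move=> al; apply/negPn/negP=> /lmin; rewrite leqNgt al.
have l0 : 0 < l by case: (l) lX => //; rewrite addn0 tX.
exists (j + t.+1), l; split=> //.
apply/subsetP=> z; rewrite !inE => /or3P[/eqP->|/eqP->|/imsetP[a _ ->]].
- have [a _ _] := cs (j + t.+1 + l.-1); move: a; rewrite -addnS prednK //.
  by apply=> //; apply: rimX; rewrite prednK.
- have [_ b _] := cs (j + t); move: b; rewrite -addnS; exact.
- exact: rimX.
Qed.

Lemma hub_cycle_edges i l : 0 < l -> l < k ->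
  edge_set_of_cycle (@wheel_ends k) (hub_cycle i l).
Proof.
move=> l0 lk.
(* The hub has index 0 and the rim vertices follow, shifted by one; the two spokes are the first and
   the last of the [l.+2] edges. *)
pose v (j : 'I_l.+2) : wheel_vertex k :=
  if j == 0 :> nat then None else Some (pos (i + j.-1)).
pose e (j : 'I_l.+2) : wheel_edge k :=
  if j == 0 :> nat then spoke i else
  if j == l.+1 :> nat then spoke (i + l) else rim (i + j.-1).
have spoke_neq : spoke i <> spoke (i + l).
  rewrite -{1}[i]addn0 => h; have e0 := pos_inj k_gt0 lk (inr_inj h).
  by rewrite -e0 in l0.
exists l.+2, v, e; split=> //.
- move=> [[|a] ha] [[|b] hb]; rewrite /v //= => h; apply: val_inj => //=.
  congr S; rewrite !ltnS in ha hb; apply: (pos_inj _ _ (Some_inj h)).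
    exact: leq_ltn_trans ha lk.
  exact: leq_ltn_trans hb lk.
- move=> [[|a] ha] [[|b] hb]; rewrite /e //= => h; apply: val_inj => //=.
  + by move: h; case: eqP.
  + by move: h; case: eqP => // _ /esym.
  move: h; rewrite !eqSS; case: eqP => [->|_]; case: eqP => [->|_] //.
  move=> h; congr S; rewrite !ltnS in ha hb; apply: (pos_inj _ _ (inl_inj h)).
    exact: leq_ltn_trans ha lk.
  exact: leq_ltn_trans hb lk.
- move=> [[|a] ha]; rewrite /e /v /=.
    by rewrite addn0.
  rewrite !ltnS in ha; rewrite eqSS; case: eqP => [->|al] /=.
    by rewrite modnn /= setUC.
  have al' : a < l by rewrite ltn_neqAle ha andbT; apply/eqP.
  by rewrite modn_small ?ltnS //= ordS_pos addnS.
apply/setP=> z; apply/idP/imsetP.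
  rewrite !inE => /or3P[/eqP->|/eqP->|/imsetP[a _ ->]].
  - by exists ord_max; rewrite // /e /= eqxx.
  - by exists ord0.
  have ha : a.+1 < l.+2 by rewrite !ltnS ltnW.
  by exists (Ordinal ha); rewrite // /e /= eqSS ltn_eqF.
case=> [[[|a] ha]] _ ->; rewrite /e /=; first by rewrite !inE eqxx orbT.
rewrite eqSS; case: eqP => [_|al] /=; first by rewrite setU11.
rewrite !ltnS in ha; have al' : a < l by rewrite ltn_neqAle ha andbT; apply/eqP.
by rewrite !inE; apply/or3P/Or33/imsetP; exists (Ordinal al').
Qed.

Lemma rim_edges : edge_set_of_cycle (@wheel_ends k) (wheel_rim k).
Proof.
exists k, (fun i => Some i), (fun i => inl i); split=> //.
- exact: Some_inj.
- exact: inl_inj.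
Qed.

Section WheelMatroids.
Variable N : matroid (wheel_edge k).
Hypothesis groundN : ground N = setT.

Section Fan.
Hypothesis triangle : forall n, [set spoke n; rim n; spoke n.+1] \in circuits N.
Hypothesis triad : forall C, C \in circuits N -> starry C.

(** By induction on [l], the spoke at [i + l] lies in the closure of [wheel_path i l]: each triangle
    puts the next spoke in the closure of the previous spoke and the rim edge between them. *)
Lemma hub_cycle_dep i l : 0 < l -> l < k -> hub_cycle i l \notin indep N.
Proof.
move=> l0 lk; apply: rank_dep.
  rewrite !inE negb_or; apply/andP; split; last by apply/imsetP=> -[].
  apply/negP=> /eqP; rewrite -[in RHS](addn0 i) => h.
  by have e0 := pos_inj lk k_gt0 (inr_inj h); rewrite e0 in l0.
elim: l {l0 lk} => [|l IH].
  by congr rank; apply/setUidPr; rewrite sub1set !inE addn0 eqxx.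
have path_step : wheel_path i l.+1 = rim (i + l) |: wheel_path i l.
  rewrite /wheel_path [in RHS]setUA [[set _; spoke i]]setUC -setUA; congr setU.
  apply/setP=> z; apply/imsetP/setU1P.
    case=> j _ ->; have [jl|] := ltnP j l.
      by right; apply/imsetP; exists (Ordinal jl).
    by move=> lj; left; congr (rim (i + _)); apply/eqP; rewrite eqn_leq lj -ltnS ltn_ord.
  case=> [->|/imsetP[j _ ->]]; first by exists ord_max.
  by exists (widen_ord (leqnSn l) j).
have step : rank N (spoke (i + l.+1) |: [set spoke (i + l); rim (i + l)])
    = rank N [set spoke (i + l); rim (i + l)].
  have t := triangle (i + l); rewrite -addnS in t.
  have sin : spoke (i + l.+1) \in [set spoke (i + l); rim (i + l); spoke (i + l.+1)].
    by rewrite !inE eqxx orbT.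
  have := circuit_rank t sin; rewrite setUC => ->; congr rank.
  rewrite setU1K // !inE orbF addnS.
  by apply/eqP=> h; have := pos_neq (i + l); rewrite (inr_inj h) eqxx.
set W := wheel_path i l.+1; set P := wheel_path i l in IH path_step.
have c1 : rank N (spoke (i + l) |: W) = rank N W.
  by apply: rank_closure_mono IH; rewrite /W path_step subsetUr.
rewrite -c1; apply/eqP; rewrite eqn_leq; apply/andP; split; last first.
  by rewrite c1; apply/rank_mono/subsetUr.
apply: leq_trans (rank_mono _ (setUS [set spoke (i + l.+1)] (subsetUr [set spoke (i + l)] W))) _.
rewrite (rank_closure_mono _ step) // subUset !sub1set !inE eqxx /=.
by apply/imsetP; exists ord_max.
Qed.

Lemma circuit_contains_cycle C : C \in circuits N ->
  exists2 Z, edge_set_of_cycle (@wheel_ends k) Z & Z \subset C.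
Proof.
move=> cC; have C0 : C != set0.
  by apply: contraTneq cC => ->; apply/negP=> /circuitP[_]; rewrite indep_set0.
have [sR|[i [l [l0 lk sH]]]] := starry_contains_cycle C0 (triad cC).
  by exists (wheel_rim k) => //; exact: rim_edges.
by exists (hub_cycle i l) => //; exact: hub_cycle_edges.
Qed.

Lemma cycle_is_rim_or_hub Z : edge_set_of_cycle (@wheel_ends k) Z ->
  Z = wheel_rim k \/ exists i l, [/\ 0 < l, l < k & Z = hub_cycle i l].
Proof.
move=> cZ; have lZ := cycle_leafless wheel_no_loop cZ.
have sZ : starry Z by move=> n; apply: leafless_star.
have [sR|[i [l [l0 lk sH]]]] := starry_contains_cycle (cycle_neq0 cZ) sZ.
  left; apply: esym; apply: (cycle_minimal cZ sR (cycle_neq0 rim_edges)).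
  exact: (cycle_leafless wheel_no_loop rim_edges).
right; exists i, l; split=> //; have cH := hub_cycle_edges i l0 lk.
apply/esym; apply: (cycle_minimal cZ sH (cycle_neq0 cH)).
exact: (cycle_leafless wheel_no_loop cH).
Qed.

Lemma cycle_antichain Z Z' : edge_set_of_cycle (@wheel_ends k) Z ->
  edge_set_of_cycle (@wheel_ends k) Z' -> Z' \subset Z -> Z' = Z.
Proof.
move=> cZ cZ' s; apply: cycle_minimal cZ s (cycle_neq0 cZ') _.
exact: (cycle_leafless wheel_no_loop cZ').
Qed.

(** Every circuit contains a cycle and every cycle is dependent, so the minimal members of the two
    families agree. The rim is the one cycle whose dependence does not follow from the triangles. *)
Lemma wheel_matroid_of_fan : wheel_rim k \notin indep N -> is_wheel_matroid N.
Proof.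
move=> dR.
have dep Z : edge_set_of_cycle (@wheel_ends k) Z -> Z \notin indep N.
  by case/cycle_is_rim_or_hub=> [->//|[i [l [l0 lk ->]]]]; apply: hub_cycle_dep.
split=> // C; split=> [cC|cZ].
  have [Z cZ sZ] := circuit_contains_cycle cC.
  suff <- : Z = C by [].
  apply/eqP; rewrite eqEsubset sZ; apply/subsetP=> x xC; apply/negPn/negP=> xZ.
  have /circuitP[_ _ /(_ x xC) iC] := cC; case/negP: (dep Z cZ).
  apply: indep_subset iC _; apply/subsetP=> z zZ; rewrite !inE (subsetP sZ) // andbT.
  by apply: contraNneq xZ => <-.
have [|C' cC' sC'] := dep_circuit (M := N) _ (dep C cZ); first by rewrite groundN subsetT.
have [Z cZ' sZ] := circuit_contains_cycle cC'.
have eZ := cycle_antichain cZ cZ' (subset_trans sZ sC').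
suff <- : C' = C by [].
by apply/eqP; rewrite eqEsubset sC' -eZ sZ.
Qed.

End Fan.
End WheelMatroids.
End WheelCycles.

(** * Pullbacks and wheel matroids *)

Section WheelRank.
Variables (k : nat) (k_gt1 : 1 < k) (N : matroid (wheel_edge k)).
Hypothesis wheelN : is_wheel_matroid N.

Local Notation spokes := [set (inr i : wheel_edge k) | i : 'I_k].

Lemma card_hub_cycle i l : 0 < l -> l < k -> #|hub_cycle k_gt1 i l| = l.+2.
Proof.
move=> l0 lk; rewrite /hub_cycle /wheel_path !cardsU1 card_imset ?card_ord; last first.
  move=> a b h; apply: val_inj.
  by apply: (pos_inj _ _ (inl_inj h)); apply: ltn_trans lk.
rewrite !inE negb_or; have -> : spoke k_gt1 (i + l) != spoke k_gt1 i.
  apply/eqP; rewrite -[in RHS](addn0 i) => h.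
  by have := pos_inj lk (ltnW k_gt1) (inr_inj h); case: (l) l0.
have nsp a : spoke k_gt1 a \notin [set rim k_gt1 (i + j) | j : 'I_l].
  by apply/imsetP=> -[].
by rewrite !nsp.
Qed.

Lemma spokes_indep : spokes \in indep N.
Proof.
case: wheelN => gN cN; apply/negPn/negP=> dS.
have [|C cC sC] := dep_circuit (M := N) _ dS; first by rewrite gN subsetT.
have [e|[i [l [l0 lk e]]]] := cycle_is_rim_or_hub k_gt1 (proj1 (cN C) cC).
  have : inl (pos k_gt1 0) \in C by rewrite e imset_f.
  by move/(subsetP sC)/imsetP=> -[].
have : rim k_gt1 (i + Ordinal l0) \in C by rewrite e !inE imset_f ?orbT.
by move/(subsetP sC)/imsetP=> -[].
Qed.

Lemma hub_cycle_circuit i l : 0 < l -> l < k -> hub_cycle k_gt1 i l \in circuits N.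
Proof. by case: wheelN => _ cN l0 lk; apply/cN/hub_cycle_edges. Qed.

Lemma wheel_rank : mrank N = k.
Proof.
case: (wheelN) => gN cN; rewrite -(max_indep_card spokes_indep).
  by rewrite card_imset ?card_ord //; apply: inr_inj.
move=> [i|i] _; last by rewrite imset_f.
move=> _; have /circuitP[_ d _] := hub_cycle_circuit i (isT : 0 < 1) k_gt1.
apply: contra d => /indep_subset; apply.
apply/subsetP=> z; rewrite !inE => /or3P[/eqP->|/eqP->|/imsetP[j _ ->]].
- by rewrite imset_f ?orbT.
- by rewrite imset_f ?orbT.
by rewrite ord1 addn0 /rim pos_ord eqxx.
Qed.

(** For more than three spokes the rim is too long to be a triangle, which leaves the hub cycles
    with one rim edge. *)
Lemma rim_triangle i C : 3 < k -> C \in triangles N -> inl i \in C ->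
  C = [set inr i; inl i; inr (ordS i)].
Proof.
move=> k3; rewrite inE => /andP[cC /eqP C3] iC; case: wheelN => _ cN.
have [e|[j [l [l0 lk e]]]] := cycle_is_rim_or_hub k_gt1 (proj1 (cN C) cC).
  move: C3; rewrite e card_imset; last exact: inl_inj.
  by rewrite card_ord => ek; rewrite ek in k3.
have l1 : l = 1 by move: C3; rewrite e card_hub_cycle // => -[].
move: iC; rewrite e l1 !inE => /imsetP[a _]; rewrite ord1 addn0 => h; have ei := inl_inj h.
apply/setP=> z; rewrite !inE ei /spoke addn1 ordS_pos.
rewrite (_ : [set rim _ _ | _ : 'I_1] = [set rim k_gt1 j]); last first.
  apply/setP=> y; rewrite inE; apply/imsetP/eqP=> [[b _]|->]; first by rewrite ord1 addn0.
  by exists ord0; rewrite ?addn0.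
by rewrite !inE /rim orbC.
Qed.

End WheelRank.

Section Pullback.
Variables (U T : finType) (M : matroid T) (g : U -> T).
Hypothesis g_inj : injective g.
Implicit Types (I J X C : {set U}).

Let pb_indep : {set {set U}} := [set J : {set U} | g @: J \in indep M].

Let pb_ground J : J \in pb_indep -> J \subset g @^-1: ground M.
Proof. by rewrite inE => /indep_ground; rewrite sub_imset_pre. Qed.

Let pb_set0 : set0 \in pb_indep.
Proof. by rewrite inE imset0 indep_set0. Qed.

Let pb_subset I J : J \in pb_indep -> I \subset J -> I \in pb_indep.
Proof. by rewrite !inE => iJ /(imsetS g); apply: indep_subset. Qed.

Let pb_augment I J : I \in pb_indep -> J \in pb_indep -> #|I| < #|J| ->
  exists2 x, x \in J :\: I & x |: I \in pb_indep.
Proof.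
rewrite !inE -(card_imset I g_inj) -(card_imset J g_inj) => iI iJ lt.
have [y] := indep_augment iI iJ lt.
rewrite inE => /andP[yI /imsetP[x xJ ey]] ix; exists x; rewrite ?inE.
  by rewrite xJ andbT; apply: contra yI => xI; rewrite ey imset_f.
by rewrite imsetU1 -ey.
Qed.

(** Transports a labelled matroid to the edge type of the wheel, where the predicates for wheels and
    whirls are stated. *)
Definition pullback : matroid U := Matroid pb_ground pb_set0 pb_subset pb_augment.

Lemma pullback_indep J : (J \in indep pullback) = (g @: J \in indep M).
Proof. by rewrite inE. Qed.

Lemma pullback_rank X : rank pullback X = rank M (g @: X).
Proof.
apply/eqP; rewrite eqn_leq; apply/andP; split.
  have [I [iI sI <-]] := rank_witness pullback X.
  by rewrite -(card_imset I g_inj) leq_rank ?imsetS -?pullback_indep.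
have [I [iI sI <-]] := rank_witness M (g @: X).
have eI : I = g @: (g @^-1: I).
  apply/eqP; rewrite eqEsubset sub_imset_pre subxx andbT; apply/subsetP=> y yI.
  have /imsetP[x xX ey] := subsetP sI _ yI.
  by rewrite ey imset_f // inE -ey.
rewrite eI card_imset // leq_rank ?pullback_indep -?eI //.
apply/subsetP=> x; rewrite inE => /(subsetP sI)/imsetP[x' x'X].
by move/g_inj->.
Qed.

Lemma pullback_circuit C : C \in circuits pullback -> g @: C \in circuits M.
Proof.
case/circuitP=> sC dC iC; apply/circuitP; split; first by rewrite sub_imset_pre.
  by rewrite -pullback_indep.
move=> _ /imsetP[x xC ->]; have := iC x xC; rewrite pullback_indep.
suff -> : g @: C :\ g x = g @: (C :\ x) by [].
apply/setP=> y; rewrite !inE; apply/andP/imsetP.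
  case=> ny /imsetP[z zC ey]; exists z; rewrite // !inE zC andbT.
  by apply: contraNneq ny => <-; rewrite ey.
case=> z; rewrite !inE => /andP[zx zC] ->; rewrite (inj_eq g_inj) zx.
by rewrite imset_f.
Qed.

Lemma circuit_pullback C : g @: C \in circuits M -> C \in circuits pullback.
Proof.
case/circuitP=> sC dC iC; apply/circuitP; split; first by rewrite -sub_imset_pre.
  by rewrite pullback_indep.
move=> x xC; rewrite pullback_indep; apply: indep_subset (iC (g x) (imset_f g xC)) _.
apply/subsetP=> _ /imsetP[z zCx ->]; move: zCx; rewrite !inE => /andP[zx zC].
by rewrite (inj_eq g_inj) zx imset_f.
Qed.

Lemma pullback_isomorphism (u0 : U) : g @: setT = ground M ->
  exists f, isomorphism M pullback f /\ cancel g f.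
Proof.
move=> g_onto; pose f y := odflt u0 [pick x | g x == y].
have gK : cancel g f.
  move=> x; rewrite /f; case: pickP => [x' /eqP/g_inj //|/(_ x)].
  by rewrite eqxx.
exists f; split=> //; have fK : {in ground M, cancel f g}.
  by move=> y; rewrite -g_onto => /imsetP[x _ ->]; rewrite gK.
have imK (A : {set T}) : A \subset ground M -> g @: (f @: A) = A.
  move=> sA; rewrite -imset_comp -[RHS]imset_id; apply: eq_in_imset => y yA.
  exact: fK (subsetP sA _ yA).
split=> [||I sI]; first exact: can_in_inj fK.
  rewrite /= -g_onto -imset_comp; apply/setP=> x; rewrite !inE imset_f // ?inE //.
  by apply/imsetP; exists x; rewrite //= gK.
by rewrite pullback_indep imK.
Qed.

End Pullback.

(** * Extremal matroids without 2-separations *)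

Section Tightening.
Variables (T : finType) (M : matroid T) (B : {set T}).
Hypothesis baseB : B \in bases M.
Hypothesis freeB : forall x y, x \in B -> y \in ground M -> y \notin B ->
  y |: (B :\ x) \in indep M.
Hypothesis B_neq0 : B != set0.

Let ti : {set {set T}} := indep M :\ B.

Let ti_ground (I : {set T}) : I \in ti -> I \subset ground M.
Proof. by rewrite inE => /andP[_ /indep_ground]. Qed.

Let ti_set0 : set0 \in ti.
Proof. by rewrite !inE eq_sym B_neq0 indep_set0. Qed.

Let iB : B \in indep M. Proof. by have /basesP[] := baseB. Qed.

Let ti_subset (I J : {set T}) : J \in ti -> I \subset J -> I \in ti.
Proof.
rewrite !inE => /andP[JB iJ] sIJ; rewrite (indep_subset iJ sIJ) andbT.
apply: contraNneq JB => eI; rewrite eI in sIJ.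
rewrite eq_sym eqEcard sIJ; have /basesP[_ ->] := baseB.
exact: leq_rank iJ (indep_ground iJ).
Qed.

Let ti_augment (I J : {set T}) : I \in ti -> J \in ti -> #|I| < #|J| ->
  exists2 x, x \in J :\: I & x |: I \in ti.
Proof.
rewrite !inE => /andP[IB iI] /andP[JB iJ] lt.
have [x xJI ix] := indep_augment iI iJ lt.
have [eB|nB] := eqVneq (x |: I) B; last by exists x; rewrite // !inE nB.
have xI : x \notin I by move: xJI; rewrite inE => /andP[].
have [y yJ yB] : exists2 y, y \in J & y \notin B.
  apply/subsetPn; apply: contra JB => sJB; rewrite eqEcard sJB -eB cardsU1 xI.
  exact: lt.
have yI : y \notin I by apply: contra yB; rewrite -eB !inE => ->; rewrite orbT.
exists y; rewrite !inE ?yI ?yJ //.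
have eI : I = B :\ x by rewrite -eB setU1K.
rewrite {2}eI freeB ?(subsetP (indep_ground iJ)) // -?eB ?setU11 // andbT.
by apply: contraNneq yB => e; rewrite -eB -e setU11.
Qed.

(* The inverse of relaxation. *)
Definition tightening : matroid T :=
  Matroid ti_ground ti_set0 ti_subset ti_augment.

Lemma tightening_indep I : (I \in indep tightening) = (I != B) && (I \in indep M).
Proof. by rewrite !inE. Qed.

Lemma tightening_circuit : B \in circuits tightening.
Proof.
apply/circuitP; split; first exact: indep_ground iB.
  by rewrite tightening_indep eqxx.
move=> x xB; rewrite tightening_indep (indep_subset iB) ?subD1set // andbT.
by apply/eqP=> /setP/(_ x); rewrite !inE eqxx xB.
Qed.

Lemma tightening_relaxation : mrank tightening = mrank M ->
  is_relaxation tightening B M.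
Proof.
move=> eR; have /basesP[_ cB] := baseB.
have /set0Pn[b bB] := B_neq0.
have rB : (rank tightening B).+1 = #|B|.
  rewrite (circuit_rank tightening_circuit bB).
  have /circuitP[_ _ /(_ b bB)] := tightening_circuit.
  by rewrite indepE => /eqP ->; rewrite [in RHS](cardsD1 b) bB.
split=> //; first exact: tightening_circuit.
  split; last by rewrite rB eR cB.
  split; first exact: indep_ground iB.
  move=> x; rewrite inE => /andP[xB xG].
  rewrite rB -[#|B|](_ : #|x |: B :\ b| = _); last first.
    by rewrite cardsU1 !inE (negPf xB) andbF [in RHS](cardsD1 b) bB.
  apply: leq_rank; last by rewrite setUS ?subD1set.
  rewrite tightening_indep freeB // andbT.
  by apply: contraNneq xB => <-; rewrite setU11.
apply/setP=> I; rewrite in_setU1; apply/basesP/orP.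
  case=> iI cI; have [->|nB] := eqVneq I B; first by left.
  by right; apply/basesP; rewrite tightening_indep nB eR.
case=> [/eqP->|/basesP[]]; first by split.
by rewrite tightening_indep eR => /andP[_].
Qed.

End Tightening.

(** * Whirls as relaxed wheels *)

Section WhirlMatroids.
Variables (k : nat) (k_gt1 : 1 < k) (N : matroid (wheel_edge k)).
Hypothesis groundN : ground N = setT.
Hypothesis triangle : forall n,
  [set spoke k_gt1 n; rim k_gt1 n; spoke k_gt1 n.+1] \in circuits N.
Hypothesis triad : forall C, C \in circuits N -> starry k_gt1 C.

Lemma whirl_matroid_of_fan :
  wheel_rim k \in indep N -> mrank N = k -> is_whirl N.
Proof.
move=> iR rN; have cR : #|wheel_rim k| = k.
  by rewrite card_imset ?card_ord //; apply: inl_inj.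
have bR : wheel_rim k \in bases N by apply/basesP; rewrite cR.
(* A circuit in the exchanged set would contain the whole rim, although [x] is missing, or a hub
   cycle, although [y] is the only spoke. *)
have freeR x y : x \in wheel_rim k -> y \in ground N -> y \notin wheel_rim k ->
    y |: wheel_rim k :\ x \in indep N.
  move=> xR _ yR; apply/negPn/negP=> d.
  have [|C cC sC] := dep_circuit (M := N) _ d; first by rewrite groundN subsetT.
  have C0 : C != set0.
    by apply: contraTneq cC => ->; apply/negP=> /circuitP[_]; rewrite indep_set0.
  have [sR|[i [l [l0 lk sH]]]] := starry_contains_cycle C0 (triad cC).
    have := subsetP sC _ (subsetP sR _ xR); rewrite !inE eqxx orbF => /eqP exy.
    by rewrite -exy xR in yR.
  have eqy n : spoke k_gt1 n \in C -> spoke k_gt1 n = y.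
    move/(subsetP sC); rewrite !inE => /orP[/eqP//|/andP[_ /imsetP[]//]].
  have e1 := eqy _ (subsetP sH _ (setU11 _ _)).
  have e2 : spoke k_gt1 i = y by apply: eqy; apply: (subsetP sH); rewrite !inE eqxx orbT.
  have := inr_inj (etrans e1 (esym e2)); rewrite -[in RHS](addn0 i).
  by move/(pos_inj lk (ltnW k_gt1)) => e0; rewrite e0 in l0.
have R0 : wheel_rim k != set0 by rewrite -card_gt0 cR ltnW.
(* The rim of [W] is dependent, so [W] is recognised as the wheel of which [N] is the relaxation. *)
pose W := tightening bR freeR R0.
have subW I : I \in indep W -> I \in indep N.
  by rewrite tightening_indep => /andP[].
have wheelW : is_wheel_matroid W.
  apply: (@wheel_matroid_of_fan k k_gt1) => //.
  - move=> n; have /circuitP[sC dC iC] := triangle n; apply/circuitP; split=> //.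
      by apply: contra dC; apply: subW.
    move=> x xC; rewrite tightening_indep iC // andbT.
    apply/eqP=> /setP e; have [es|ns] := eqVneq x (spoke k_gt1 n).
      have := e (spoke k_gt1 n.+1); rewrite !inE eqxx orbT andbT es.
      rewrite (_ : _ \in wheel_rim k = false); last by apply/imsetP=> -[].
      by move=> h; have := pos_neq k_gt1 n; rewrite (inr_inj (eqP (negbFE h))) eqxx.
    have := e (spoke k_gt1 n); rewrite !inE eqxx eq_sym ns.
    by rewrite (_ : _ \in wheel_rim k = false) //; apply/imsetP=> -[].
  - move=> C cC; have [->|nC] := eqVneq C (wheel_rim k).
      move=> n; apply: leafless_star.
      exact (cycle_leafless (wheel_no_loop k_gt1) (rim_edges k_gt1)).
    apply: triad; have /circuitP[sC dC iC] := cC; apply/circuitP; split=> //.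
      by move: dC; rewrite tightening_indep nC.
    by move=> x /iC/subW.
  - by rewrite tightening_indep eqxx.
exists W => //; apply: tightening_relaxation.
by rewrite (wheel_rank k_gt1 wheelW) rN.
Qed.

End WhirlMatroids.

Definition tight (T : finType) (M : matroid T) : pred {set T} :=
  [pred X : {set T} | (X \subset ground M) && (#|X|.+1 == 2 * rank M X)].

(** What the equality case extracts from minimal degeneracy. In this form it is also established for
    the parts of a 2-separation. *)
Record extremal (T : finType) (M : matroid T) : Prop := Extremal {
  ext_card : #|ground M| = 2 * mrank M;
  ext_gt3 : 3 < #|ground M|;
  ext_sparse (X : {set T}) :
    X \proper ground M -> X != set0 -> #|X| < 2 * rank M X;
  ext_peel : peelable (tight M) }.

Section Extremal.
Variables (T : finType) (M : matroid T).
Hypothesis extM : extremal M.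
Local Notation E := (ground M).

Lemma extremal_tight_family : tight_family E (tight M).
Proof.
split=> [X|X||X Y|x xE|x xE].
- by case/andP.
- by case/andP=> _ /eqP e; rewrite -[odd _]negbK -[~~ odd _]/(odd _.+1) e mul2n odd_double.
- by rewrite (ext_card extM) mul2n odd_double.
(* Submodularity bounds the sum of [f] over join and meet by 2, while sparsity makes each term at
   least 1; so both are 1. *)
- case/andP=> sX /eqP rX /andP[sY /eqP rY] n0 nE.
  have XYE : X :|: Y \proper E by rewrite properEneq nE subUset sX.
  have IE : X :&: Y \proper E.
    apply: sub_proper_trans XYE; exact: subset_trans (subsetIl _ _) (subsetUl _ _).
  have U0 : X :|: Y != set0.
    apply: contraNneq n0 => e; rewrite -subset0 -e.
    exact: subset_trans (subsetIl _ _) (subsetUl _ _).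
  have h1 := ext_sparse extM XYE U0; have h2 := ext_sparse extM IE n0.
  have h3 := rank_submod M X Y; have h4 := cardsUI X Y.
  rewrite /tight /= (proper_sub XYE) (proper_sub IE) /=.
  by move: rX rY h1 h2 h3 h4; clear; lia.
- rewrite /tight /= sub1set xE cards1 /=.
  have xP : [set x] \proper E.
    rewrite properEcard sub1set xE cards1; apply: leq_trans (ext_gt3 extM); exact: isT.
  have x0 : [set x] != set0 by apply/set0Pn; exists x; rewrite inE.
  have := ext_sparse extM xP x0; have := rank_leq_card M [set x].
  by rewrite cards1; clear; lia.
- have cE : #|E :\ x|.+1 = #|E| by rewrite [in RHS](cardsD1 x) xE.
  have g3 := ext_gt3 extM.
  have xP : E :\ x \proper E by rewrite properD1.
  have x0 : E :\ x != set0 by rewrite -card_gt0; move: cE g3; clear; lia.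
  have := ext_sparse extM xP x0; have := rank_mono M (subD1set E x).
  rewrite /tight /= subD1set /= -/(mrank M); have := ext_card extM.
  by move: cE; clear; lia.
Qed.

Let tauE := extremal_tight_family.

Lemma tight3_circuit t : tight M t -> #|t| = 3 -> t \in circuits M.
Proof.
move=> tt t3; have /andP[st /eqP rt] := tt; apply/circuitP; split=> //.
  by rewrite indepE t3; apply/eqP=> r3; rewrite r3 t3 in rt.
move=> x xt; have c2 : #|t :\ x| = 2.
  by have := cardsD1 x t; rewrite xt t3 => -[].
rewrite indepE c2 eqn_leq -[X in _ <= X]c2 rank_leq_card /=.
have tP : t :\ x \proper E.
  exact: sub_proper_trans (subD1set _ _) (tight_proper tauE tt).
have := ext_sparse extM tP; rewrite -card_gt0 c2 => /(_ isT).
by clear; lia.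
Qed.

(** If they met in [c] alone, [c] would lie in the closure of the tight set [E :\: D]; adding it
    would raise the size but not the rank, against sparsity. *)
Lemma circuit_cotight C D : C \in circuits M -> cotight E (tight M) D ->
  #|D| = 3 -> #|C :&: D| != 1.
Proof.
move=> cC /andP[sD tD] D3; apply/cards1P=> -[c ec].
have /setIP[cC' cD] : c \in C :&: D by rewrite ec inE.
have sC : C \subset E by case/circuitP: cC.
have rc : rank M (c |: (E :\: D)) = rank M (E :\: D).
  apply: (@rank_closure_mono _ _ _ (C :\ c)).
    apply/subsetP=> z; rewrite !inE => /andP[zc zC]; rewrite (subsetP sC) // andbT.
    apply: contra zc => zD; have : z \in C :&: D by rewrite inE zC.
    by rewrite ec inE.
  by rewrite setD1K // (circuit_rank cC cC').
have cN : c \notin E :\: D by rewrite !inE cD.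
have cE : c \in E := subsetP sD _ cD.
have sub : c |: (E :\: D) \subset E by rewrite subUset sub1set cE subsetDl.
have cP : c |: (E :\: D) \proper E.
  rewrite properEcard sub cardsU1 cN cardsD (setIidPr sD) D3.
  by have := ext_gt3 extM; clear; lia.
have := ext_sparse extM cP; rewrite -card_gt0 cardsU1 cN rc.
case/andP: tD => _ /eqP <-; rewrite ltnn => /(_ isT).
by [].
Qed.

Lemma unsplittable_wheel_or_whirl : unsplittable E (tight M) ->
  (exists k (N : matroid (wheel_edge k)) (f : T -> wheel_edge k),
     [/\ 3 <= k, is_wheel_matroid N & isomorphism M N f]) \/
  whirl_type M.
Proof.
move=> conn.
have [k [g [k_gt1 g_inj g_onto tri trd]]] :=
  tight_wheel tauE conn (ext_peel extM) (ext_gt3 extM).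
have cE : #|E| = 2 * k.
  by rewrite -g_onto card_imset // cardsT card_sum card_ord addnn mul2n.
pose N := pullback M g_inj.
have [f [isoN _]] := pullback_isomorphism (M := M) g_inj (inl (pos k_gt1 0)) g_onto.
have groundN : ground N = setT.
  by apply/setP=> e; rewrite !inE -g_onto imset_f ?inE.
have card3 (a b c : wheel_edge k) : uniq [:: a; b; c] ->
    #|[set g a; g b; g c]| = 3.
  by move=> u; rewrite -imset3 card_imset // card_set3.
have triN n : [set spoke k_gt1 n; rim k_gt1 n; spoke k_gt1 n.+1] \in circuits N.
  apply: circuit_pullback; rewrite imset3; apply: tight3_circuit.
    by have := tri (pos k_gt1 n); rewrite ordS_pos.
  apply: card3; rewrite /= !inE /= andbT; apply/eqP=> h.
  by have := pos_neq k_gt1 n; rewrite (inr_inj h) eqxx.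
have trdN C : C \in circuits N -> starry k_gt1 C.
  move=> /pullback_circuit cC n.
  have := circuit_cotight cC (D := g @: star k_gt1 n).
  rewrite -imsetI ?card_imset //; last by move=> ? ? _ _; apply: g_inj.
  rewrite imset3 => -> //; first by have := trd (pos k_gt1 n); rewrite ordS_pos.
  apply: card_set3; rewrite /= !inE /= andbT; apply/eqP=> h.
  by have := pos_neq k_gt1 n; rewrite (inl_inj h) eqxx.
have [iR|dR] := boolP (wheel_rim k \in indep N).
  right; exists k, N; split=> //; last by exists f.
  apply: (whirl_matroid_of_fan groundN triN trdN iR).
  rewrite /mrank groundN pullback_rank g_onto -/(mrank M).
  by have := ext_card extM; rewrite cE; clear; lia.
left; exists k, N, f; split=> //; last exact: wheel_matroid_of_fan groundN triN trdN dR.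
(* For [k = 2] the rim is a pair, which sparsity makes independent; a dependent rim therefore has at
   least three edges. *)
rewrite ltn_neqAle k_gt1 andbT; apply: contraNneq dR => k2; subst k.
rewrite pullback_indep indepE.
have c2 : #|g @: wheel_rim 2| = 2.
  by rewrite card_imset // card_imset ?card_ord //; apply: inl_inj.
rewrite eqn_leq rank_leq_card c2.
have rP : g @: wheel_rim 2 \proper E.
  by rewrite properEcard c2 cE andbT -g_onto imsetS ?subsetT.
have := ext_sparse extM rP; rewrite -card_gt0 c2 => /(_ isT).
by clear; lia.
Qed.

End Extremal.

(** * Minimally degenerate matroids are extremal *)

Section SmallCocircuits.
Variables (T : finType) (M : matroid T).
Implicit Types (X C : {set T}).

Lemma cogirth_leq_ground : cogirth M <= #|ground M|.
Proof. by rewrite /cogirth; elim/big_rec: _ => // C m _; rewrite geq_min orbC => ->. Qed.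

(** The strict inequality rules out that the value is merely the default of the empty minimum. *)
Lemma cogirth_witness : cogirth M < #|ground M| ->
  exists2 C, C \in cocircuits M & #|C| <= cogirth M.
Proof.
rewrite /cogirth; elim/big_rec: _ => [|C m cC IH]; first by rewrite ltnn.
rewrite /minn; case: ifP => [lt _|_ /IH//]; by exists C.
Qed.

(** If the rank did not drop, a basis would avoid [C], and [C] would be coindependent. *)
Lemma cocircuit_rank C : C \in cocircuits M ->
  C \subset ground M /\ rank M (ground M :\: C) < mrank M.
Proof.
rewrite inE => /minsetP[/= /andP[sC dC] _]; split=> //.
rewrite ltn_neqAle rank_mono ?subsetDl // andbT; apply: contra dC => /eqP e.
have [I [iI sI cI]] := rank_witness M (ground M :\: C).
rewrite inE; apply/existsP; exists I; apply/andP; split.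
  by apply/basesP; rewrite cI e.
rewrite subsetD sC disjoint_sym; move: sI; rewrite subsetD => /andP[_ ->].
by [].
Qed.

End SmallCocircuits.

Section Restrictions.
Variables (T : finType) (M : matroid T).
Implicit Types (X C : {set T}).

Lemma restrict_rank X Y : rank (restrict M X) Y = rank M (Y :&: X).
Proof.
apply/eqP; rewrite eqn_leq; apply/andP; split.
  have [I [iI sI <-]] := rank_witness (restrict M X) Y.
  by move: iI; rewrite inE => /andP[iI sIX]; apply: leq_rank; rewrite // subsetI sI.
have [I [iI]] := rank_witness M (Y :&: X); rewrite subsetI => /andP[sIY sIX] <-.
by apply: leq_rank; rewrite // inE iI.
Qed.

Lemma small_cocircuit X k : X \subset ground M ->
    cogirth (restrict M X) <= k -> k < #|X| ->
  exists C, [/\ C \subset X, #|C| <= k & rank M (X :\: C) < rank M X].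
Proof.
move=> sX gk kX; have gX : ground (restrict M X) = X by exact/setIidPr.
have [|C cC leC] := @cogirth_witness _ (restrict M X).
  by rewrite gX; apply: leq_ltn_trans kX.
have [sC rC] := cocircuit_rank cC; exists C; split.
- by rewrite gX in sC.
- exact: leq_trans gk.
- by move: rC; rewrite /mrank gX !restrict_rank setIid (setIidPl (subsetDl _ _)).
Qed.

End Restrictions.

Section MinimallyDegenerate.
Variables (T : finType) (M : matroid T).
Hypotheses (M_simple : simple M) (M_min : minimally_degenerate 3 M).
Local Notation E := (ground M).
Implicit Types (X C : {set T}).

Lemma simple_indep X : X \subset E -> #|X| <= 2 -> X \in indep M.
Proof.
move=> sX X2; apply/negPn/negP=> /(dep_circuit sX)[C /M_simple C3].
by move/subset_leq_card/leq_trans => /(_ _ X2); rewrite leqNgt C3.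
Qed.

Let peel X : X \proper E -> 2 < #|X| ->
  exists C, [/\ C \subset X, #|C| <= 2 & rank M (X :\: C) < rank M X].
Proof.
case: M_min => _ _ _ _ mn pX X2; apply: small_cocircuit => //.
  exact: proper_sub.
by apply: mn => //; rewrite -card_gt0 ltnW // ltnW.
Qed.

(** Sets of at most two elements are independent by simplicity. A larger set loses at most two
    elements and at least one unit of rank by peeling, and stays non-empty. *)
Lemma min_degenerate_sparse X : X \proper E -> X != set0 -> #|X| < 2 * rank M X.
Proof.
have [n] := ubnP #|X|; elim: n X => // n IH X; rewrite ltnS => Xn pX X0.
have [X2|X2] := leqP #|X| 2.
  have := simple_indep (proper_sub pX) X2; rewrite indepE => /eqP ->.
  by rewrite mul2n -addnn -[X in X < _]addn0 ltn_add2l card_gt0.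
have [C [sC C2 rC]] := peel pX X2.
have cC : #|X :\: C| = #|X| - #|C| by rewrite cardsD (setIidPr sC).
have C0 : 0 < #|C|.
  by rewrite card_gt0; apply: contraTneq rC => ->; rewrite setD0 ltnn.
have lt : #|X :\: C| < n.
  by rewrite cC; move: Xn X2 C0; clear; lia.
have pXC : X :\: C \proper E by apply: sub_proper_trans pX; apply: subsetDl.
have XC0 : X :\: C != set0 by rewrite -card_gt0 cC; move: X2 C2; clear; lia.
have := IH _ lt pXC XC0; rewrite cC; move: X2 C2 C0 rC; clear; lia.
Qed.

Let E3 : 2 < #|E|.
Proof. by case: M_min => _ _ _ g3 _; rewrite -g3 cogirth_leq_ground. Qed.

Lemma min_degenerate_bound : #|E| <= 2 * mrank M.
Proof.
have /card_gt0P[e eE] : 0 < #|E| by exact: ltnW (ltnW E3).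
have cE : #|E :\ e|.+1 = #|E| by rewrite [in RHS](cardsD1 e) eE.
have pE : E :\ e \proper E by rewrite properD1.
have nE : E :\ e != set0 by rewrite -card_gt0; move: E3; rewrite -cE; case: #|_|.
have := min_degenerate_sparse pE nE; rewrite cE => /leq_trans; apply.
by rewrite leq_mul2l rank_mono ?subD1set.
Qed.

Lemma min_degenerate_extremal : #|E| = 2 * mrank M -> extremal M.
Proof.
move=> eE; split=> //.
- by move: E3; rewrite eE; clear; lia.
- exact: min_degenerate_sparse.
move=> X /andP[sX /eqP rX] X1.
have oX : odd #|X| by rewrite -[odd _]negbK -[~~ odd _]/(odd _.+1) rX mul2n odd_double.
have pX : X \proper E.
  rewrite properEneq sX andbT; apply: contraTneq oX => ->.
  by rewrite eE mul2n odd_double.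
have X2 : 2 < #|X| by case: #|X| X1 oX => [|[|[]]].
have [C [sC C2 rC]] := peel pX X2.
have cC : #|X :\: C| = #|X| - #|C| by rewrite cardsD (setIidPr sC).
have pXC : X :\: C \proper E by apply: sub_proper_trans pX; apply: subsetDl.
have XC0 : X :\: C != set0 by rewrite -card_gt0 cC; move: X2 C2; clear; lia.
have sp := min_degenerate_sparse pXC XC0; rewrite cC in sp.
(* Twice the rank of [X :\: C] exceeds [#|X| - #|C|] and is at most [#|X| - 1]. Hence [C] has
   exactly two elements and the rank drops by exactly one. *)
exists C; split=> //; first by move: sp rX rC C2 X2; clear; lia.
rewrite /tight /= (proper_sub pXC) /= cC.
by move: sp rX rC C2 X2; clear; lia.
Qed.

End MinimallyDegenerate.

(** * Peeling in the presence of a 2-separation *)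

Section TightSplits.
Variables (T : finType) (E : {set T}) (tau : pred {set T}).
Hypotheses (tauE : tight_family E tau) (peel : peelable tau).
Implicit Types (A B C D Q X : {set T}).

(** Otherwise [D] lies inside [B], and the join of [E :\: B] with [Q :\: D] is [E :\: D], a tight
    set of even size. *)
Lemma peel_avoids_side B Q D : tau B -> tau (E :\: B) -> B \proper Q -> tau Q ->
    2 < #|B| -> D \subset Q -> #|D| = 2 -> tau (Q :\: D) ->
  [disjoint D & B].
Proof.
move=> tB tA /properP[sBQ [q qQ qB]] tQ B3 sD D2 tD.
have [[sDB tBD]|//] := tight_peel_sub tauE tQ tB sBQ sD D2 tD B3.
have sQ := tight_sub tauE tQ; have sB := tight_sub tauE tB.
have eU : (E :\: B) :|: (Q :\: D) = E :\: D.
  apply/setP=> z; rewrite !inE; have [zD|zD] := boolP (z \in D).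
    by rewrite (subsetP sDB).
  have := subsetP sQ z; have := subsetP sBQ z.
  by case: (z \in B); case: (z \in Q); case: (z \in E) => //= h1 h2;
     rewrite ?(h1 isT) ?(h2 isT).
have sDE : D \subset E by apply: subset_trans sD sQ.
have : tau (E :\: D).
  rewrite -eU; apply: (tight_join tauE) => //.
    apply/set0Pn; exists q; rewrite !inE qB qQ (subsetP sQ) //= andbT.
    by apply: contra qB; apply: subsetP.
  rewrite eU; apply/eqP=> /setP e; have /card_gt0P[d dD] : 0 < #|D| by rewrite D2.
  by have := e d; rewrite !inE dD (subsetP sDE).
move/(tight_odd tauE); rewrite cardsD (setIidPr sDE) D2 oddB ?addbF.
  by rewrite (negPf (ground_even tauE)).
by rewrite -D2 subset_leq_card.
Qed.

(** A minimal tight proper superset [Q] of [B] avoiding [x] is peeled by a pair disjoint from [B],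
    and minimality leaves exactly [B]. With [B] replaced by a basepoint, the pair becomes a triangle
    through it that avoids [x]. *)
Lemma tight_pair_extension B x : tau B -> tau (E :\: B) -> 2 < #|B| ->
    x \in E -> x \notin B -> 1 < #|E :\: B| ->
  exists X, [/\ X \subset E :\: B, #|X| = 2, x \notin X & tau (X :|: B)].
Proof.
move=> tB tA B3 xE xB A1.
pose cand := [pred Q : {set T} | [&& tau Q, B \proper Q & x \notin Q]].
have: cand (E :\ x).
  rewrite /= (tight_setD1 tauE xE) !inE eqxx andbT /=.
  have sB : B \subset E :\ x.
    apply/subsetP=> z zB; rewrite !inE (subsetP (tight_sub tauE tB)) // andbT.
    by apply: contraNneq xB => <-.
  rewrite properEcard sB; have := cardsD1 x E; rewrite xE.
  have := subset_leq_card (tight_sub tauE tB).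
  by move: A1; rewrite cardsD (setIidPr (tight_sub tauE tB)); clear; lia.
case/minset_exists=> Q /minsetP[/and3P[tQ pQ xQ] minQ] _.
have sBQ := proper_sub pQ.
have [|D [sD D2 tD]] := peel tQ.
  by apply: leq_trans (subset_leq_card sBQ); apply: ltnW.
have dDB := peel_avoids_side tB tA pQ tQ B3 sD D2 tD.
have sBQD : B \subset Q :\: D by rewrite subsetD sBQ disjoint_sym.
have eB : B = Q :\: D.
  apply/eqP/negPn/negP=> nB.
  have : Q :\: D = Q.
    apply: minQ (subsetDl _ _); rewrite /= tD properEneq nB sBQD /=.
    by rewrite inE (negPf xQ) andbF.
  move/setP=> e; have /card_gt0P[d dD] : 0 < #|D| by rewrite D2.
  by have := e d; rewrite !inE dD (subsetP sD).
exists D; split=> //.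
- by rewrite subsetD dDB (subset_trans sD (tight_sub tauE tQ)).
- by apply: contra xQ; apply: (subsetP sD).
suff -> : D :|: B = Q by [].
by rewrite [in LHS]eB -[RHS](setID Q D) (setIidPr sD).
Qed.

(** A minimal tight set that contains both sides and avoids [x] is peeled by a pair disjoint from
    both, and so is not minimal. *)
Lemma disjoint_sides_absurd B C x : tau B -> tau (E :\: B) -> 2 < #|B| ->
    tau C -> tau (E :\: C) -> 2 < #|C| -> [disjoint B & C] ->
    x \in E -> x \notin B -> x \notin C -> False.
Proof.
move=> tB tB' B3 tC tC' C3 dBC xE xB xC.
pose cand := [pred Q : {set T} | [&& tau Q, B \subset Q, C \subset Q & x \notin Q]].
have: cand (E :\ x).
  have sub D : tau D -> x \notin D -> D \subset E :\ x.
    by move=> tD xD; rewrite subsetD1 xD (tight_sub tauE tD).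
  by rewrite /= (tight_setD1 tauE xE) !sub // !inE eqxx.
case/minset_exists=> Q /minsetP[/and4P[tQ sBQ sCQ xQ] minQ] _.
have pB D D' : tau D -> D' \subset Q -> D \subset Q -> 2 < #|D'| ->
    [disjoint D & D'] -> D \proper Q.
  move=> tD s' s D'3 dD; rewrite properEneq s andbT; apply: contraTneq D'3 => eD.
  by move: dD; rewrite eD -setI_eq0 (setIidPr s') => /eqP->; rewrite cards0.
have pBQ := pB _ _ tB sCQ sBQ C3 dBC.
have dCB : [disjoint C & B] by rewrite disjoint_sym.
have pCQ := pB _ _ tC sBQ sCQ B3 dCB.
have [|D [sD D2 tD]] := peel tQ.
  by apply: leq_trans (subset_leq_card sBQ); apply: ltnW.
have d1 := peel_avoids_side tB tB' pBQ tQ B3 sD D2 tD.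
have d2 := peel_avoids_side tC tC' pCQ tQ C3 sD D2 tD.
have : Q :\: D = Q.
  apply: minQ (subsetDl _ _); rewrite /= tD !subsetD sBQ sCQ disjoint_sym d1.
  by rewrite disjoint_sym d2 /= inE (negPf xQ) andbF.
move/setP=> e; have /card_gt0P[d dD] : 0 < #|D| by rewrite D2.
by have := e d; rewrite !inE dD (subsetP sD).
Qed.

(* Peeling [X :|: B] for the 2-sum part with the side [B] replaced by a
   basepoint: either the pair lies in [X], or it consists of the basepoint and
   an element of [X]. *)
Lemma peel_side B X : tau B -> [disjoint X & B] -> X != set0 -> tau (X :|: B) ->
  (exists D, [/\ D \subset X, #|D| = 2 & tau ((X :\: D) :|: B)]) \/
  (exists2 x, x \in X & tau (X :\ x)).
Proof.
move=> tB dXB X0 tXB.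
(* A minimal such [S] stands in for the basepoint. If it is a singleton, the peeling pair may use
   it; otherwise minimality keeps the pair out of [S]. When the pair lies in [X], joining with [B]
   restores the full side. *)
pose cand := [pred S : {set T} | [&& tau S, S \subset B & tau (X :|: S)]].
have: cand B by rewrite /= tB subxx tXB.
case/minset_exists=> S /minsetP[/and3P[tS sSB tXS] minS] _.
have dXS : [disjoint X & S] := disjointWr sSB dXB.
have S0 := tight_neq0 tauE tS.
have [|D [sD D2 tD]] := peel tXS.
  have := cardsUI X S; move: dXS; rewrite -setI_eq0 => /eqP->; rewrite cards0.
  by move: X0 S0; rewrite -!card_gt0; clear; lia.
have eD : (X :|: S) :\: D = (X :\: D) :|: (S :\: D) by rewrite setDUl.
have [S1|S1] := leqP #|S| 2.
  have /cards1P[s es] : #|S| == 1.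
    by have := tight_odd tauE tS; move: S1; case: #|S| => [|[|[]]].
  have sS : s \in S by rewrite es inE.
  have [sDs|nDs] := boolP (s \in D).
    right; have /cards1P[x ex] : #|D :\ s| == 1.
      by have := cardsD1 s D; rewrite sDs D2 add1n => -[<-].
    have xD : x \in D :\ s by rewrite ex inE.
    move: xD; rewrite !inE => /andP[xs xD].
    have xX : x \in X.
      by have := subsetP sD _ xD; rewrite es !inE (negPf xs) orbF.
    exists x => //; suff -> : X :\ x = (X :|: S) :\: D by [].
    have -> : D = [set s; x] by rewrite -(setD1K sDs) ex.
    apply/setP=> z; rewrite es !inE negb_or.
    have [->|zs] := eqVneq z s; last by rewrite orbF /=.
    by rewrite /= (disjointFl dXS sS) andbF.
  left; exists D; split=> //.
    apply/subsetP=> z zD; have := subsetP sD _ zD; rewrite es !inE => /orP[//|/eqP ez].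
    by rewrite -ez zD in nDs.
  have eSD : S :\: D = S.
    by apply/setDidPl; rewrite es disjoints1.
  have := tight_join tauE tD tB; rewrite eD eSD -setUA (setUidPr sSB); apply.
    by apply/set0Pn; exists s; rewrite !inE sS (subsetP sSB) // orbT.
  by apply: (subset_tight_neq tauE tXB); rewrite setSU ?subsetDl.
have [[sDS tSD]|dDS] := tight_peel_sub tauE tXS tS (subsetUr _ _) sD D2 tD S1.
  have : S :\: D = S.
    apply: minS (subsetDl _ _); rewrite /= tSD (subset_trans (subsetDl _ _) sSB).
    have eX : X :\: D = X.
      by apply/setDidPl; apply: disjointWr sDS dXS.
    by move: tD; rewrite eD eX.
  move/setP=> e; have /card_gt0P[d dD] : 0 < #|D| by rewrite D2.
  by have := e d; rewrite !inE dD (subsetP sDS).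
left; exists D; split=> //.
  apply/subsetP=> z zD; have := subsetP sD _ zD; rewrite inE => /orP[//|zS].
  by rewrite (disjointFr dDS zD) in zS.
have eSD : S :\: D = S by apply/setDidPl; rewrite disjoint_sym.
have := tight_join tauE tD tB; rewrite eD eSD -setUA (setUidPr sSB); apply.
  have /set0Pn[s sS] := S0.
  by apply/set0Pn; exists s; rewrite !inE sS (subsetP sSB) // orbT.
by apply: (subset_tight_neq tauE tXB); rewrite setSU ?subsetDl.
Qed.

End TightSplits.

(** * The parts of a 2-separation *)

Section OptionSets.
Variable T : finType.
Implicit Types (X : {set T}) (Y : {set option T}).

Definition dn Y : {set T} := Some @^-1: Y.
Definition up X : {set option T} := Some @: X.

Lemma upK X : dn (up X) = X.
Proof. by apply/setP=> x; rewrite inE mem_imset //; apply: Some_inj. Qed.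

Lemma dn_None X : dn (None |: up X) = X.
Proof. by rewrite -[RHS]upK; apply/setP=> x; rewrite !inE. Qed.

Lemma None_up X : None \notin up X.
Proof. by apply/imsetP=> -[]. Qed.

Lemma Some_up X x : (Some x \in up X) = (x \in X).
Proof. by rewrite mem_imset //; apply: Some_inj. Qed.

Lemma card_up X : #|up X| = #|X|.
Proof. by apply: card_imset; apply: Some_inj. Qed.

Lemma up_dn Y : None \notin Y -> Y = up (dn Y).
Proof.
move=> nY; apply/setP=> -[x|]; first by rewrite Some_up inE.
by rewrite (negPf nY) (negPf (None_up _)).
Qed.

Lemma up_dn_None Y : None \in Y -> Y = None |: up (dn Y).
Proof.
move=> nY; apply/setP=> -[x|]; first by rewrite !inE Some_up inE.
by rewrite nY !inE eqxx.
Qed.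

Lemma dn_sub_up Y X : Y \subset None |: up X -> dn Y \subset X.
Proof. by move/subsetP=> s; apply/subsetP=> x; rewrite inE => /s; rewrite !inE Some_up. Qed.

End OptionSets.

Section Side.
Variables (T : finType) (M : matroid T) (A B : {set T}).
Hypotheses (AUB : A :|: B = ground M) (dAB : [disjoint A & B]).
Hypothesis rAB : rank M A + rank M B = (mrank M).+1.
Implicit Types (X : {set T}) (Y : {set option T}).

(* The 2-sum part carried by A; [None] is the basepoint, a virtual point of the
   line common to the spans of A and B. *)
Definition side_rank Y : nat :=
  if None \in Y then (rank M (dn Y :|: B) - rank M B).+1 else rank M (dn Y).

Definition side_ground : {set option T} := None |: up A.

(** The rank deficiency between [A] and [B] is one, and it does not grow when [A] shrinks to a
    subset. *)
Lemma side_rank_leq X : X \subset A -> rank M X + rank M B <= (rank M (X :|: B)).+1.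
Proof.
move=> sX; have := rank_submod M (X :|: B) A.
have -> : X :|: B :|: A = ground M by rewrite -AUB setUC setUA (setUidPl sX).
have -> : (X :|: B) :&: A = X.
  rewrite setIUl (setIidPl sX) setIC.
  by move: dAB; rewrite -setI_eq0 => /eqP->; rewrite setU0.
by move: rAB; rewrite -/(mrank M); clear; lia.
Qed.

Let rB X : rank M B <= rank M (X :|: B).
Proof. exact/rank_mono/subsetUr. Qed.

Lemma side_rank_function : rank_function side_ground side_rank.
Proof.
split=> [Y sY|X Y sY sXY|X Y sX sY]; rewrite /side_rank.
- have [nY|nY] := boolP (None \in Y).
    rewrite {2}(up_dn_None nY) cardsU1 None_up card_up add1n ltnS.
    have := rank_submod M (dn Y) B; have := rank_leq_card M (dn Y); clear; lia.
  by rewrite {2}(up_dn nY) card_up rank_leq_card.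
- have sdn : dn X \subset dn Y by apply: preimsetS.
  have [nX|nX] := boolP (None \in X).
    rewrite (subsetP sXY _ nX) ltnS; apply: leq_sub2r.
    by apply/rank_mono/setSU.
  case: ifP => [nY|_]; last exact: rank_mono.
  have := side_rank_leq (subset_trans sdn (dn_sub_up sY)).
  have := rank_mono M (setSU B sdn); have := rB (dn X); clear; lia.
have dnU : dn (X :|: Y) = dn X :|: dn Y by apply: preimsetU.
have dnI : dn (X :&: Y) = dn X :&: dn Y by apply: preimsetI.
have mixed (X' Y' : {set T}) : Y' \subset A ->
    rank M (X' :|: Y' :|: B) + rank M (X' :&: Y') <= rank M (X' :|: B) + rank M Y'.
  move=> sY'; have := rank_submod M (X' :|: B) Y'.
  have -> : X' :|: B :|: Y' = X' :|: Y' :|: B by rewrite -!setUA [B :|: _]setUC.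
  have -> : (X' :|: B) :&: Y' = X' :&: Y'.
    rewrite setIUl [B :&: _]setIC; suff -> : Y' :&: B = set0 by rewrite setU0.
    by apply/eqP; rewrite setI_eq0; apply: disjointWl dAB.
  by [].
rewrite dnU dnI !inE; have [nX|nX] := boolP (None \in X); have [nY|nY] := boolP (None \in Y) => /=.
- have := rank_submod M (dn X :|: B) (dn Y :|: B).
  rewrite -setUIl -setUUl.
  move: (rB (dn X)) (rB (dn Y)) (rB (dn X :|: dn Y)) (rB (dn X :&: dn Y)).
  clear; lia.
- have := mixed (dn X) (dn Y) (dn_sub_up sY).
  move: (rB (dn X)) (rB (dn X :|: dn Y)); clear; lia.
- have := mixed (dn Y) (dn X) (dn_sub_up sX); rewrite setUC [dn Y :&: _]setIC.
  move: (rB (dn Y)) (rB (dn X :|: dn Y)); rewrite [dn Y :|: dn X]setUC [B :|: _]setUC.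
  clear; lia.
exact: rank_submod.
Qed.

Definition side : matroid (option T) := matroid_of_rank side_rank_function.

Lemma side_rank_up X : X \subset A -> rank side (up X) = rank M X.
Proof.
move=> sX; rewrite rank_matroid_of_rank /side_rank ?(negPf (None_up _)) ?upK //.
by rewrite subsetU // imsetS // orbT.
Qed.

Lemma side_rank_None X : X \subset A ->
  rank side (None |: up X) + rank M B = (rank M (X :|: B)).+1.
Proof.
move=> sX; rewrite rank_matroid_of_rank; last by rewrite setUS ?imsetS.
by rewrite /side_rank !inE eqxx dn_None addSn subnK.
Qed.

Lemma side_cases Y : Y \subset side_ground ->
  exists2 X : {set T}, X \subset A & Y = up X \/ Y = None |: up X.
Proof.
move=> sY; exists (dn Y); first exact: dn_sub_up.
have [nY|nY] := boolP (None \in Y); [right|left]; [exact: up_dn_None | exact: up_dn].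
Qed.

End Side.

Section ExtremalSide.
Variables (T : finType) (M : matroid T) (A B : {set T}).
Hypothesis extM : extremal M.
Hypotheses (AUB : A :|: B = ground M) (dAB : [disjoint A & B]).
Hypotheses (tA : tight M A) (tB : tight M B) (A3 : 2 < #|A|) (B3 : 2 < #|B|).
Implicit Types (X : {set T}) (Y : {set option T}).
Local Notation E := (ground M).

Let tauE := extremal_tight_family extM.

Let cAB : #|A| + #|B| = #|E|.
Proof.
by rewrite -AUB -cardsUI; move: dAB; rewrite -setI_eq0 => /eqP->; rewrite cards0 addn0.
Qed.

Lemma split_rank : rank M A + rank M B = (mrank M).+1.
Proof.
have := ext_card extM; move: tA tB cAB => /andP[_ /eqP] + /andP[_ /eqP].
clear; lia.
Qed.

Local Notation S := (side AUB dAB split_rank).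

Let compl_B : E :\: B = A.
Proof. by rewrite -AUB setDUl setDv setU0; apply/setDidPl. Qed.

Let compl_A : E :\: A = B.
Proof. by rewrite -AUB setDUl setDv set0U; apply/setDidPl; rewrite disjoint_sym. Qed.

Let sAE : A \subset E. Proof. by rewrite -AUB subsetUl. Qed.

Let cXB X : X \subset A -> #|X :|: B| = #|X| + #|B|.
Proof.
move=> sX; rewrite -cardsUI; have := disjointWl sX dAB.
by rewrite -setI_eq0 => /eqP->; rewrite cards0 addn0.
Qed.

Let rB : #|B|.+1 = 2 * rank M B. Proof. by case/andP: tB => _ /eqP. Qed.

Lemma tight_side_up X : X \subset A -> tight S (up X) = tight M X.
Proof.
move=> sX; rewrite /tight /= card_up side_rank_up // (subset_trans sX sAE).
by rewrite subsetU // imsetS // orbT.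
Qed.

Lemma tight_side_None X : X \subset A -> tight S (None |: up X) = tight M (X :|: B).
Proof.
move=> sX; rewrite /tight /= setUS ?imsetS //= -AUB setSU //=.
have := side_rank_None AUB dAB split_rank sX.
rewrite cardsU1 None_up card_up cXB // => e.
by apply/eqP/eqP; move: e rB; clear; lia.
Qed.

(** Tightness in the part is tightness in [M], with [B] in the place of the basepoint. Only peeling
    is not literal: a pair of [M] may touch [B], which [peel_side] repairs. *)
Lemma extremal_side : extremal S.
Proof.
have gS : #|ground S| = #|A|.+1 by rewrite cardsU1 None_up card_up.
have rS : mrank S = rank M A.
  have := side_rank_None AUB dAB split_rank (subxx A); rewrite AUB -/(mrank M) -split_rank.
  by rewrite /mrank /=; move/addIn.
have cN (X : {set T}) : #|None |: up X| = #|X|.+1 by rewrite cardsU1 None_up card_up.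
split.
- by rewrite gS rS; case/andP: tA => _ /eqP.
- by rewrite gS.
- move=> Y pY Y0; have [X sX [eY|eY]] := side_cases (proper_sub pY); subst Y.
    rewrite card_up side_rank_up //; apply: (ext_sparse extM).
      exact: sub_proper_trans sX (tight_proper tauE tA).
    by move: Y0; rewrite -!card_gt0 card_up.
  have := proper_card pY; rewrite cN gS ltnS => ltX.
  have pXB : X :|: B \proper E.
    by rewrite properEcard -AUB setSU // AUB cXB // -cAB ltn_add2r.
  have XB0 : X :|: B != set0 by rewrite -card_gt0 cXB //; move: B3; clear; lia.
  have := ext_sparse extM pXB XB0; have := side_rank_None AUB dAB split_rank sX.
  by rewrite cXB //; move: rB; clear; lia.
move=> Y tY; have sY : Y \subset ground S by case/andP: tY.
have [X sX [eY|eY]] := side_cases sY; subst Y.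
  rewrite tight_side_up // in tY; rewrite card_up => X1.
  have [D [sD D2 tD]] := ext_peel extM tY X1.
  exists (up D); rewrite card_up; split=> //; first exact: imsetS.
  suff -> : up X :\: up D = up (X :\: D).
    by rewrite tight_side_up // (subset_trans (subsetDl _ _)).
  by apply/setP=> -[x|]; rewrite ?inE ?Some_up ?inE // !(negPf (None_up _)) andbF.
rewrite tight_side_None // in tY; rewrite cN ltnS => X0.
have dXB := disjointWl sX dAB.
have {}X0 : X != set0 by rewrite -card_gt0.
have [[D [sD D2 tD]]|[x xX tx]] := peel_side tauE (ext_peel extM) tB dXB X0 tY.
  exists (up D); rewrite card_up; split=> //.
    by apply: subset_trans (subsetUr _ _); apply: imsetS.
  suff -> : (None |: up X) :\: up D = None |: up (X :\: D).
    by rewrite tight_side_None // (subset_trans (subsetDl _ _)).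
  by apply/setP=> -[x|]; rewrite !inE ?Some_up ?inE // !(negPf (None_up _)).
exists [set None; Some x]; rewrite cards2; split=> //.
  by rewrite subUset !sub1set !inE Some_up xX.
suff -> : (None |: up X) :\: [set None; Some x] = up (X :\ x).
  by rewrite tight_side_up // (subset_trans (subsetDl _ _)).
apply/setP=> -[y|]; rewrite !inE ?Some_up ?inE ?(negPf (None_up _)) //=.
Qed.

(** A split of the part gives a side inside [A], disjoint from the side [B]; any element of [A]
    outside it is missed by both, which [disjoint_sides_absurd] forbids. *)
Lemma unsplittable_side : unsplittable (ground S) (tight S).
Proof.
have absurd X : X \subset A -> tight M X -> tight M (A :\: X :|: B) -> 1 < #|X| ->
    A :\: X = set0.
  move=> sX tX tX' X1; apply/eqP/negPn/negP=> /set0Pn[x].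
  rewrite inE => /andP[xX xA].
  have eX : A :\: X :|: B = E :\: X.
    rewrite -AUB setDUl; congr setU; apply/esym/setDidPl.
    by rewrite disjoint_sym; apply: disjointWl sX dAB.
  rewrite eX in tX'; apply: (disjoint_sides_absurd tauE (ext_peel extM) tB _ B3 tX tX').
  - by rewrite compl_B.
  - by have := tight_odd tauE tX; move: X1; case: #|X| => [|[|[]]].
  - by rewrite disjoint_sym; apply: disjointWl sX dAB.
  - exact: (subsetP sAE _ xA).
  - by rewrite (disjointFr dAB xA).
  - exact: xX.
have cN (X : {set T}) : #|None |: up X| = #|X|.+1 by rewrite cardsU1 None_up card_up.
move=> Y tY; have sY : Y \subset ground S by case/andP: tY.
have [X sX [eY|eY]] := side_cases sY; subst Y.
  have -> : ground S :\: up X = None |: up (A :\: X).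
    by apply/setP=> -[x|]; rewrite !inE ?Some_up ?inE // !(negPf (None_up _)).
  rewrite tight_side_up ?tight_side_None ?subsetDl // in tY * => tX'.
  have [X1|X1] := leqP #|X| 1.
    left; rewrite card_up; have := tight_odd tauE tY.
    by move: X1; case: #|X| => [|[]].
  by right; rewrite cN (absurd X) ?cards0.
have -> : ground S :\: (None |: up X) = up (A :\: X).
  by apply/setP=> -[x|]; rewrite !inE ?Some_up ?inE ?(negPf (None_up _)) ?andbF.
rewrite tight_side_up ?tight_side_None ?subsetDl // in tY * => tX'.
have [X1|X1] := leqP #|A :\: X| 1.
  right; rewrite card_up; have := tight_odd tauE tX'.
  by move: X1; case: #|_ :\: X| => [|[]].
have := absurd _ (subsetDl A X) tX'.
by rewrite setDDr setDv set0U (setIidPr sX) => X0; left; rewrite cN X0 ?cards0.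
Qed.

(** Given one triangle through the basepoint, a second one is obtained by avoiding an element of the
    first. *)
Lemma basepoint_triangles : 1 < #|[set C in triangles S | None \in C]|.
Proof.
have tri x : x \in A -> exists2 C, C \in [set C in triangles S | None \in C] & Some x \notin C.
  move=> xA; have xB : x \notin B by rewrite (disjointFr dAB xA).
  have tB' : tight M (E :\: B) by rewrite compl_B.
  have A1 : 1 < #|E :\: B| by rewrite compl_B; apply: ltnW.
  have [X [sX X2 xX tX]] := tight_pair_extension tauE (ext_peel extM) tB tB' B3
     (subsetP sAE _ xA) xB A1.
  rewrite compl_B in sX.
  exists (None |: up X); last by rewrite !inE Some_up.
  have c3 : #|None |: up X| = 3 by rewrite cardsU1 None_up card_up X2.
  rewrite in_set; apply/andP; split; last by rewrite setU11.
  rewrite in_set c3 eqxx andbT; apply: (tight3_circuit extremal_side) => //.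
  by rewrite tight_side_None.
have /card_gt0P[a aA] : 0 < #|A| by apply: ltnW (ltnW A3).
have [C CS aC] := tri a aA.
have [x xC xN] : exists2 x, x \in C & x != None.
  have := CS; rewrite in_set => /andP[]; rewrite in_set => /andP[_ /eqP C3] NC.
  have := cardsD1 None C; rewrite C3 NC add1n => -[e].
  have /card_gt0P[x] : 0 < #|C :\ None| by rewrite -e.
  by rewrite !inE => /andP[xN xC]; exists x.
case: x xC xN => // x xC _.
have xA : x \in A.
  have := CS; rewrite in_set => /andP[]; rewrite in_set => /andP[/circuitP[sC _ _] _] _.
  by have := subsetP sC _ xC; rewrite !inE Some_up.
have [C' C'S xC'] := tri x xA.
rewrite (cardsD1 C) CS ltnS card_gt0; apply/set0Pn; exists C'.
rewrite in_setD1 C'S andbT; apply: contraNneq xC' => ->; exact: xC.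
Qed.

End ExtremalSide.

(** * The 2-sum decomposition *)

Lemma eq_circuits (T : finType) (M1 M2 : matroid T) (C : {set T}) :
    C \subset ground M1 -> C \subset ground M2 ->
    (forall J : {set T}, J \subset C -> (J \in indep M1) = (J \in indep M2)) ->
  C \in circuits M1 -> C \in circuits M2.
Proof.
move=> s1 s2 e /circuitP[_ dC iC]; apply/circuitP; split=> //.
  by rewrite -e.
by move=> x xC; rewrite -e ?subD1set ?iC.
Qed.

Section LiftToOption.
Variables (T : finType) (M : matroid T).
Implicit Types (X : {set T}) (Y : {set option T}).

Lemma lift_rank_function : rank_function (up (ground M)) (fun Y => rank M (dn Y)).
Proof.
split=> [Y sY|X Y sY sXY|X Y sX sY].
- rewrite {2}(@up_dn _ Y) ?card_up ?rank_leq_card //.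
  by apply/negP=> /(subsetP sY); rewrite (negPf (None_up _)).
- by apply: rank_mono; apply: preimsetS.
have -> : dn (X :|: Y) = dn X :|: dn Y by apply: preimsetU.
have -> : dn (X :&: Y) = dn X :&: dn Y by apply: preimsetI.
exact: rank_submod.
Qed.

(** A copy of [M] over [option T], because a 2-sum and its parts must share one ambient type. *)
Definition lift_option : matroid (option T) := matroid_of_rank lift_rank_function.

Lemma lift_option_indep X : X \subset ground M ->
  (up X \in indep lift_option) = (X \in indep M).
Proof. by move=> sX; rewrite !indepE rank_matroid_of_rank ?imsetS // upK card_up. Qed.

Lemma lift_option_isomorphic : isomorphic M lift_option.
Proof.
exists Some; split=> //; first by move=> x y _ _ [].
by move=> I sI; rewrite lift_option_indep.
Qed.

End LiftToOption.

Section SideIndependence.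
Variables (T : finType) (M : matroid T) (A B : {set T}).
Hypotheses (AUB : A :|: B = ground M) (dAB : [disjoint A & B]).
Hypothesis rAB : rank M A + rank M B = (mrank M).+1.
Implicit Types (X Y Z : {set T}) (C : {set option T}).

Local Notation E := (ground M).
Local Notation SA := (side AUB dAB rAB).
Local Notation N := (lift_option M).

Lemma side_indep_up X : X \subset A -> (up X \in indep SA) = (X \in indep M).
Proof. by move=> sX; rewrite !indepE side_rank_up // card_up. Qed.

Lemma side_indep_None X : X \subset A ->
  (None |: up X \in indep SA) = (X \in indep M) && (rank M (X :|: B) == rank M X + rank M B).
Proof.
move=> sX; rewrite !indepE cardsU1 None_up card_up.
have := side_rank_None AUB dAB rAB sX; move: (rank SA _) => s es.
have := rank_submod M X B; have := rank_leq_card M X.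
move: es; clear; move: (rank M (X :&: B)); lia.
Qed.

Lemma disjoint_cardU X Y : X \subset A -> Y \subset B -> #|X :|: Y| = #|X| + #|Y|.
Proof.
move=> sX sY; rewrite -cardsUI; have := disjointWl sX (disjointWr sY dAB).
by rewrite -setI_eq0 => /eqP->; rewrite cards0 addn0.
Qed.

(** Independence together with the basepoint means that [X] is skew to all of [B], hence to [Y]. *)
Lemma union_indep X Y : X \subset A -> Y \subset B ->
    X \in indep M -> Y \in indep M -> None |: up X \in indep SA ->
  X :|: Y \in indep M.
Proof.
move=> sX sY iX iY; rewrite side_indep_None // iX => /eqP rXB.
have := rank_submod M (X :|: Y) B.
have -> : X :|: Y :|: B = X :|: B by rewrite -setUA (setUidPr sY).
have -> : (X :|: Y) :&: B = Y.
  rewrite setIUl (setIidPl sY); have := disjointWl sX dAB.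
  by rewrite -setI_eq0 => /eqP->; rewrite set0U.
move: iX iY; rewrite !indepE disjoint_cardU // => /eqP rX /eqP rY.
have := rank_leq_card M (X :|: Y); rewrite disjoint_cardU // rXB rX rY.
by move: (rank M (X :|: Y)); clear; lia.
Qed.

Lemma side_circuit_up X : X \subset A -> (up X \in circuits SA) = (up X \in circuits N).
Proof.
move=> sX; have sXA : up X \subset ground SA by rewrite subsetU // imsetS ?orbT.
have sXE : up X \subset ground N by rewrite imsetS // -AUB subsetU ?sX.
have e (J : {set option T}) : J \subset up X -> (J \in indep SA) = (J \in indep N).
  move=> sJ; have nJ : None \notin J by apply/negP=> /(subsetP sJ); rewrite (negPf (None_up _)).
  have sdJ : dn J \subset X by rewrite -(upK X) preimsetS.
  rewrite (up_dn nJ) side_indep_up ?lift_option_indep //.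
    by apply: subset_trans sdJ (subset_trans sX _); rewrite -AUB subsetUl.
  exact: subset_trans sdJ sX.
by apply/idP/idP; apply: eq_circuits => // J /e.
Qed.

Lemma side_mrank : mrank SA = rank M A.
Proof.
have := side_rank_None AUB dAB rAB (subxx A); rewrite AUB -/(mrank M) -rAB.
by move/addIn.
Qed.

Lemma basepoint_not_loop : ~ loop SA None.
Proof.
case/circuitP=> _ /negP d _; case: d.
have := side_indep_None (sub0set A); rewrite indep_set0 set0U.
have -> : rank M set0 = 0 by apply/eqP; rewrite -leqn0 -(cards0 T) rank_leq_card.
by rewrite eqxx /up imset0 setU0.
Qed.

Lemma basepoint_not_coloop : ~ coloop SA None.
Proof.
case=> _ bN; have [I [iI sI cI]] := rank_witness SA (up A).
have := bN I; have -> : I \in bases SA.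
  by apply/basesP; rewrite cI side_rank_up // side_mrank.
by move=> /(_ isT)/(subsetP sI); rewrite (negPf (None_up _)).
Qed.

End SideIndependence.

Section MixedCircuits.
Variables (T : finType) (M : matroid T) (A B : {set T}).
Hypotheses (AUB : A :|: B = ground M) (dAB : [disjoint A & B]).
Hypothesis rAB : rank M A + rank M B = (mrank M).+1.
Hypotheses (BUA : B :|: A = ground M) (dBA : [disjoint B & A]).
Hypothesis rBA : rank M B + rank M A = (mrank M).+1.
Implicit Types (X Y Z : {set T}) (C : {set option T}).

Local Notation E := (ground M).
Local Notation SA := (side AUB dAB rAB).
Local Notation SB := (side BUA dBA rBA).
Local Notation N := (lift_option M).

(** If the union were independent, [X :|: B] and [Y :|: A] would each fall one short of the sum of
    their ranks. These sets cover the ground set and meet in [X :|: Y], so submodularity leaves that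
    meet a rank below its size. *)
Lemma union_dep X Y : X \subset A -> Y \subset B ->
    None |: up X \notin indep SA -> None |: up Y \notin indep SB ->
  X :|: Y \notin indep M.
Proof.
move=> sX sY dX dY; apply/negP=> iXY.
have iX : X \in indep M by apply: indep_subset iXY (subsetUl _ _).
have iY : Y \in indep M by apply: indep_subset iXY (subsetUr _ _).
rewrite side_indep_None // iX in dX; rewrite side_indep_None // iY in dY.
have lX := side_rank_leq AUB dAB rAB sX; have lY := side_rank_leq BUA dBA rBA sY.
have := rank_submod M (X :|: B) (Y :|: A).
have -> : X :|: B :|: (Y :|: A) = E.
  rewrite -AUB; apply/setP=> z; rewrite !inE.
  have := subsetP sX z; have := subsetP sY z.
  case: (z \in X); case: (z \in Y); case: (z \in A); case: (z \in B) => //= h1 h2;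
    by rewrite ?(h1 isT) ?(h2 isT).
have -> : (X :|: B) :&: (Y :|: A) = X :|: Y.
  apply/setP=> z; rewrite !inE; have := subsetP sX z; have := subsetP sY z.
  have := disjointFr dAB (x := z).
  case: (z \in X); case: (z \in Y); case: (z \in A); case: (z \in B) => //= h0 h1 h2;
    rewrite ?(h1 isT) ?(h2 isT) //; by [have := h0 isT | have := h1 isT | have := h2 isT].
move: iX iY iXY dX dY lX lY; rewrite !indepE (disjoint_cardU dAB) //.
move=> /eqP -> /eqP -> /eqP -> /= /eqP d1 /eqP d2 l1 l2; rewrite -/(mrank M).
have := rank_submod M X B; have := rank_submod M Y A.
have := rank_leq_card M X; have := rank_leq_card M Y.
move: rAB d1 d2 l1 l2; clear; lia.
Qed.

(** Both halves are independent, so by [union_indep] each is dependent together with the basepoint.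
    Were this still so after removing an element of [X], [union_dep] would make a proper subset of
    the circuit dependent. *)
Lemma mixed_circuit_side X Y : X \subset A -> Y \subset B -> X != set0 -> Y != set0 ->
  X :|: Y \in circuits M -> None |: up X \in circuits SA.
Proof.
move=> sX sY /set0Pn[x0 x0X] /set0Pn[y0 y0Y] /circuitP[sE dXY iXY].
have dis := disjointWl sX (disjointWr sY dAB).
have iX : X \in indep M.
  apply: indep_subset (iXY y0 _) _; first by rewrite inE y0Y orbT.
  apply/subsetP=> z zX; rewrite !inE zX andbT; apply/eqP=> ez.
  by rewrite -ez (disjointFr dis zX) in y0Y.
have iY : Y \in indep M.
  apply: indep_subset (iXY x0 _) _; first by rewrite inE x0X.
  apply/subsetP=> z zY; rewrite !inE zY orbT andbT; apply/eqP=> ez.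
  by rewrite -ez (disjointFl dis zY) in x0X.
have dY : None |: up Y \notin indep SB.
  by apply: contra dXY => i; rewrite setUC; apply: (union_indep sY sX iY iX i).
apply/circuitP; split.
- by rewrite setUS ?imsetS.
- by apply: contra dXY; apply: union_indep sX sY iX iY.
move=> [x|] xC; last by rewrite setU1K ?None_up // side_indep_up.
rewrite !inE Some_up /= in xC; apply/negPn/negP=> dX'.
have e : (None |: up X) :\ Some x = None |: up (X :\ x).
  by apply/setP=> -[z|]; rewrite !inE ?Some_up ?inE.
rewrite e in dX'; have := union_dep (subset_trans (subD1set X x) sX) sY dX' dY.
have -> : X :\ x :|: Y = (X :|: Y) :\ x.
  rewrite setDUl; congr setU; apply/esym/setDidPl.
  by rewrite disjoint_sym disjoints1 (disjointFr dis xC).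
by rewrite iXY // inE xC.
Qed.

Lemma side_circuits_sum X Y : X \subset A -> Y \subset B ->
    None |: up X \in circuits SA -> None |: up Y \in circuits SB ->
  X :|: Y \in circuits M.
Proof.
move=> sX sY /circuitP[_ dX iX] /circuitP[_ dY iY].
have iX0 : X \in indep M.
  by have := iX None (setU11 _ _); rewrite setU1K ?None_up // side_indep_up.
have iY0 : Y \in indep M.
  by have := iY None (setU11 _ _); rewrite setU1K ?None_up // side_indep_up.
have dis := disjointWl sX (disjointWr sY dAB).
apply/circuitP; split.
- by rewrite -AUB setUSS.
- exact: union_dep dX dY.
move=> z; rewrite inE => /orP[zX|zY].
  have -> : (X :|: Y) :\ z = X :\ z :|: Y.
    rewrite setDUl; congr setU; apply/setDidPl.
    by rewrite disjoint_sym disjoints1 (disjointFr dis zX).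
  apply: (union_indep (subset_trans (subD1set X z) sX) sY) => //.
    exact: indep_subset iX0 (subD1set _ _).
  have := iX (Some z); rewrite in_setU1 Some_up zX orbT => /(_ isT).
  rewrite (_ : _ :\ Some z = None |: up (X :\ z)) //.
  by apply/setP=> -[w|]; rewrite !inE ?Some_up ?inE.
have -> : (X :|: Y) :\ z = Y :\ z :|: X.
  rewrite setDUl setUC; congr setU; apply/setDidPl.
  by rewrite disjoint_sym disjoints1 (disjointFl dis zY).
apply: (union_indep (subset_trans (subD1set Y z) sY) sX) => //.
  exact: indep_subset iY0 (subD1set _ _).
have := iY (Some z); rewrite in_setU1 Some_up zY orbT => /(_ isT).
rewrite (_ : _ :\ Some z = None |: up (Y :\ z)) //.
by apply/setP=> -[w|]; rewrite !inE ?Some_up ?inE.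
Qed.

End MixedCircuits.

Section TwoSumOfSides.
Variables (T : finType) (M : matroid T) (A B : {set T}).
Hypotheses (AUB : A :|: B = ground M) (dAB : [disjoint A & B]).
Hypothesis rAB : rank M A + rank M B = (mrank M).+1.
Hypotheses (BUA : B :|: A = ground M) (dBA : [disjoint B & A]).
Hypothesis rBA : rank M B + rank M A = (mrank M).+1.
Hypotheses (A2 : 1 < #|A|) (B2 : 1 < #|B|).
Implicit Types (X Y Z : {set T}) (C : {set option T}).

Local Notation E := (ground M).
Local Notation SA := (side AUB dAB rAB).
Local Notation SB := (side BUA dBA rBA).
Local Notation N := (lift_option M).

Lemma lift_circuit X : (up X \in circuits N) = (X \in circuits M).
Proof.
have sE Z : up Z \subset up E -> Z \subset E.
  by move/(preimsetS Some); rewrite -/(dn _) -/(dn _) !upK.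
have upD x Z : up Z :\ Some x = up (Z :\ x).
  by apply/setP=> -[w|]; rewrite !inE ?Some_up ?inE // !(negPf (None_up _)) ?andbF.
apply/circuitP/circuitP=> -[s d i]; have {}s := s; split.
- exact: sE.
- by rewrite -lift_option_indep ?sE.
- move=> x xX; rewrite -lift_option_indep -?upD ?i ?Some_up //.
  exact: subset_trans (subD1set _ _) (sE _ s).
- exact: imsetS.
- by rewrite lift_option_indep.
move=> [x|]; last by rewrite (negPf (None_up _)).
rewrite Some_up upD => xX; rewrite lift_option_indep ?i //.
exact: subset_trans (subD1set _ _) s.
Qed.

Lemma side_None_circuit (A' : {set T}) (S : matroid (option T)) C :
    C \in circuits S -> None \in C -> ground S = None |: up A' ->
  exists2 X : {set T}, X \subset A' & C = None |: up X.
Proof.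
move=> /circuitP[sC _ _] NC gS; exists (dn C); last exact: up_dn_None.
by apply: dn_sub_up; rewrite -gS.
Qed.

Lemma is_two_sum_sides : is_two_sum SA SB None N.
Proof.
have cN (X : {set T}) : #|None |: up X| = #|X|.+1 by rewrite cardsU1 None_up card_up.
split.
- apply/setP=> -[x|]; rewrite !inE ?Some_up //=.
  by apply/negP=> /andP[xA]; rewrite (disjointFr dAB xA).
- by rewrite !cN.
- split; [exact: basepoint_not_loop | exact: basepoint_not_coloop
         | exact: basepoint_not_loop | exact: basepoint_not_coloop].
- by apply/setP=> -[x|]; rewrite !inE ?Some_up ?(negPf (None_up _)) // -AUB !inE.
apply/setP=> C; apply/idP/idP.
  move=> cC; have nC : None \notin C.
    case/circuitP: cC => sC _ _; apply/negP=> /(subsetP sC).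
    by rewrite (negPf (None_up _)).
  rewrite (up_dn nC) in cC *; set Z := dn C in cC *.
  rewrite lift_circuit in cC.
  have sZ : Z \subset E by case/circuitP: cC.
  have eZ : Z = (Z :&: A) :|: (Z :&: B) by rewrite -setIUr AUB (setIidPl sZ).
  rewrite in_setU in_setU.
  have [X0|X0] := eqVneq (Z :&: A) set0.
    apply/orP; left; apply/orP; right; rewrite in_set None_up andbT.
    have sZB : Z \subset B by rewrite eZ X0 set0U subsetIr.
    by rewrite (side_circuit_up BUA dBA rBA sZB) lift_circuit.
  have [Y0|Y0] := eqVneq (Z :&: B) set0.
    apply/orP; left; apply/orP; left; rewrite in_set None_up andbT.
    have sZA : Z \subset A by rewrite eZ Y0 setU0 subsetIr.
    by rewrite (side_circuit_up AUB dAB rAB sZA) lift_circuit.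
  apply/orP; right; apply/imset2P.
  exists (None |: up (Z :&: A)) (None |: up (Z :&: B)).
  - rewrite in_set setU11 andbT.
    by apply: (mixed_circuit_side AUB dAB rAB BUA dBA rBA _ _ X0 Y0); rewrite ?subsetIr -?eZ.
  - rewrite in_set setU11 andbT.
    by apply: (mixed_circuit_side BUA dBA rBA AUB dAB rAB _ _ Y0 X0);
      rewrite ?subsetIr // setUC -?eZ.
  apply/setP=> -[x|]; rewrite !inE ?Some_up ?(negPf (None_up _)) //.
  by rewrite {1}eZ !inE.
rewrite in_setU in_setU => /orP[/orP[|]|].
- rewrite in_set => /andP[cC nC]; rewrite (up_dn nC) in cC *.
  have sC : dn C \subset A.
    by case/circuitP: cC => sC _ _; rewrite -[dn C]upK; apply: dn_sub_up.
  by rewrite -(side_circuit_up AUB dAB rAB sC).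
- rewrite in_set => /andP[cC nC]; rewrite (up_dn nC) in cC *.
  have sC : dn C \subset B.
    by case/circuitP: cC => sC _ _; rewrite -[dn C]upK; apply: dn_sub_up.
  by rewrite -(side_circuit_up BUA dBA rBA sC).
case/imset2P=> C1 C2; rewrite in_set => /andP[c1 n1].
rewrite in_set => /andP[c2 n2] ->.
have [X sX e1] := side_None_circuit c1 n1 erefl.
have [Y sY e2] := side_None_circuit c2 n2 erefl.
rewrite e1 in c1 *; rewrite e2 in c2 *.
have -> : (None |: up X :|: (None |: up Y)) :\ None = up (X :|: Y).
  by apply/setP=> -[x|]; rewrite !inE ?Some_up ?inE ?(negPf (None_up _)).
rewrite lift_circuit; exact: side_circuits_sum c1 c2.
Qed.

End TwoSumOfSides.

(** * Extremality of wheels, whirls and their 2-sums *)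

Section Isomorphisms.
Variables (T U : finType) (M : matroid T) (N : matroid U) (f : T -> U).
Hypothesis iso_f : isomorphism M N f.
Implicit Types (I C : {set T}).

Lemma isomorphism_card I : I \subset ground M -> #|f @: I| = #|I|.
Proof.
case: iso_f => inj_f _ _ sI; apply: card_in_imset => x y xI yI.
by apply: inj_f; apply: (subsetP sI).
Qed.

Lemma isomorphism_ground : #|ground M| = #|ground N|.
Proof. by case: (iso_f) => _ <- _; rewrite isomorphism_card. Qed.

Lemma isomorphism_preim (J : {set U}) : J \subset ground N ->
  exists2 I : {set T}, I \subset ground M & J = f @: I.
Proof.
case: iso_f => _ eG _ sJ; exists (ground M :&: f @^-1: J); first exact: subsetIl.
apply/setP=> y; apply/idP/imsetP=> [yJ|[x]].
  have := subsetP sJ _ yJ; rewrite -eG => /imsetP[x xG ey].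
  by exists x; rewrite // !inE xG -ey.
by rewrite !inE => /andP[_ fxJ] ->.
Qed.

Lemma isomorphism_mrank : mrank M = mrank N.
Proof.
case: (iso_f) => _ _ ind; apply/eqP; rewrite /mrank eqn_leq; apply/andP; split.
  have [I [iI sI <-]] := rank_witness M (ground M).
  by rewrite -isomorphism_card //; apply: leq_rank; [|apply: indep_ground]; rewrite -ind.
have [J [iJ sJ <-]] := rank_witness N (ground N).
have [I sI eJ] := isomorphism_preim sJ; rewrite eJ in iJ *.
by rewrite isomorphism_card //; apply: leq_rank; rewrite // ind.
Qed.

Lemma isomorphism_circuit C : C \in circuits M -> f @: C \in circuits N.
Proof.
case: (iso_f) => inj_f eG ind /circuitP[sC dC iC]; apply/circuitP; split.
- by rewrite -eG imsetS.
- by rewrite -ind.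
move=> _ /imsetP[x xC ->]; have := iC x xC.
rewrite ind; last exact: subset_trans (subD1set _ _) sC.
move=> i; apply: indep_subset i _; apply/subsetP=> y; rewrite !inE => /andP[ny /imsetP[z zC ey]].
by rewrite ey imset_f // !inE zC andbT; apply: contraNneq ny => <-; rewrite ey.
Qed.

End Isomorphisms.

Section TypesCard.
Variables (T : finType).
Implicit Type (M : matroid T).

Lemma card_wheel_ground k (N : matroid (wheel_edge k)) :
  ground N = setT -> #|ground N| = 2 * k.
Proof. by move=> ->; rewrite cardsT card_sum card_ord addnn mul2n. Qed.

Lemma wheel_type_card M : wheel_type M -> #|ground M| = 2 * mrank M.
Proof.
case=> k [N [k3 wN [f iso]]]; rewrite (isomorphism_ground iso) (isomorphism_mrank iso).
have [gN _] := wN.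
by rewrite (wheel_rank (ltnW k3) wN) card_wheel_ground.
Qed.

(** Relaxation only adds a basis, so any basis of the wheel shows that the rank is unchanged. *)
Lemma whirl_type_card M : whirl_type M -> #|ground M| = 2 * mrank M.
Proof.
case=> k [N [k2 [W wW [_ _ gN bN]] [f iso]]].
rewrite (isomorphism_ground iso) (isomorphism_mrank iso).
have [gW _] := wW; rewrite card_wheel_ground ?gN //; congr (_ * _).
apply: etrans (esym (wheel_rank k2 wW)) _; have [B bB _] := indep_basis (indep_set0 W).
have : B \in bases N by rewrite bN in_setU1 bB orbT.
by case/basesP=> _ <-; case/basesP: bB => _ ->.
Qed.

Lemma wheel_spoke_type_card M p : wheel_type_with_spoke M p -> #|ground M| = 2 * mrank M.
Proof.
by case=> k [N [f [k3 wN iso _ _]]]; apply: wheel_type_card; exists k, N; split=> //; exists f.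
Qed.

Lemma whirl_spoke_type_card M p : whirl_type_with_spoke M p -> #|ground M| = 2 * mrank M.
Proof. by case=> /whirl_type_card. Qed.

End TypesCard.

Section TwoSumCard.
Variables (U : finType) (M1 M2 N : matroid U) (p : U).
Hypothesis sum : is_two_sum M1 M2 p N.
Implicit Types (B C X : {set U}).

Lemma circuit_dep (M : matroid U) C X : C \in circuits M -> C \subset X -> X \notin indep M.
Proof. by move=> /circuitP[_ dC _] sC; apply: contra dC => iX; apply: indep_subset iX sC. Qed.

Lemma basis_add_circuit (M : matroid U) B e : B \in bases M -> e \in ground M -> e \notin B ->
  exists2 C, C \in circuits M & C \subset e |: B.
Proof.
move=> /basesP[iB cB] eG eB; apply: dep_circuit.
  by rewrite subUset sub1set eG indep_ground.
apply/negP=> i; have := leq_rank i (indep_ground i).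
by rewrite -/(mrank M) -cB cardsU1 eB add1n ltnn.
Qed.

Lemma two_sum_card :
  #|ground N| + 2 = #|ground M1| + #|ground M2| /\
  (mrank N).+1 = mrank M1 + mrank M2.
Proof.
case: sum => gI _ [nl1 _ _ nc2] gN cN.
have /setIP[p1 p2] : p \in ground M1 :&: ground M2 by rewrite gI inE.
have G12 x : x \in ground M1 -> x \in ground M2 -> x = p.
  by move=> x1 x2; apply/set1P; rewrite -gI inE x1.
split.
  rewrite gN -cardsUI gI cards1 (cardsD1 p (ground M1 :|: _)) inE p1 add1n.
  by rewrite addn1 addn2.
have ip : [set p] \in indep M1.
  apply/negPn/negP=> d; have [|C cC] := dep_circuit _ d; first by rewrite sub1set.
  rewrite subset1 => /orP[/eqP eC|/eqP eC].
    by apply: nl1; rewrite /loop -eC.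
  by case/circuitP: cC; rewrite eC indep_set0.
have [B1 bB1] := indep_basis ip; rewrite sub1set => pB1.
(* As [p] is neither a loop of [M1] nor a coloop of [M2], one basis can contain it and the other
   avoid it; their union without [p] is shown to be a basis of the 2-sum. *)
have [B2 bB2 pB2] : exists2 B2, B2 \in bases M2 & p \notin B2.
  have [/existsP[B2 /andP[bB2 pB2]]|no] := boolP [exists B, (B \in bases M2) && (p \notin B)].
    by exists B2.
  case: nc2; split=> // B bB; apply/negPn/negP=> pB.
  by case/existsP: no; exists B; rewrite bB.
have /basesP[iB1 cB1] := bB1; have /basesP[iB2 cB2] := bB2.
have s1 := indep_ground iB1; have s2 := indep_ground iB2.
pose B := (B1 :|: B2) :\ p.
have inN C : C \in circuits N ->
    [\/ C \in circuits M1 /\ p \notin C, C \in circuits M2 /\ p \notin C |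
      exists C1 C2, [/\ C1 \in circuits M1, C2 \in circuits M2, p \in C1, p \in C2 &
                        C = (C1 :|: C2) :\ p]].
  rewrite cN in_setU in_setU => /orP[/orP[]|].
  - by rewrite in_set => /andP[c n]; apply: Or31.
  - by rewrite in_set => /andP[c n]; apply: Or32.
  case/imset2P=> C1 C2; rewrite in_set => /andP[c1 n1].
  by rewrite in_set => /andP[c2 n2] eC; apply: Or33; exists C1, C2.
have in1 C : C \in circuits M1 -> p \notin C -> C \in circuits N.
  by move=> c n; rewrite cN in_setU in_setU in_set c n.
have in2 C : C \in circuits M2 -> p \notin C -> C \in circuits N.
  by move=> c n; rewrite cN in_setU in_setU [C \in [set _ in circuits M2 | _]]in_set c n orbT.
have in3 C1 C2 : C1 \in circuits M1 -> C2 \in circuits M2 -> p \in C1 -> p \in C2 ->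
    (C1 :|: C2) :\ p \in circuits N.
  move=> c1 c2 n1 n2; rewrite cN in_setU; apply/orP; right; apply/imset2P.
  by exists C1 C2 => //; rewrite in_set ?c1 ?c2 ?n1 ?n2.
have sub1 X : X \subset ground M1 -> p \notin X -> X \subset B -> X \subset B1.
  move=> sX pX sXB; apply/subsetP=> z zX; have := subsetP sXB _ zX.
  rewrite !inE => /andP[zp /orP[//|zB2]].
  by rewrite (G12 z (subsetP sX _ zX) (subsetP s2 _ zB2)) eqxx in zp.
have iB : B \in indep N.
  apply/negPn/negP=> d; have [|C cC sC] := dep_circuit _ d.
    by rewrite gN setSD // setUSS.
  case: (inN C cC) => [[c n]|[c n]|[C1 [C2 [c1 c2 n1 n2 eC]]]].
  - have /circuitP[sCG _ _] := c.
    by have := circuit_dep c (sub1 C sCG n sC); rewrite iB1.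
  - have /circuitP[sCG _ _] := c; have := circuit_dep c (X := B2); rewrite iB2.
    case/(_ _)/negP=> //; apply/subsetP=> z zC; have := subsetP sC _ zC.
    rewrite !inE => /andP[zp /orP[zB1|//]].
    by rewrite (G12 z (subsetP s1 _ zB1) (subsetP sCG _ zC)) eqxx in zp.
  have /circuitP[sC1 _ _] := c1; have := circuit_dep c1 (X := B1); rewrite iB1.
  case/(_ _)/negP=> //; rewrite -(setD1K n1) subUset sub1set pB1 /=.
  apply: sub1; first exact: subset_trans (subD1set _ _) sC1.
    by rewrite !inE eqxx.
  by apply: subset_trans sC; rewrite eC setSD // subsetUl.
have <- : #|B| = mrank N.
  apply: max_indep_card => // e; rewrite gN !inE => /andP[ep eG]; rewrite ep /=.
  rewrite negb_or => /andP[eB1 eB2].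
  have sB1 : e |: B1 \subset p |: (e |: B).
    apply/subsetP=> z; rewrite !inE; case: (z == e); case: (z == p); case: (z \in B1) => //=.
  have sB2 : e |: B2 \subset e |: B.
    apply: setUS; apply/subsetP=> z zB2; rewrite !inE zB2 orbT andbT.
    by apply: contraNneq pB2 => <-.
  have subp C X : C \subset p |: X -> C :\ p \subset X.
    by rewrite subDset.
  case/orP: eG => eG.
    have [C1 c1 sC1] := basis_add_circuit bB1 eG eB1.
    have sC1' := subp _ _ (subset_trans sC1 sB1).
    have [n1|n1] := boolP (p \in C1); last first.
      apply: (circuit_dep (in1 _ c1 n1)); apply: subset_trans sC1'.
      by rewrite subsetD1 subxx.
    (* A circuit of [M1] through [p] is completed by the circuit that [p] closes with [B2]. *)
    have [C2 c2 sC2] := basis_add_circuit bB2 p2 pB2.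
    have n2 : p \in C2.
      apply/negPn/negP=> n2; have := circuit_dep c2 (X := B2); rewrite iB2.
      case/(_ _)/negP=> //; apply/subsetP=> z zC2; have := subsetP sC2 _ zC2.
      by rewrite !inE => /orP[/eqP ez|//]; rewrite -ez zC2 in n2.
    apply: (circuit_dep (in3 _ _ c1 c2 n1 n2)); rewrite setDUl subUset sC1' /=.
    by apply: subset_trans (subp _ _ sC2) _; apply: subset_trans (subsetUr _ _) sB2.
  have [C2 c2 sC2] := basis_add_circuit bB2 eG eB2.
  have n2 : p \notin C2.
    by apply/negP=> /(subsetP sC2); rewrite !inE (negPf pB2) orbF eq_sym (negPf ep).
  exact: circuit_dep (in2 _ c2 n2) (subset_trans sC2 sB2).
rewrite -cB1 -cB2 -cardsUI.
have -> : B1 :&: B2 = set0.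
  apply/setP=> z; rewrite !inE; apply/negP=> /andP[z1 z2].
  by have := G12 z (subsetP s1 _ z1) (subsetP s2 _ z2) => ez; rewrite -ez z2 in pB2.
by rewrite cards0 addn0 (cardsD1 p (B1 :|: B2)) inE pB1.
Qed.

End TwoSumCard.

(** * The basepoint as a spoke, and the equality case *)

Section Spokes.
Variables (T : finType) (M : matroid T) (p : T).
Hypotheses (extM : extremal M) (conn : unsplittable (ground M) (tight M)).
Hypothesis p_tri : 1 < #|[set C in triangles M | p \in C]|.

(** A rim element of a wheel with more than three spokes lies in only one triangle, and with three
    spokes every edge counts as a spoke. For whirls the two triangles are the definition of a
    spoke. *)
Lemma basepoint_spoke : p \in ground M ->
  wheel_type_with_spoke M p \/ whirl_type_with_spoke M p.
Proof.
move=> pG; have [[k [N [f [k3 wN iso]]]]|w] := unsplittable_wheel_or_whirl extM conn; last by right.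
left; exists k, N, f; split=> //; case e: (f p) => [i|i]; last by right; exists i.
have [k4|k4] := ltnP 3 k; last by left; apply/eqP; rewrite eqn_leq k4.
have tri C : C \in [set C in triangles M | p \in C] ->
    C \subset ground M /\ f @: C = [set inr i; inl i; inr (ordS i)].
  rewrite in_set => /andP[]; rewrite in_set => /andP[cC /eqP C3] pC.
  have sC : C \subset ground M by case/circuitP: cC.
  split=> //; apply: (rim_triangle (ltnW k3) wN k4).
    by rewrite in_set (isomorphism_circuit iso) // (isomorphism_card iso) // C3.
  by rewrite -e imset_f.
case/card_gt1P: p_tri => C [D [/tri[sC eC] /tri[sD eD]]].
have [inj_f _ _] := iso.
have inj (A A' : {set T}) : A \subset ground M -> A' \subset ground M ->
    f @: A = f @: A' -> A \subset A'.
  move=> sA sA' eA; apply/subsetP=> x xA; have : f x \in f @: A' by rewrite -eA imset_f.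
  case/imsetP=> y yA' exy; suff -> : x = y by [].
  by apply: inj_f exy; [apply: (subsetP sA) | apply: (subsetP sA')].
have eCD : f @: C = f @: D by rewrite eC eD.
by rewrite eqEsubset (inj C D) ?(inj D C).
Qed.

End Spokes.

Theorem theorem1p1 (T : finType) (M : matroid T)
    (M_simple : simple M) (M_min : minimally_degenerate 3 M) :
  #|ground M| <= 2 * mrank M /\
  (#|ground M| = 2 * mrank M <->
   (wheel_type M \/ whirl_type M \/ two_sum_type M)).
Proof.
split; first exact: min_degenerate_bound.
split=> [eE|[|[]]]; last first.
- case=> U [M1 [M2 [N [p [sum [f iso] t1 t2]]]]].
  rewrite (isomorphism_ground iso) (isomorphism_mrank iso).
  have c1 : #|ground M1| = 2 * mrank M1.
    by case: t1 => [/wheel_spoke_type_card|/whirl_spoke_type_card].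
  have c2 : #|ground M2| = 2 * mrank M2.
    by case: t2 => [/wheel_spoke_type_card|/whirl_spoke_type_card].
  have [] := two_sum_card sum; rewrite c1 c2; clear; lia.
- exact: whirl_type_card.
- exact: wheel_type_card.
have extM := min_degenerate_extremal M_simple M_min eE.
have tauM := extremal_tight_family extM.
(* Tight sets are odd, so a side that is not a singleton has at least three elements, as the
   construction of the parts requires. *)
have [/existsP[A /and4P[tA tB A1 B1]]|no] := boolP [exists A : {set T},
    [&& tight M A, tight M (ground M :\: A), #|A| != 1 & #|ground M :\: A| != 1]].
  right; right; set B := ground M :\: A in tB B1.
  have sA := tight_sub tauM tA.
  have ge3 X : tight M X -> #|X| != 1 -> 2 < #|X|.
    by move/(tight_odd tauM); case: #|X| => [|[|[]]].
  have A3 := ge3 _ tA A1; have B3 := ge3 _ tB B1.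
  have AUB : A :|: B = ground M by rewrite setUC -[RHS](setID _ A) (setIidPr sA) setUC.
  have BUA : B :|: A = ground M by rewrite setUC.
  have dAB : [disjoint A & B] by rewrite -setI_eq0 setIDA (setIidPl sA) setDv.
  have dBA : [disjoint B & A] by rewrite disjoint_sym.
  pose rAB := split_rank extM AUB dAB tA tB.
  pose rBA := split_rank extM BUA dBA tB tA.
  exists (option T), (side AUB dAB rAB), (side BUA dBA rBA), (lift_option M), None.
  split.
  - by apply: is_two_sum_sides; apply: ltnW.
  - exact: lift_option_isomorphic.
  - apply: basepoint_spoke; last exact: setU11.
    + exact: extremal_side.
    + exact: unsplittable_side.
    + exact: basepoint_triangles.
  apply: basepoint_spoke; last exact: setU11.
  - exact: extremal_side.
  - exact: unsplittable_side.
  - exact: basepoint_triangles.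
have conn : unsplittable (ground M) (tight M).
  move=> A tA tB; have [A1|A1] := eqVneq #|A| 1; first by left.
  have [B1|B1] := eqVneq #|ground M :\: A| 1; first by right.
  by case/existsP: no; exists A; apply/and4P.
have [[k [N [f [k3 wN iso]]]]|w] := unsplittable_wheel_or_whirl extM conn.
  by left; exists k, N; split=> //; exists f.
by right; left.
Qed.
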